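(* Let $A$ be a unitary $*$-algebra over a field $F$ of characteristic zero with quadratic codimension growth. Then $A$ is $T_*$-equivalent to a finite direct sum of $*$-algebras in the set $\mathcal{I}$ with at least one direct summand belonging to $\widetilde{\mathcal{I}}$, where $$\mathcal{I} = \{F,\ C_2^{gr},\ C_{2,*},\ C_{2,*}^{gr},\ C_{3,i_1}^{gr},\ C_{3,i_2},\ C_{3,i_3}^{gr},\ U_{3,*},\ U_{3,*}^{gri},\ N_{3,*},\ N_{3,*}^{gri},\ \mathcal{G}_{2,\psi}^{gr},\ \mathcal{G}_{2,\tau},\ \mathcal{G}_{2,\tau}^{gr},\ \mathcal{G}_{2,\tau}^{gri},\ \mathcal{G}_{2,\gamma}^{gr},\ \mathcal{G}_{2,\gamma}^{gri},\ W_{\eta_1}^{gri},\ W_{\eta_2}^{gr},\ W_{\eta_3}^{gri}\}$$ and $\widetilde{\mathcal{I}}=\mathcal{I}\setminus\{F,\ C_2^{gr},\ C_{2,*},\ C_{2,*}^{gr}\}$.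
   Context: Throughout, $F$ is a field of characteristic zero and algebras are associative over $F$. A superalgebra is an algebra $A=A_0\oplus A_1$ with $A_iA_j\subseteq A_{i+j}$ (indices mod 2); we also write $A=(A_0,A_1)$. The trivial grading is $(A,0)$. A superinvolution on $A$ is a linear map $*:A\to A$ with $A_i^*\subseteq A_i$, $(a^* )^*=a$ and $(ab)^*=(-1)^{|a||b|}b^*a^*$ for all homogeneous $a,b$ (of degrees $|a|,|b|$). A $*$-algebra is a superalgebra with a superinvolution; it is unitary if it has a unit. Put $A_i^{+}=\{a\in A_i: a^*=a\}$, $A_i^-=\{a\in A_i:a^*=-a\}$. Direct sums carry the componentwise grading and superinvolution. $F$ itself is a $*$-algebra with trivial grading and identity superinvolution. Let $\mathcal F$ be the free associative algebra on the disjoint sets $X_i^\varepsilon=\{x_{1,i}^\varepsilon,x_{2,i}^\varepsilon,\dots\}$, $i\in\{0,1\}$, $\varepsilon\in\{+,-\}$, where variables in $X_i^\varepsilon$ have degree $i$ and are symmetric ($\varepsilon=+$) or skew ($\varepsilon=-$). A polynomial $f\in\mathcal F$ is a $*$-identity of $A$ if it vanishes under all substitutions sending each $x_{j,i}^\varepsilon$ into $A_i^\varepsilon$; $\mathrm{Id}^*(A)$ is the set of all $*$-identities. $A$ and $B$ are $T_*$-equivalent if $\mathrm{Id}^*(A)=\mathrm{Id}^*(B)$. $P_n^*$ is the span of all $w_{\sigma(1)}\cdots w_{\sigma(n)}$ with $\sigma\in S_n$ and $w_j\in\{x_{j,0}^+,x_{j,0}^-,x_{j,1}^+,x_{j,1}^-\}$,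 and $c_n^*(A)=\dim_F P_n^*/(P_n^*\cap \mathrm{Id}^*(A))$. $A$ has quadratic codimension growth if $c_n^*(A)\approx\alpha n^2$ for some $\alpha\neq0$, i.e. $\lim_{n\to\infty} c_n^*(A)/(\alpha n^2)=1$. The algebras (with $e_{ij}$ matrix units): (1) $C_2=\{a(e_{11}+e_{22})+be_{12}\}$, $a,b\in F$. $C_{2,*}$: trivial grading, superinvolution $b\mapsto -b$. $C_2^{gr}$: grading $(F(e_{11}+e_{22}),Fe_{12})$, identity superinvolution. $C_{2,*}^{gr}$: the same grading, superinvolution $b\mapsto-b$. (2) $C_3=\{a(e_{11}+e_{22}+e_{33})+b(e_{12}+e_{23})+ce_{13}\}$, $a,b,c\in F$. Maps: $i_1:(a,b,c)\mapsto(a,b,-c)$, $i_2:(a,b,c)\mapsto(a,-b,c)$, $i_3:(a,b,c)\mapsto(a,-b,-c)$. $C_{3,i_2}$: trivial grading, superinvolution $i_2$. $C_{3,i_1}^{gr}$, $C_{3,i_3}^{gr}$: grading $(F(e_{11}+e_{22}+e_{33})+Fe_{13},\,F(e_{12}+e_{23}))$ with superinvolution $i_1$, resp. $i_3$. (3) Inside the $6\times6$ upper triangular matrices, with $I_6$ the identity and $E=e_{23}+e_{45}$: $N_3=\mathrm{span}\{I_6,E,e_{12}-e_{56},e_{13},e_{46}\}$, $U_3=\mathrm{span}\{I_6,E,e_{12}+e_{56},e_{13},e_{46}\}$. The reflection superinvolution is $e_{ij}\mapsto e_{7-j,7-i}$. $N_{3,*},U_{3,*}$: trivial grading and reflection superinvolution.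 $N_{3,*}^{gri},U_{3,*}^{gri}$: reflection superinvolution and the elementary grading induced by $(g_1,\dots,g_6)=(0,1,1,0,0,1)$, i.e. $e_{ij}$ has degree $g_i+g_j \bmod 2$. (4) $\mathcal G_2=\langle 1,e_1,e_2\mid e_ie_j=-e_je_i,\ i,j=1,2\rangle$ (basis $1,e_1,e_2,e_1e_2$). Gradings: $\mathcal G_2$ trivial; $\mathcal G_2^{gr}=(F1+Fe_1e_2,\,Fe_1+Fe_2)$; $\mathcal G_2^{gri}=(F1+Fe_1,\,Fe_2+Fe_1e_2)$. Superinvolutions determined by $\psi(e_i)=e_i$, $\tau(e_i)=-e_i$, $\gamma(e_i)=(-1)^ie_i$ ($i=1,2$). For $\star\in\{\psi,\tau,\gamma\}$, $\mathcal G_{2,\star}$, $\mathcal G_{2,\star}^{gr}$, $\mathcal G_{2,\star}^{gri}$ denote these superalgebras with superinvolution $\star$. (5) $W=\{a(e_{11}+e_{22}+e_{33}+e_{44})+b(e_{12}+e_{34})+c(e_{13}+e_{24})+de_{14}\}$, $a,b,c,d\in F$. Maps: $\eta_1:(a,b,c,d)\mapsto(a,-b,c,-d)$, $\eta_2:(a,b,c,d)\mapsto(a,-b,c,d)$, $\eta_3:(a,b,c,d)\mapsto(a,-b,-c,d)$. $W_{\eta_2}^{gr}$: grading $(F(e_{11}+\cdots+e_{44})+Fe_{14},\,F(e_{12}+e_{34})+F(e_{13}+e_{24}))$, superinvolution $\eta_2$. $W_{\eta_1}^{gri}$, $W_{\eta_3}^{gri}$: grading $(F(e_{11}+\cdots+e_{44})+F(e_{12}+e_{34}),\,F(e_{13}+e_{24})+Fe_{14})$,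 superinvolution $\eta_1$, resp. $\eta_3$. *)

(* Defs.v *)
From HB Require Import structures.
From mathcomp Require Import all_boot all_order all_algebra all_fingroup all_field.
From mathcomp Require Import boolp classical_sets reals topology normedtype sequences.
(* The notations of monalg clash with those of MathComp-Analysis. *)
From mathcomp Require Import -(notations) monalg.
From mathcomp Require Import ring zify.

Set Implicit Arguments.
Unset Strict Implicit.
Unset Printing Implicit Defensive.

Import Order.TTheory GRing.Theory Num.Theory.
Import numFieldNormedType.Exports.

Local Open Scope classical_set_scope.
Local Open Scope ring_scope.

(* Unitary *-algebras.  Degrees are booleans (false = 0, true = 1) and degrees
   add with (+).  An algType is unitary and nonzero; the zero algebra does not
   have quadratic codimension growth. *)
Record staralg (F : fieldType) : Type := StarAlg {
  scar :> algType F;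
  homog : bool -> set scar;
  star : scar -> scar;
  homog0 : forall i, homog i 0;
  homogP : forall i (c : F) x y,
    homog i x -> homog i y -> homog i (c *: x + y);
  homog_sum : forall x, exists y z,
    [/\ homog false y, homog true z & x = y + z];
  homog_cap : forall x, homog false x -> homog true x -> x = 0;
  homogM : forall i j x y,
    homog i x -> homog j y -> homog (i (+) j) (x * y);
  star_linear : linear star;
  star_homog : forall i x, homog i x -> homog i (star x);
  starK : involutive star;
  starM : forall i j x y, homog i x -> homog j y ->
    star (x * y) = (-1) ^+ (i && j) *: (star y * star x)
}.

(* The space A_i^+ (e = false) or A_i^- (e = true). *)
Definition homog_sgn F (A : staralg F) (i e : bool) : set A :=
  [set x | homog i x /\ star x = (-1) ^+ e *: x].

(* ((i, e), j) stands for the variable x_{j,i}^e, where e = false is + and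
   e = true is -. *)
Definition var : choiceType := (bool * bool * nat)%type.

Definition freestar (F : fieldType) : lalgType F := malg (fmonom var) F.

Definition fvar (F : fieldType) (x : var) : freestar F := mkmalgU (fmu x) 1.

Definition feval F (A : staralg F) (v : var -> A) (f : freestar F) : A :=
  mmap (in_alg A) (fun m : fmonom var => \prod_(x <- (m : seq var)) v x) f.

Definition Idstar F (A : staralg F) : set (freestar F) :=
  [set f | forall v : var -> A,
    (forall i e j, homog_sgn i e (v ((i, e), j))) -> feval v f = 0].

Definition Tequiv F (A B : staralg F) : Prop := Idstar A = Idstar B.

(* The monomial w_{s(1)} ... w_{s(n)} with w_j = x_{j,i}^e for (i, e) = w j. *)
Definition mlmonom (F : fieldType) n (s : 'S_n)
    (w : {ffun 'I_n -> bool * bool}) : freestar F :=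
  \prod_(k < n) fvar F (w (s k), s k : nat).

Definition Pstar (F : fieldType) n : set (freestar F) :=
  [set f | exists c : 'S_n * {ffun 'I_n -> bool * bool} -> F,
    f = \sum_p c p *: mlmonom F p.1 p.2].

(* The quotient of the space P by the space P `&` Q has dimension d: the
   classes of b_0, ..., b_(d-1) form a basis of it. *)
Definition quotient_dim (F : fieldType) (V : lmodType F) (P Q : set V)
    (d : nat) : Prop :=
  exists b : 'I_d -> V,
    [/\ forall i, P (b i),
        forall x, P x -> exists c : 'I_d -> F,
          (P `&` Q) (x - \sum_i c i *: b i)
      & forall c : 'I_d -> F,
          (P `&` Q) (\sum_i c i *: b i) -> forall i, c i = 0].

Definition is_codim F (A : staralg F) (n d : nat) : Prop :=
  quotient_dim (@Pstar F n) (Idstar A) d.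

Definition quadratic_growth (R : realType) F (A : staralg F) : Prop :=
  exists2 c : nat -> nat, forall n, is_codim A n (c n) &
  exists2 alpha : R, alpha != 0 &
    (fun n => (c n)%:R / (alpha * n%:R ^+ 2)) @ \oo --> (1 : R).

Section DirectSum.
Variables (F : fieldType) (A B : staralg F).

Let T : algType F := (A * B)%type.
Let hom (i : bool) : set T := [set x | homog i x.1 /\ homog i x.2].
Let st (x : T) : T := (star x.1, star x.2).

Fact dsum2_homog0 i : hom i 0.
Proof. by split; apply: homog0. Qed.

Fact dsum2_homogP i (c : F) x y : hom i x -> hom i y -> hom i (c *: x + y).
Proof. by move=> [? ?] [? ?]; split; apply: homogP. Qed.

Fact dsum2_homog_sum x :
  exists y z, [/\ hom false y, hom true z & x = y + z].
Proof.
have [y1 [z1 [? ? e1]]] := homog_sum x.1.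
have [y2 [z2 [? ? e2]]] := homog_sum x.2.
exists (y1, y2), (z1, z2); split=> //.
by case: x e1 e2 => x1 x2 /= -> ->.
Qed.

Fact dsum2_homog_cap x : hom false x -> hom true x -> x = 0.
Proof.
case: x => x1 x2 [/= a b] [/= c d].
by rewrite (homog_cap a c) (homog_cap b d).
Qed.

Fact dsum2_homogM i j x y : hom i x -> hom j y -> hom (i (+) j) (x * y).
Proof. by move=> [? ?] [? ?]; split; apply: homogM. Qed.

Fact dsum2_star_linear : linear st.
Proof. by move=> c x y; rewrite /st /= !star_linear. Qed.

Fact dsum2_star_homog i x : hom i x -> hom i (st x).
Proof. by move=> [? ?]; split; apply: star_homog. Qed.

Fact dsum2_starK : involutive st.
Proof. by case=> x y; rewrite /st /= !starK. Qed.

Fact dsum2_starM i j x y : hom i x -> hom j y ->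
  st (x * y) = (-1) ^+ (i && j) *: (st y * st x).
Proof.
by move=> [? ?] [? ?]; rewrite /st /= (@starM _ A i j) // (@starM _ B i j).
Qed.

Definition dsum2 : staralg F :=
  StarAlg dsum2_homog0 dsum2_homogP dsum2_homog_sum dsum2_homog_cap
    dsum2_homogM dsum2_star_linear dsum2_star_homog dsum2_starK dsum2_starM.

End DirectSum.

(* The direct sum of the nonempty family A :: s. *)
Fixpoint dsum F (A : staralg F) (s : seq (staralg F)) : staralg F :=
  if s is B :: s' then dsum2 A (dsum B s') else A.

Section BaseField.
Variable F : fieldType.

Let hom (i : bool) : set F^o := [set x | i -> x = 0].

Fact base_homog0 i : hom i 0. Proof. by []. Qed.

Fact base_homogP i (c : F) x y : hom i x -> hom i y -> hom i (c *: x + y).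
Proof. by move=> hx hy /[dup] /hx-> /hy->; rewrite scaler0 addr0. Qed.

Fact base_homog_sum x : exists y z, [/\ hom false y, hom true z & x = y + z].
Proof. by exists x, 0; rewrite addr0. Qed.

Fact base_homog_cap x : hom false x -> hom true x -> x = 0.
Proof. by move=> _; apply. Qed.

Fact base_homogM i j x y : hom i x -> hom j y -> hom (i (+) j) (x * y).
Proof.
rewrite /hom /=; case: i j => [] [] //= hx hy _.
  by rewrite hx // mul0r.
by rewrite hy // mulr0.
Qed.

Fact base_starM i j x y : hom i x -> hom j y ->
  id (x * y) = (-1) ^+ (i && j) *: (y * x : F^o).
Proof.
rewrite /hom /= mulrC; case: i j => [] [] hx hy; rewrite ?expr0 ?scale1r //.
by rewrite hx // mulr0 scaler0.
Qed.

Definition baseF : staralg F :=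
  @StarAlg F F^o hom id base_homog0 base_homogP base_homog_sum base_homog_cap
    base_homogM (fun _ _ _ => erefl) (fun _ _ => id) (fun _ => erefl)
    base_starM.

End BaseField.

(* *-algebras carried by a unitary subalgebra A of a matrix algebra; D is the
   grading and s induces the superinvolution (its values outside A do not
   matter). *)

Record superinv_mx (F : fieldType) n (A : {vspace 'M[F]_n.+1})
    (D : bool -> {vspace 'M[F]_n.+1}) (s : 'M[F]_n.+1 -> 'M[F]_n.+1) : Prop :=
  SuperinvMx {
  simx_1 : 1 \in D false;
  simx_sum : (D false + D true)%VS = A;
  simx_cap : (D false :&: D true)%VS = 0%VS;
  simx_mul : forall i j, {in D i & D j, forall x y, x * y \in D (i (+) j)};
  simx_lin : linear s;
  simx_homog : forall i, {in D i, forall x, s x \in D i};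
  simx_K : {in A, forall x, s (s x) = x};
  simx_M : forall i j, {in D i & D j, forall x y,
    s (x * y) = (-1) ^+ (i && j) *: (s y * s x)}
}.

Section SubMatrix.
Variables (F : fieldType) (n : nat) (A : {vspace 'M[F]_n.+1}).
Variables (D : bool -> {vspace 'M[F]_n.+1}) (s : 'M[F]_n.+1 -> 'M[F]_n.+1).
Hypothesis H : superinv_mx A D s.

Let DA i x : x \in D i -> x \in A.
Proof.
by rewrite -(simx_sum H); case: i; apply: subvP; rewrite ?addvSl ?addvSr.
Qed.

Fact mxstar_aspace_proof : is_aspace A.
Proof.
apply/andP; split; first by rewrite has_algid1 // (DA (simx_1 H)).
apply/prodvP=> x y; rewrite -{1 2}(simx_sum H).
move=> /memv_addP[x0 hx0 [x1 hx1 ->]] /memv_addP[y0 hy0 [y1 hy1 ->]].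
by rewrite mulrDl !mulrDr !memvD //;
  (apply: DA; apply: (simx_mul H); eassumption).
Qed.

Definition mxstar_aspace : {aspace 'M[F]_n.+1} := ASpace mxstar_aspace_proof.

Let T : algType F := subvs_of mxstar_aspace.
Let hom (i : bool) : set T := [set x | vsval x \in D i].
Let st (x : T) : T := vsproj mxstar_aspace (s (vsval x)).

Let sA x : x \in A -> s x \in A.
Proof.
rewrite -{1}(simx_sum H) => /memv_addP[x0 hx0 [x1 hx1 ->]].
have := simx_lin H 1 x0 x1; rewrite !scale1r => ->.
by rewrite memvD //; (apply: DA; apply: (simx_homog H); eassumption).
Qed.

Let stE x : vsval (st x) = s (vsval x).
Proof. by rewrite /st vsprojK // sA // subvsP. Qed.

Fact mxstar_homog0 i : hom i 0. Proof. exact: mem0v. Qed.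

Fact mxstar_homogP i (c : F) x y : hom i x -> hom i y -> hom i (c *: x + y).
Proof. by rewrite /hom /= => hx hy; rewrite memvD ?memvZ. Qed.

Fact mxstar_homog_sum x :
  exists y z, [/\ hom false y, hom true z & x = y + z].
Proof.
have : vsval x \in (D false + D true)%VS by rewrite (simx_sum H) subvsP.
move=> /memv_addP[y hy [z hz e]].
have yA := DA hy; have zA := DA hz.
exists (vsproj mxstar_aspace y), (vsproj mxstar_aspace z).
rewrite /hom /= !vsprojK //; split=> //.
by apply: subvs_inj; rewrite /= !vsprojK.
Qed.

Fact mxstar_homog_cap x : hom false x -> hom true x -> x = 0.
Proof.
move=> h0 h1; apply: subvs_inj; apply/eqP; rewrite -memv0 -(simx_cap H).
by rewrite memv_cap h0 h1.
Qed.

Fact mxstar_homogM i j x y : hom i x -> hom j y -> hom (i (+) j) (x * y).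
Proof. by move=> hx hy; apply: (simx_mul H hx hy). Qed.

Fact mxstar_star_linear : linear st.
Proof. by move=> c x y; apply: subvs_inj; rewrite /= !stE /= (simx_lin H). Qed.

Fact mxstar_star_homog i x : hom i x -> hom i (st x).
Proof. by move=> hx; rewrite /hom /= stE; apply: (simx_homog H hx). Qed.

Fact mxstar_starK : involutive st.
Proof. by move=> x; apply: subvs_inj; rewrite !stE (simx_K H) ?subvsP. Qed.

Fact mxstar_starM i j x y : hom i x -> hom j y ->
  st (x * y) = (-1) ^+ (i && j) *: (st y * st x).
Proof.
by move=> hx hy; apply: subvs_inj; rewrite /= !stE /=; apply: (simx_M H hx hy).
Qed.

Definition mxstaralg : staralg F :=
  StarAlg mxstar_homog0 mxstar_homogP mxstar_homog_sum mxstar_homog_cap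
    mxstar_homogM mxstar_star_linear mxstar_star_homog mxstar_starK mxstar_starM.

End SubMatrix.

Section GradedSpan.
Variables (F : fieldType) (n : nat).
Implicit Types bs : seq (bool * 'M[F]_n.+1).

Definition full_span bs : {vspace 'M[F]_n.+1} := <<[seq b.2 | b <- bs]>>%VS.

Definition graded_span bs (i : bool) : {vspace 'M[F]_n.+1} :=
  <<[seq b.2 | b <- bs & b.1 == i]>>%VS.

Lemma span_lin_ind (P : 'M[F]_n.+1 -> Prop) (X : seq 'M[F]_n.+1) :
  P 0 -> (forall c x y, P x -> P y -> P (c *: x + y)) ->
  (forall x, x \in X -> P x) -> forall x, x \in <<X>>%VS -> P x.
Proof.
move=> P0 PD; elim: X => [_ x|b X IH hX x].
  by rewrite span_nil memv0 => /eqP->.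
rewrite span_cons => /memv_addP[y /vlineP[c ->] [z hz ->]].
apply: PD; first by apply: hX; rewrite mem_head.
by apply: IH => // t tX; apply: hX; rewrite inE tX orbT.
Qed.

Lemma graded_span_sum bs :
  (graded_span bs false + graded_span bs true)%VS = full_span bs.
Proof.
rewrite /graded_span /full_span; elim: bs => [|[[] b] bs IH] /=.
- by rewrite !span_nil addv0.
- by rewrite !span_cons addvA [(_ + <[b]>)%VS]addvC -addvA IH.
- by rewrite !span_cons -addvA IH.
Qed.

Lemma graded_span_perm bs :
  perm_eq ([seq b.2 | b <- bs & b.1 == false] ++
           [seq b.2 | b <- bs & b.1 == true]) [seq b.2 | b <- bs].
Proof.
rewrite -map_cat; apply: perm_map.
rewrite (@eq_filter _ (fun b => b.1 == true) (predC (fun b => b.1 == false))).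
  by rewrite perm_filterC.
by case=> [[]].
Qed.

Lemma graded_spanP bs (s : 'M[F]_n.+1 -> 'M[F]_n.+1) :
  (false, 1) \in bs -> free [seq b.2 | b <- bs] -> linear s ->
  {in bs & bs, forall b b', b.2 * b'.2 \in graded_span bs (b.1 (+) b'.1)} ->
  {in bs, forall b, s b.2 \in graded_span bs b.1} ->
  {in bs, forall b, s (s b.2) = b.2} ->
  {in bs & bs, forall b b',
    s (b.2 * b'.2) = (-1) ^+ (b.1 && b'.1) *: (s b'.2 * s b.2)} ->
  superinv_mx (full_span bs) (graded_span bs) s.
Proof.
move=> h1 hf hl hm hh hk ha.
have s0 : s 0 = 0.
  by have := hl (-1) 0 0; rewrite !scaler0 addr0 => h; rewrite h scaleN1r addNr.
have ind i (P : 'M[F]_n.+1 -> Prop) : P 0 ->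
    (forall c x y, P x -> P y -> P (c *: x + y)) ->
    (forall b, b \in bs -> b.1 = i -> P b.2) ->
    forall x, x \in graded_span bs i -> P x.
  move=> P0 PD hP; apply: span_lin_ind => // x /mapP[b].
  by rewrite mem_filter => /andP[/eqP bi bb] ->; apply: hP.
split=> //.
- by apply: memv_span; apply/mapP; exists (false, 1) => //; rewrite mem_filter.
- exact: graded_span_sum.
- rewrite -(perm_free (graded_span_perm bs)) cat_free in hf.
  by case/and3P: hf => _ _ /directv_addP.
- move=> i j x y hx hy; move: y hy; apply: (ind).
  + by rewrite mulr0 mem0v.
  + by move=> c y z hy hz; rewrite mulrDr -scalerAr memvD ?memvZ.
  move=> b' hb' <-; move: x hx; apply: (ind).
  + by rewrite mul0r mem0v.
  + by move=> c y z hy hz; rewrite mulrDl -scalerAl memvD ?memvZ.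
  by move=> b hb <-; apply: hm.
- move=> i; apply: (ind).
  + by rewrite s0 mem0v.
  + by move=> c y z hy hz; rewrite hl memvD ?memvZ.
  by move=> b hb <-; apply: hh.
- move=> x; apply: (span_lin_ind (P := fun x => s (s x) = x)).
  + by rewrite !s0.
  + by move=> c y z hy hz; rewrite !hl hy hz.
  by move=> y /mapP[b hb ->]; apply: hk.
- move=> i j x y hx hy; move: y hy; apply: (ind).
  + by rewrite mulr0 s0 mul0r scaler0.
  + move=> c y z hy hz; rewrite mulrDr -scalerAr !hl hy hz mulrDl -scalerAl.
    by rewrite scalerDr !scalerA mulrC.
  move=> b' hb' <-; move: x hx; apply: (ind).
  + by rewrite mul0r s0 mulr0 scaler0.
  + move=> c y z hy hz; rewrite mulrDl -scalerAl !hl hy hz mulrDr -scalerAr.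
    by rewrite scalerDr !scalerA mulrC.
  by move=> b hb <-; apply: ha.
Qed.

Lemma superinv_mx_ext A (D D' : bool -> {vspace 'M[F]_n.+1}) s :
  D =1 D' -> superinv_mx A D s -> superinv_mx A D' s.
Proof. by move=> /boolp.funext ->. Qed.

End GradedSpan.

Section MatrixUnits.
Variables (F : fieldType) (n : nat).

(* The matrix unit e_ij of size n+1, with i and j counted from 1. *)
Definition eu (i j : nat) : 'M[F]_n.+1 :=
  \matrix_(k, l) ((k.+1 == i) && (l.+1 == j))%:R.

Lemma mul_eu i j k l :
  eu i j * eu k l = ((j == k) && (0 < j <= n.+1)%N)%:R *: eu i l.
Proof.
apply/matrixP=> a b; rewrite !mxE.
have [j0|] := boolP (0 < j <= n.+1)%N; last first.
  move=> jn; rewrite andbF mul0r big1 // => m _; rewrite !mxE.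
  suff -> : (m.+1 == j) = false by rewrite andbF mul0r.
  by apply: contraNF jn => /eqP<-; rewrite ltn_ord.
case: j j0 => // j /= jn.
rewrite (bigD1 (Ordinal jn)) //= big1 ?addr0 => [|m mj]; last first.
  rewrite !mxE (_ : (m.+1 == j.+1) = false) ?andbF ?mul0r //.
  by apply/negbTE; apply: contraNneq mj => -[e]; apply/eqP/val_inj.
rewrite !mxE /= eqxx !andbT -!natrM !mulnb.
by case: (a.+1 == i) (j.+1 == k) => [] [].
Qed.

End MatrixUnits.
Arguments eu {F n}.


Section SuperinvTools.
Variables (F : fieldType) (n : nat).
Implicit Types (bs : seq (bool * 'M[F]_n.+1)) (s : 'M[F]_n.+1 -> 'M[F]_n.+1).

Lemma memv_graded bs i b : (i, b) \in bs -> b \in graded_span bs i.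
Proof.
move=> h; apply: memv_span; apply/mapP; exists (i, b) => //.
by rewrite mem_filter eqxx.
Qed.

Lemma linear_fun0 s : linear s -> s 0 = 0.
Proof.
by move=> h; have := h (-1) 0 0; rewrite scaler0 addr0 scaleN1r addNr.
Qed.

Lemma linear_funZ s : linear s -> forall c x, s (c *: x) = c *: s x.
Proof. by move=> h c x; rewrite -[c *: x]addr0 h (linear_fun0 h) addr0. Qed.

End SuperinvTools.

Ltac graded_mem := rewrite ?memv0 ?mem0v //; try apply: memvZ;
  by apply: memv_graded; rewrite !inE eqxx ?orbT.

Ltac mul_simp E := rewrite ?E ?(mul1r, mulr1, mul0r, mulr0, scaler0, addbF,
  addFb, andbF, expr0, scale1r) -?(scalerAl, scalerAr)
  ?E ?(mul1r, mulr1, mul0r, mulr0, scaler0) //.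

Ltac eu_simp :=
  rewrite ?(mulrDl, mulrDr, mulNr, mulrN)
    -?(scalerAl, scalerAr) ?mul_eu /=
    ?(scale0r, scaler0, scale1r, addr0, add0r, oppr0, opprK).

Ltac mx_entries := rewrite !mxE /= ?(mulr0, mulr1, mul0r, add0r, addr0,
  mulr0n, mulr1n, oppr0).

Section SuperinvFamilies.
Variables (F : fieldType) (n : nat).
Implicit Types (b c d : 'M[F]_n.+1) (s : 'M[F]_n.+1 -> 'M[F]_n.+1).

Lemma superinv_dim2 b s (d1 t1 : bool) :
  let bs := [:: (false, 1); (d1, b)] in
  b * b = 0 -> free [seq x.2 | x <- bs] ->
  linear s -> s 1 = 1 -> s b = (-1) ^+ t1 *: b ->
  superinv_mx (full_span bs) (graded_span bs) s.
Proof.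
move=> bs bb hf hl s1 sb.
rewrite {}/bs in hf *.
have s0 := linear_fun0 hl; have sZ := linear_funZ hl.
have mulE := bb; have sE := (s0, s1, sb, sZ).
clear s0 s1 sb sZ.
apply: graded_spanP => //; clear hl.
- exact: mem_head.
- move=> x y; rewrite !inE => /orP[]/eqP-> /orP[]/eqP->;
  rewrite /=; mul_simp mulE; rewrite ?addbb; graded_mem.
- by move=> x; rewrite !inE => /orP[]/eqP->; rewrite /= !sE; graded_mem.
- by move=> x; rewrite !inE => /orP[]/eqP->;
  rewrite /= ?sE ?scalerA -?signr_addb ?addbb ?expr0 ?scale1r.
- move=> x y; rewrite !inE => /orP[]/eqP-> /orP[]/eqP->;
  rewrite /=; mul_simp mulE; rewrite ?sE; mul_simp mulE;
  rewrite ?scalerA -?signr_addb;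
  by case: d1 t1 {hf sE} => [] [].
Qed.

Lemma superinv_dim3 b c s (d1 t1 : bool) :
  let bs := [:: (false, 1); (d1, b); (false, c)] in
  b * b = c -> b * c = 0 -> c * b = 0 -> c * c = 0 ->
  free [seq x.2 | x <- bs] ->
  linear s -> s 1 = 1 -> s b = (-1) ^+ t1 *: b -> s c = (-1) ^+ d1 *: c ->
  superinv_mx (full_span bs) (graded_span bs) s.
Proof.
move=> bs bb bc cb cc hf hl s1 sb sc.
rewrite {}/bs in hf *.
have s0 := linear_fun0 hl; have sZ := linear_funZ hl.
have mulE := (bb, bc, cb, cc); have sE := (s0, s1, sb, sc, sZ).
clear s0 s1 sb sc sZ bb bc cb cc.
apply: graded_spanP => //; clear hl.
- exact: mem_head.
- move=> x y; rewrite !inE => /or3P[]/eqP-> /or3P[]/eqP->;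
  rewrite /=; mul_simp mulE; rewrite ?addbb; graded_mem.
- by move=> x; rewrite !inE => /or3P[]/eqP->; rewrite /= !sE; graded_mem.
- by move=> x; rewrite !inE => /or3P[]/eqP->;
  rewrite /= ?sE ?scalerA -?signr_addb ?addbb ?expr0 ?scale1r.
- move=> x y; rewrite !inE => /or3P[]/eqP-> /or3P[]/eqP->;
  rewrite /=; mul_simp mulE; rewrite ?sE; mul_simp mulE;
  rewrite ?scalerA -?signr_addb;
  by case: d1 t1 {hf sE mulE} => [] [].
Qed.

Lemma superinv_dim4 b c d s (eps d1 d2 t1 t2 : bool) :
  let bs := [:: (false, 1); (d1, b); (d2, c); (d1 (+) d2, d)] in
  b * b = 0 -> c * c = 0 -> b * c = d -> c * b = (-1) ^+ eps *: d ->
  free [seq x.2 | x <- bs] ->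
  linear s -> s 1 = 1 -> s b = (-1) ^+ t1 *: b -> s c = (-1) ^+ t2 *: c ->
  s d = (-1) ^+ ((d1 && d2) (+) eps (+) t1 (+) t2) *: d ->
  superinv_mx (full_span bs) (graded_span bs) s.
Proof.
move=> bs bb cc bc cb hf hl s1 sb sc sd.
rewrite {}/bs in hf *.
have s0 := linear_fun0 hl; have sZ := linear_funZ hl.
have bd : b * d = 0 by rewrite -bc mulrA bb mul0r.
have dc : d * c = 0 by rewrite -bc -mulrA cc mulr0.
have db : d * b = 0 by rewrite -bc -mulrA cb -scalerAr bd scaler0.
have cd : c * d = 0 by rewrite -bc mulrA cb -scalerAl dc scaler0.
have dd : d * d = 0 by rewrite -{1}bc -mulrA cd mulr0.
have mulE := (bb, bc, cb, cc, bd, dc, db, cd, dd).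
have sE := (s0, s1, sb, sc, sd, sZ).
clear s0 s1 sb sc sd sZ bb bc cb cc bd dc db cd dd.
apply: graded_spanP => //; clear hl.
- exact: mem_head.
- move=> x y; rewrite !inE => /or4P[]/eqP-> /or4P[]/eqP->;
  rewrite /=; mul_simp mulE; rewrite ?addbb ?[d2 (+) d1]addbC; graded_mem.
- by move=> x; rewrite !inE => /or4P[]/eqP->; rewrite /= !sE; graded_mem.
- by move=> x; rewrite !inE => /or4P[]/eqP->;
  rewrite /= ?sE ?scalerA -?signr_addb ?addbb ?expr0 ?scale1r.
- move=> x y; rewrite !inE => /or4P[]/eqP-> /or4P[]/eqP->;
  rewrite /=; mul_simp mulE; rewrite ?sE; mul_simp mulE;
  rewrite ?scalerA -?signr_addb;
  by case: t1 t2 d1 d2 eps {hf sE mulE} => [] [] [] [] [].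
Qed.

Lemma superinv_dim5 E p q r s (eps d1 : bool) :
  let bs := [:: (false, 1); (false, E); (d1, p); (d1, q); (d1, r)] in
  E * E = 0 -> E * p = (-1) ^+ eps *: r -> E * q = 0 -> E * r = 0 ->
  p * E = q -> p * p = 0 -> p * q = 0 -> p * r = 0 ->
  q * E = 0 -> q * p = 0 -> q * q = 0 -> q * r = 0 ->
  r * E = 0 -> r * p = 0 -> r * q = 0 -> r * r = 0 ->
  free [seq x.2 | x <- bs] ->
  linear s -> s 1 = 1 -> s E = E -> s p = (-1) ^+ eps *: p ->
  s q = r -> s r = q ->
  superinv_mx (full_span bs) (graded_span bs) s.
Proof.
move=> bs e1 e2 e3 e4 e5 e6 e7 e8 e9 e10 e11 e12 e13 e14 e15 e16.
move=> hf hl s1 sb sc sd se.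
rewrite {}/bs in hf *.
have s0 := linear_fun0 hl; have sZ := linear_funZ hl.
have mulE := (e1, e2, e3, e4, e5, e6, e7, e8, e9, e10, e11, e12, e13, e14,
  e15, e16).
have sE := (s0, s1, sb, sc, sd, se, sZ).
clear s0 s1 sb sc sd se sZ e1 e2 e3 e4 e5 e6 e7 e8 e9 e10 e11 e12 e13 e14 e15 e16.
apply: graded_spanP => //; clear hl.
- exact: mem_head.
- move=> x y; rewrite !inE => /or4P[|||/orP[]]/eqP-> /or4P[|||/orP[]]/eqP->;
  rewrite /=; mul_simp mulE; rewrite ?addbb; graded_mem.
- by move=> x; rewrite !inE => /or4P[|||/orP[]]/eqP->; rewrite /= !sE; graded_mem.
- by move=> x; rewrite !inE => /or4P[|||/orP[]]/eqP->;
  rewrite /= ?sE ?scalerA -?signr_addb ?addbb ?expr0 ?scale1r.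
- move=> x y; rewrite !inE => /or4P[|||/orP[]]/eqP-> /or4P[|||/orP[]]/eqP->;
  rewrite /=; mul_simp mulE; rewrite ?sE; mul_simp mulE;
  rewrite ?scalerA -?signr_addb ?addbb ?expr0 ?scale1r;
  by case: d1 eps {hf sE mulE} => [] [].
Qed.

End SuperinvFamilies.

Section C2.
Variable F : fieldType.

Definition C2elt (a b : F) : 'M[F]_2 := a%:M + b *: eu 1 2.

Definition C2basis (d : bool) : seq (bool * 'M[F]_2) :=
  [:: (false, 1); (d, eu 1 2)].

Definition C2neg (M : 'M[F]_2) : 'M[F]_2 := C2elt (M 0 0) (- M 0 1).

Lemma C2_free d : free [seq x.2 | x <- C2basis d].
Proof.
apply/(@freeP _ _ _ (in_tuple _)) => k /= /matrixP h i.
rewrite !big_ord_recl big_ord0 /= in h.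
have := h 0 0; have := h 0 1; mx_entries => h1 h0.
by case: i => [[|[|//]] hi]; [rewrite -h0|rewrite -h1]; congr k;
  apply: val_inj.
Qed.

Lemma C2_mulb : eu 1 2 * eu 1 2 = 0 :> 'M[F]_2.
Proof. by eu_simp. Qed.

Lemma C2_id_superinv d :
  superinv_mx (full_span (C2basis d)) (graded_span (C2basis d)) id.
Proof.
apply: (superinv_dim2 (t1 := false)) => //; first exact: C2_mulb.
  exact: C2_free.
by rewrite scale1r.
Qed.

Lemma C2_neg_superinv d :
  superinv_mx (full_span (C2basis d)) (graded_span (C2basis d)) C2neg.
Proof.
apply: (superinv_dim2 (t1 := true)); first exact: C2_mulb.
- exact: C2_free.
- by move=> c x y; apply/matrixP=> i j; rewrite !mxE; ring.
- by rewrite /C2neg /C2elt; mx_entries; rewrite scale0r addr0.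
- by rewrite /C2neg /C2elt; mx_entries; rewrite raddf0 add0r.
Qed.

Definition C2_gr : staralg F := mxstaralg (C2_id_superinv true).
Definition C2_star : staralg F := mxstaralg (C2_neg_superinv false).
Definition C2_star_gr : staralg F := mxstaralg (C2_neg_superinv true).

End C2.

Section C3.
Variable F : fieldType.

Definition C3elt (a b c : F) : 'M[F]_3 :=
  a%:M + b *: (eu 1 2 + eu 2 3) + c *: eu 1 3.

Definition C3basis (d : bool) : seq (bool * 'M[F]_3) :=
  [:: (false, 1); (d, eu 1 2 + eu 2 3); (false, eu 1 3)].

Definition C3_i1 (M : 'M[F]_3) := C3elt (M 0 0) (M 0 1) (- M 0 2).
Definition C3_i2 (M : 'M[F]_3) := C3elt (M 0 0) (- M 0 1) (M 0 2).
Definition C3_i3 (M : 'M[F]_3) := C3elt (M 0 0) (- M 0 1) (- M 0 2).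

Lemma C3_free d : free [seq x.2 | x <- C3basis d].
Proof.
apply/(@freeP _ _ _ (in_tuple _)) => k /= /matrixP h i.
rewrite !big_ord_recl big_ord0 /= in h.
have := h 0 0; have := h 0 1; have := h 0 2; mx_entries => h2 h1 h0.
by case: i => [[|[|[|//]]] hi]; [rewrite -h0|rewrite -h1|rewrite -h2];
  congr k; apply: val_inj.
Qed.

Lemma C3_superinv (d t1 : bool) (s : 'M[F]_3 -> 'M[F]_3) :
  linear s -> s 1 = 1 ->
  s (eu 1 2 + eu 2 3) = (-1) ^+ t1 *: (eu 1 2 + eu 2 3) ->
  s (eu 1 3) = (-1) ^+ d *: eu 1 3 ->
  superinv_mx (full_span (C3basis d)) (graded_span (C3basis d)) s.
Proof.
move=> h1 h2 h3 h4; apply: (superinv_dim3 (t1 := t1)) => //;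
  first [by eu_simp | exact: C3_free].
Qed.

Ltac C3_tac := rewrite ?/C3_i1 ?/C3_i2 ?/C3_i3 /C3elt; first
  [ by move=> c x y; apply/matrixP=> i j; rewrite !mxE; ring
  | by mx_entries; rewrite ?(raddf0, scale0r, scaleN1r, scale1r, addr0, add0r)].

Lemma C3_i1_superinv :
  superinv_mx (full_span (C3basis true)) (graded_span (C3basis true)) C3_i1.
Proof. by apply: (@C3_superinv true false); C3_tac. Qed.

Lemma C3_i2_superinv :
  superinv_mx (full_span (C3basis false)) (graded_span (C3basis false)) C3_i2.
Proof. by apply: (@C3_superinv false true); C3_tac. Qed.

Lemma C3_i3_superinv :
  superinv_mx (full_span (C3basis true)) (graded_span (C3basis true)) C3_i3.
Proof. by apply: (@C3_superinv true true); C3_tac. Qed.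

Definition C3_i1_gr : staralg F := mxstaralg C3_i1_superinv.
Definition C3_i2_triv : staralg F := mxstaralg C3_i2_superinv.
Definition C3_i3_gr : staralg F := mxstaralg C3_i3_superinv.

End C3.

Section W.
Variable F : fieldType.

Definition Welt (a b c d : F) : 'M[F]_4 :=
  a%:M + b *: (eu 1 2 + eu 3 4) + c *: (eu 1 3 + eu 2 4) + d *: eu 1 4.

(* d1 and d2 are the degrees of e_12 + e_34 and e_13 + e_24. *)
Definition Wbasis (d1 d2 : bool) : seq (bool * 'M[F]_4) :=
  [:: (false, 1); (d1, eu 1 2 + eu 3 4); (d2, eu 1 3 + eu 2 4);
      (d1 (+) d2, eu 1 4)].

Definition W_eta1 (M : 'M[F]_4) :=
  Welt (M 0 0) (- M 0 1) (M 0 2) (- M 0 3).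
Definition W_eta2 (M : 'M[F]_4) :=
  Welt (M 0 0) (- M 0 1) (M 0 2) (M 0 3).
Definition W_eta3 (M : 'M[F]_4) :=
  Welt (M 0 0) (- M 0 1) (- M 0 2) (M 0 3).

Lemma W_free d1 d2 : free [seq x.2 | x <- Wbasis d1 d2].
Proof.
apply/(@freeP _ _ _ (in_tuple _)) => k /= /matrixP h i.
rewrite !big_ord_recl big_ord0 /= in h.
have := h 0 0; have := h 0 1; have := h 0 2; have := h 0 3.
mx_entries => h3 h2 h1 h0.
by case: i => [[|[|[|[|//]]]] hi];
  [rewrite -h0|rewrite -h1|rewrite -h2|rewrite -h3]; congr k; apply: val_inj.
Qed.

Lemma W_superinv (d1 d2 t1 t2 : bool) (s : 'M[F]_4 -> 'M[F]_4) :
  linear s -> s 1 = 1 ->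
  s (eu 1 2 + eu 3 4) = (-1) ^+ t1 *: (eu 1 2 + eu 3 4) ->
  s (eu 1 3 + eu 2 4) = (-1) ^+ t2 *: (eu 1 3 + eu 2 4) ->
  s (eu 1 4) = (-1) ^+ ((d1 && d2) (+) false (+) t1 (+) t2) *: eu 1 4 ->
  superinv_mx (full_span (Wbasis d1 d2)) (graded_span (Wbasis d1 d2)) s.
Proof.
move=> h1 h2 h3 h4 h5.
by apply: (superinv_dim4 (eps := false) (t1 := t1) (t2 := t2)) => //;
  first [by eu_simp | exact: W_free].
Qed.

Ltac W_tac := rewrite ?/W_eta1 ?/W_eta2 ?/W_eta3 /Welt; first
  [ by move=> c x y; apply/matrixP=> i j; rewrite !mxE; ring
  | by mx_entries; rewrite ?(raddf0, scale0r, scaleN1r, scale1r, addr0, add0r)].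

Lemma W_eta1_superinv : superinv_mx (full_span (Wbasis false true))
  (graded_span (Wbasis false true)) W_eta1.
Proof. by apply: (@W_superinv _ _ true false); W_tac. Qed.

Lemma W_eta2_superinv : superinv_mx (full_span (Wbasis true true))
  (graded_span (Wbasis true true)) W_eta2.
Proof. by apply: (@W_superinv _ _ true false); W_tac. Qed.

Lemma W_eta3_superinv : superinv_mx (full_span (Wbasis false true))
  (graded_span (Wbasis false true)) W_eta3.
Proof. by apply: (@W_superinv _ _ true true); W_tac. Qed.

Definition W_eta1_gri : staralg F := mxstaralg W_eta1_superinv.
Definition W_eta2_gr : staralg F := mxstaralg W_eta2_superinv.
Definition W_eta3_gri : staralg F := mxstaralg W_eta3_superinv.

End W.

(* G_2, realized by the matrices of its right multiplications in the basis
   1, e_1, e_2, e_1 e_2; the lemmas below are its defining relations and the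
   freeness of that basis. *)
Section G2.
Variable F : fieldType.

Definition g1 : 'M[F]_4 := eu 1 2 - eu 3 4.
Definition g2 : 'M[F]_4 := eu 1 3 + eu 2 4.

Lemma g1g1 : g1 * g1 = - (g1 * g1).
Proof. by rewrite /g1; eu_simp. Qed.

Lemma g2g2 : g2 * g2 = - (g2 * g2).
Proof. by rewrite /g2; eu_simp. Qed.

Lemma g2g1 : g2 * g1 = - (g1 * g2).
Proof. by rewrite /g1 /g2; eu_simp. Qed.

(* d1 and d2 are the degrees of e_1 and e_2. *)
Definition G2basis (d1 d2 : bool) : seq (bool * 'M[F]_4) :=
  [:: (false, 1); (d1, g1); (d2, g2); (d1 (+) d2, g1 * g2)].

(* The map with e_i |-> (-1)^(t_i) e_i and
   e_1 e_2 |-> (-1)^(d1 d2) (e_2)^* (e_1)^*.  The first row of a matrix in G_2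
   holds its coordinates in the basis 1, e_1, e_2, e_1 e_2. *)
Definition G2star (d1 d2 t1 t2 : bool) (M : 'M[F]_4) : 'M[F]_4 :=
  let x1 := (-1) ^+ t1 *: g1 in
  let x2 := (-1) ^+ t2 *: g2 in
  M 0 0 *: 1 + M 0 1 *: x1 + M 0 2 *: x2
    + M 0 3 *: ((-1) ^+ (d1 && d2) *: (x2 * x1)).

Lemma g1g2 : g1 * g2 = eu 1 4.
Proof. by rewrite /g1 /g2; eu_simp. Qed.

Lemma G2_coords a b c d :
  let M := a *: 1 + b *: g1 + c *: g2 + d *: (g1 * g2) in
  [/\ M 0 0 = a, M 0 1 = b, M 0 2 = c & M 0 3 = d].
Proof. by rewrite g1g2 /g1 /g2; split; mx_entries. Qed.

Lemma G2_free d1 d2 : free [seq x.2 | x <- G2basis d1 d2].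
Proof.
apply/(@freeP _ _ _ (in_tuple _)) => k /= h i.
rewrite !big_ord_recl big_ord0 /= addr0 !addrA in h.
have := G2_coords (k ord0) (k (lift ord0 ord0))
  (k (lift ord0 (lift ord0 ord0))) (k (lift ord0 (lift ord0 (lift ord0 ord0)))).
rewrite /= h !mxE => -[h0 h1 h2 h3].
by case: i => [[|[|[|[|//]]]] hi];
  [rewrite h0|rewrite h1|rewrite h2|rewrite h3]; congr k; apply: val_inj.
Qed.

Lemma G2_superinv d1 d2 t1 t2 :
  superinv_mx (full_span (G2basis d1 d2)) (graded_span (G2basis d1 d2))
    (G2star d1 d2 t1 t2).
Proof.
apply: (superinv_dim4 (eps := true) (t1 := t1) (t2 := t2)) => //.
- by rewrite /g1; eu_simp.
- by rewrite /g2; eu_simp.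
- by rewrite g2g1 scaleN1r.
- exact: G2_free.
- by move=> c x y; apply/matrixP=> i j; rewrite !mxE; ring.
- have [] := G2_coords 1 0 0 0; rewrite !scale0r !addr0 scale1r.
  by rewrite /G2star => -> -> -> ->; rewrite !scale0r !addr0 scale1r.
- have [] := G2_coords 0 1 0 0; rewrite !scale0r !addr0 add0r scale1r.
  by rewrite /G2star => -> -> -> ->; rewrite !scale0r !addr0 add0r scale1r.
- have [] := G2_coords 0 0 1 0; rewrite !scale0r !addr0 !add0r scale1r.
  by rewrite /G2star => -> -> -> ->; rewrite !scale0r !addr0 !add0r scale1r.
- have [] := G2_coords 0 0 0 1; rewrite !scale0r !add0r scale1r.
  rewrite /G2star => -> -> -> ->; rewrite !scale0r !add0r scale1r.
  rewrite -scalerAl -scalerAr g2g1 scalerN -scaleN1r !scalerA.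
  by case: d1 d2 t1 t2 => [] [] [] []; congr (_ *: _); rewrite /=; ring.
Qed.

(* psi : e_i |-> e_i; tau : e_i |-> - e_i; gamma : e_i |-> (-1)^i e_i *)
Definition G2_psi_gr : staralg F :=
  mxstaralg (G2_superinv true true false false).
Definition G2_tau : staralg F := mxstaralg (G2_superinv false false true true).
Definition G2_tau_gr : staralg F := mxstaralg (G2_superinv true true true true).
Definition G2_tau_gri : staralg F := mxstaralg (G2_superinv false true true true).
Definition G2_gamma_gr : staralg F :=
  mxstaralg (G2_superinv true true true false).
Definition G2_gamma_gri : staralg F :=
  mxstaralg (G2_superinv false true true false).

End G2.

Section NU.
Variable F : fieldType.

(* The space U_3 (eps = false) or N_3 (eps = true), as a graded span in which
   e_12 +- e_56, e_13 and e_46 have degree d. *)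
Definition NUbasis (eps d : bool) : seq (bool * 'M[F]_6) :=
  [:: (false, 1); (false, eu 2 3 + eu 4 5);
      (d, eu 1 2 + (-1) ^+ eps *: eu 5 6); (d, eu 1 3); (d, eu 4 6)].

Definition U3basis : seq 'M[F]_6 :=
  [:: 1; eu 2 3 + eu 4 5; eu 1 2 + eu 5 6; eu 1 3; eu 4 6].

Definition N3basis : seq 'M[F]_6 :=
  [:: 1; eu 2 3 + eu 4 5; eu 1 2 - eu 5 6; eu 1 3; eu 4 6].

Definition U3 : {vspace 'M[F]_6} := <<U3basis>>%VS.
Definition N3 : {vspace 'M[F]_6} := <<N3basis>>%VS.

(* e_ij |-> e_(7-j)(7-i) *)
Definition reflection (M : 'M[F]_6) : 'M[F]_6 :=
  \matrix_(i, j) M (rev_ord j) (rev_ord i).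

Definition triv_grading n (A : {vspace 'M[F]_n.+1}) (i : bool) :
    {vspace 'M[F]_n.+1} := if i then 0%VS else A.

(* The grading of A induced by the elementary grading in which e_ij has degree
   g_i + g_j. *)
Definition elem_units n (g : seq bool) (i : bool) : seq 'M[F]_n.+1 :=
  [seq delta_mx p.1 p.2 | p : 'I_n.+1 * 'I_n.+1 <- enum {: 'I_n.+1 * 'I_n.+1}
     & nth false g p.1 (+) nth false g p.2 == i].

Definition elem_grading n (g : seq bool) (A : {vspace 'M[F]_n.+1}) (i : bool) :
    {vspace 'M[F]_n.+1} := (A :&: <<elem_units n g i>>)%VS.

Definition NUdegrees := [:: false; true; true; false; false; true].

Lemma U3E d : full_span (NUbasis false d) = U3.
Proof. by rewrite /full_span /= expr0 scale1r. Qed.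

Lemma N3E d : full_span (NUbasis true d) = N3.
Proof. by rewrite /full_span /= expr1 scaleN1r. Qed.

Lemma NU_free eps d : free [seq x.2 | x <- NUbasis eps d].
Proof.
apply/(@freeP _ _ _ (in_tuple _)) => k /= /matrixP h i.
rewrite !big_ord_recl big_ord0 /= in h.
have := h 0 0; have := h 1 2; have := h 0 1; have := h 0 2; have := h 3 5.
mx_entries => h4 h3 h2 h1 h0.
by case: i => [[|[|[|[|[|//]]]]] hi];
  [rewrite -h0|rewrite -h1|rewrite -h2|rewrite -h3|rewrite -h4];
  congr k; apply: val_inj.
Qed.

Lemma reflection_eu i j : (0 < i <= 6)%N -> (0 < j <= 6)%N ->
  reflection (eu i j) = eu (7 - j) (7 - i).
Proof.
case: i j => [|i] [|j] //= hi hj.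
apply/matrixP=> k l; rewrite !mxE /= andbC; congr ((_ && _)%:R);
  have := ltn_ord k; have := ltn_ord l; lia.
Qed.

Lemma reflection_lin : linear reflection.
Proof. by move=> c x y; apply/matrixP=> i j; rewrite !mxE. Qed.

Lemma NU_superinv eps d :
  superinv_mx (full_span (NUbasis eps d)) (graded_span (NUbasis eps d))
    reflection.
Proof.
have rD x y : reflection (x + y) = reflection x + reflection y.
  by apply/matrixP=> i j; rewrite !mxE.
have rZ c x : reflection (c *: x) = c *: reflection x.
  by apply/matrixP=> i j; rewrite !mxE.
apply: (superinv_dim5 (eps := eps)); try by eu_simp.
- exact: NU_free.
- exact: reflection_lin.
- apply/matrixP=> i j; rewrite !mxE (inj_eq rev_ord_inj) eq_sym //.
- by rewrite rD !reflection_eu // addrC.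
- rewrite rD rZ !reflection_eu // scalerDr scalerA -signr_addb addbb scale1r.
  by rewrite addrC.
- by rewrite reflection_eu.
- by rewrite reflection_eu.
Qed.

Lemma graded_span_triv eps :
  graded_span (NUbasis eps false) =1 triv_grading (full_span (NUbasis eps false)).
Proof. by case=> //=; rewrite /graded_span /= span_nil. Qed.

Lemma mem_elem n (g : seq bool) i (x : 'M[F]_n.+1) :
  reflect (forall k l, x k l != 0 -> nth false g k (+) nth false g l = i)
  (x \in <<elem_units n g i>>%VS).
Proof.
apply: (iffP idP) => [|h].
  apply: (span_lin_ind (P := fun x : 'M[F]_n.+1 => forall k l, x k l != 0 ->
    nth false g k (+) nth false g l = i)).
  - by move=> k l; rewrite mxE eqxx.
  - move=> c y z hy hz k l; rewrite !mxE.
    have [y0|/hy //] := eqVneq (y k l) 0.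
    by rewrite y0 mulr0 add0r => /hz.
  move=> y /mapP[[a b]]; rewrite mem_filter /= => /andP[/eqP hab _] -> k l.
  by rewrite mxE; case: andP => [[/eqP-> /eqP->]|] //=; rewrite eqxx.
rewrite [x]matrix_sum_delta; apply: memv_suml => k _; apply: memv_suml => l _.
have [->|xkl] := eqVneq (x k l) 0; first by rewrite scale0r mem0v.
apply/memvZ/memv_span/mapP; exists (k, l) => //.
by rewrite mem_filter /= (h _ _ xkl) eqxx mem_enum.
Qed.

Lemma graded_span_elem eps :
  graded_span (NUbasis eps true) =1
    elem_grading NUdegrees (full_span (NUbasis eps true)).
Proof.
have sub i : (graded_span (NUbasis eps true) i <= <<elem_units 5 NUdegrees i>>)%VS.
  apply/span_subvP => x /mapP[[j b]]; rewrite mem_filter => /andP[/= /eqP-> hb ->].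
  apply/mem_elem => k l /=; move: hb; rewrite !inE.
  case/or4P => [|||/orP[]] /eqP[-> ->].
    by rewrite mxE; have [->|] := eqVneq k l; rewrite ?addbb ?eqxx.
  1-4: rewrite !mxE; case: k l => [[|[|[|[|[|[|//]]]]]] hk];
    case=> [[|[|[|[|[|[|//]]]]]] hl];
    by rewrite /= ?mulr0 ?addr0 ?eqxx.
move=> i; apply/eqP; rewrite eqEsubv /elem_grading subv_cap sub andbT.
have subA j : (graded_span (NUbasis eps true) j <= full_span (NUbasis eps true))%VS.
  by rewrite -graded_span_sum; case: j; rewrite ?addvSl ?addvSr.
rewrite subA /=; apply/subvP => x; rewrite memv_cap => /andP[].
rewrite -graded_span_sum => /memv_addP[y hy [z hz ->]] he.
have zero j w : w \in <<elem_units 5 NUdegrees j>>%VS ->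
    w \in <<elem_units 5 NUdegrees (~~ j)>>%VS -> w = 0.
  move=> /mem_elem h0 /mem_elem h1; apply/matrixP=> k l; rewrite mxE.
  by apply/eqP/negP=> /negP e; have := h0 _ _ e; rewrite (h1 _ _ e); case: (j).
case: i he => he.
  have y0 : y = 0.
    apply: (zero false); first exact: (subvP (sub false)).
    by rewrite -[y](addrK z) memvB // (subvP (sub true)).
  by rewrite y0 add0r.
have z0 : z = 0.
  apply: (zero true); first exact: (subvP (sub true)).
  by rewrite -[z](addKr y) memvD // memvN (subvP (sub false)).
by rewrite z0 addr0.
Qed.

Lemma U3_superinv : superinv_mx U3 (triv_grading U3) reflection.
Proof.
have := NU_superinv false false; rewrite -(U3E false); apply: superinv_mx_ext.
exact: graded_span_triv.
Qed.

Lemma N3_superinv : superinv_mx N3 (triv_grading N3) reflection.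
Proof.
have := NU_superinv true false; rewrite -(N3E false); apply: superinv_mx_ext.
exact: graded_span_triv.
Qed.

Lemma U3_gri_superinv : superinv_mx U3 (elem_grading NUdegrees U3) reflection.
Proof.
have := NU_superinv false true; rewrite -(U3E true); apply: superinv_mx_ext.
exact: graded_span_elem.
Qed.

Lemma N3_gri_superinv : superinv_mx N3 (elem_grading NUdegrees N3) reflection.
Proof.
have := NU_superinv true true; rewrite -(N3E true); apply: superinv_mx_ext.
exact: graded_span_elem.
Qed.

Definition U3_star : staralg F := mxstaralg U3_superinv.
Definition U3_star_gri : staralg F := mxstaralg U3_gri_superinv.
Definition N3_star : staralg F := mxstaralg N3_superinv.
Definition N3_star_gri : staralg F := mxstaralg N3_gri_superinv.

End NU.

Definition calItilde (F : fieldType) : seq (staralg F) :=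
  [:: C3_i1_gr F; C3_i2_triv F; C3_i3_gr F;
      U3_star F; U3_star_gri F; N3_star F; N3_star_gri F;
      G2_psi_gr F; G2_tau F; G2_tau_gr F; G2_tau_gri F;
      G2_gamma_gr F; G2_gamma_gri F;
      W_eta1_gri F; W_eta2_gr F; W_eta3_gri F].

Definition calI (F : fieldType) : seq (staralg F) :=
  [:: baseF F; C2_gr F; C2_star F; C2_star_gr F] ++ calItilde F.

(* Main.v *)
(* Quadratic growth forces all proper polynomials of degree 3 to vanish on A: a
   nonzero one, multiplied by symmetric even variables in the remaining
   positions, would give cubically many independent multilinear polynomials.
   Modulo these identities a word equals a symmetrized word plus half the sum of
   the commutators of its letters, so the identities of A are determined by the
   profile of A, i.e. by which of the (anti)commutators of two elements of A_i^e
   and A_j^f are not identically 0; anticommutators with 1 record which of the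
   spaces A_i^e are nonzero.  A vanishing profile outside of these would make the
   growth linear.  Finally, every bracket in the profile of A is nonzero on one of
   the listed algebras, whose own profile consists of what a single nonzero
   bracket forces on any algebra, so the direct sum of these algebras has the
   profile of A. *)
Require Import Defs.
From mathcomp Require Import all_boot all_order all_algebra all_fingroup.
From mathcomp Require Import falgebra.
From mathcomp Require Import reals topology normedtype sequences.
From Stdlib Require List.
From mathcomp Require Import boolp ring lra zify.
From mathcomp Require Import -(notations) finmap monalg.

Set Implicit Arguments.
Unset Strict Implicit.
Unset Printing Implicit Defensive.

Import Order.TTheory GRing.Theory Num.Theory.
Import numFieldNormedType.Exports.
Local Open Scope ring_scope.

(** * Brackets and proper polynomials *)

(** Equality of [Idstar] concerns all polynomials, not only multilinear ones, so words with repeated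
    letters are treated directly. Rescaling the variables splits an identity into components, each
    with a fixed multiset of letters. The values of such a component depend only on the sum of its
    coefficients and, for each pair of letters x, y, on the weighted excess of x before y over y
    before x. Both are read off by substituting 1 for symmetric even variables and 0 for the others.
    Two obstacles arise. If x or y is repeated, its further occurrences leave powers behind the
    commutator [a, b]; replacing b by b + 1 does not change [a, b], and this removes the powers. If
    two variables of other types remain, a substitution yields only the sum of an anticommutator
    part and a commutator part; these have the same degree and opposite signs under the
    superinvolution, so each of them vanishes. *)

Section PermInd.
Variables (T : eqType) (P : seq T -> seq T -> Prop).

(** Used with P saying that a function takes equal values on two words: invariance under reordering
    reduces to exchanging the first two letters. *)
Lemma perm_swap_ind :
  (forall s, P s s) -> (forall s2 s1 s3, P s1 s2 -> P s2 s3 -> P s1 s3) ->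
  (forall x s s', perm_eq s s' -> P s s' -> P (x :: s) (x :: s')) ->
  (forall x y s, P (x :: y :: s) (y :: x :: s)) ->
  forall s s', perm_eq s s' -> P s s'.
Proof.
move=> Pr Pt Pc Ps.
have front x s1 s2 : P (x :: s1 ++ s2) (s1 ++ x :: s2).
  elim: s1 => [|y s1 IH] /=; first exact: Pr.
  apply: Pt (Pc y _ _ _ IH); first exact: Ps.
  by rewrite -cat1s perm_catCA.
elim=> [|x s IH] s' hs; first by move: hs; rewrite perm_sym => /perm_nilP->.
have xs' : x \in s' by rewrite -(perm_mem hs) mem_head.
case/splitPr: xs' hs => s1 s2; rewrite perm_sym -cat1s perm_catCA perm_cons.
by rewrite perm_sym => hs; apply: Pt (front x s1 s2); apply: Pc (IH _ hs).
Qed.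

End PermInd.

Definition comm (R : pzRingType) (a b : R) : R := a * b - b * a.
Definition anticomm (R : pzRingType) (a b : R) : R := a * b + b * a.

Lemma commC (R : pzRingType) (a b : R) : comm a b = - comm b a.
Proof. by rewrite /comm opprB. Qed.

Lemma commxx (R : pzRingType) (a : R) : comm a a = 0.
Proof. by rewrite /comm subrr. Qed.

Lemma comm1l (R : pzRingType) (a : R) : comm 1 a = 0.
Proof. by rewrite /comm mul1r mulr1 subrr. Qed.

Lemma comm1r (R : pzRingType) (a : R) : comm a 1 = 0.
Proof. by rewrite /comm mul1r mulr1 subrr. Qed.

Lemma commDl (R : pzRingType) (a b c : R) : comm (a + b) c = comm a c + comm b c.
Proof. by rewrite /comm mulrDl mulrDr opprD addrACA. Qed.

Lemma commDr (R : pzRingType) (a b c : R) : comm c (a + b) = comm c a + comm c b.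
Proof. by rewrite /comm mulrDl mulrDr opprD addrACA. Qed.

Lemma comm0l (R : pzRingType) (a : R) : comm 0 a = 0.
Proof. by rewrite /comm mul0r mulr0 subrr. Qed.

Lemma comm0r (R : pzRingType) (a : R) : comm a 0 = 0.
Proof. by rewrite /comm mul0r mulr0 subrr. Qed.

Lemma commZl (F : fieldType) (R : algType F) (k : F) (a b : R) :
  comm (k *: a) b = k *: comm a b.
Proof. by rewrite /comm -scalerAl -scalerAr -scalerBr. Qed.

Lemma commZr (F : fieldType) (R : algType F) (k : F) (a b : R) :
  comm a (k *: b) = k *: comm a b.
Proof. by rewrite /comm -scalerAl -scalerAr -scalerBr. Qed.

Lemma anticommC (R : pzRingType) (a b : R) : anticomm a b = anticomm b a.
Proof. by rewrite /anticomm addrC. Qed.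

(* The type (i, e) stands for the space A_i^e, with the conventions of [var]. *)
Definition ty : finType := (bool * bool)%type.
Definition ty0 : ty := (false, false).

(** The conjunction comes from the sign (-1)^(ij) with which the superinvolution reverses a product;
    [s] appears because reversal negates a commutator and fixes an anticommutator. *)
Definition brtype (s : bool) (t u : ty) : ty :=
  (t.1 (+) u.1, (t.1 && u.1) (+) t.2 (+) u.2 (+) s).

Definition bracket (R : pzRingType) (s : bool) : R -> R -> R :=
  if s then @comm R else @anticomm R.

Lemma bracketE (R : pzRingType) s (a b : R) :
  bracket s a b = a * b + (-1) ^+ s * (b * a).
Proof. by case: s; rewrite /bracket /comm /anticomm ?mulN1r ?mul1r. Qed.

Section Pure.
Variables (F : fieldType) (A : staralg F).
Implicit Types (x y z a b : A) (t u : ty).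

Definition pure t x := homog_sgn t.1 t.2 x.

Lemma starZD c x y : star (c *: x + y) = c *: star x + star y.
Proof. exact: star_linear. Qed.

Lemma star0 : star (0 : A) = 0.
Proof. by have := starZD (-1) 0 0; rewrite scaler0 addr0 scaleN1r addNr. Qed.

Lemma starZ c x : star (c *: x) = c *: star x.
Proof. by rewrite -[c *: x]addr0 starZD star0 addr0. Qed.

Lemma starD x y : star (x + y) = star x + star y.
Proof. by rewrite -[x]scale1r starZD !scale1r. Qed.

Lemma homogZ i c x : homog i x -> homog i (c *: x).
Proof. by move=> h; rewrite -[c *: x]addr0; apply: homogP => //; apply: homog0. Qed.

Lemma homogD i x y : homog i x -> homog i y -> homog i (x + y).
Proof. by move=> hx hy; rewrite -[x]scale1r; apply: homogP. Qed.

Lemma homogB i x y : homog i x -> homog i y -> homog i (x - y).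
Proof.
by move=> hx hy; apply: homogD => //; rewrite -scaleN1r; apply: homogZ.
Qed.

(** The record [staralg] does not assert this. If 1 = y + z with y even and z odd, comparing degrees
    in z = zy + zz and y = yy + yz gives zz = 0 and yz = 0, so z = (y + z)z = 0. *)
Lemma homog_one : homog false (1 : A).
Proof.
have [y [z [hy hz e]]] := homog_sum (1 : A).
have zy := homogM hz hy; have zz := homogM hz hz.
have yz := homogM hy hz; have yy := homogM hy hy.
rewrite /= in zy zz yz yy.
have ez : z * z = z - z * y.
  by apply/eqP; rewrite eq_sym subr_eq addrC -mulrDr -e mulr1.
have ey : y * z = y - y * y.
  by apply/eqP; rewrite eq_sym subr_eq addrC -mulrDr -e mulr1.
have z0 : z * z = 0 by apply: homog_cap => //; rewrite ez; apply: homogB.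
have y0 : y * z = 0 by apply: homog_cap => //; rewrite ey; apply: homogB.
have : z = 0 by rewrite -[z]mul1r e mulrDl y0 z0 addr0.
by move=> z00; rewrite e z00 addr0.
Qed.

Lemma star_one : star (1 : A) = 1.
Proof.
have h := starM (star_homog homog_one) homog_one.
by rewrite mulr1 !starK expr0 scale1r mulr1 in h.
Qed.

Lemma pure1 : pure ty0 1.
Proof. by split; [exact: homog_one | rewrite star_one expr0 scale1r]. Qed.

Lemma pure0 t : pure t 0.
Proof. by split; [exact: homog0 | rewrite star0 scaler0]. Qed.

Lemma pureZ t c x : pure t x -> pure t (c *: x).
Proof.
by move=> [h e]; split; [exact: homogZ | rewrite starZ e !scalerA mulrC].
Qed.

Lemma pureD t x y : pure t x -> pure t y -> pure t (x + y).
Proof.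
by move=> [h e] [h' e']; split; [exact: homogD | rewrite starD e e' scalerDr].
Qed.

Lemma pureB t x y : pure t x -> pure t y -> pure t (x - y).
Proof. by move=> hx hy; apply: pureD => //; rewrite -scaleN1r; apply: pureZ. Qed.

Lemma pure_bracket s t u a b :
  pure t a -> pure u b -> pure (brtype s t u) (bracket s a b).
Proof.
case: t u => [i e] [j f] [/= ha sa] [/= hb sb]; rewrite bracketE mulr_sign.
have hba : homog (i (+) j) (b * a) by rewrite addbC; apply: homogM.
split=> /=.
  apply: homogD; first exact: homogM.
  by case: s => //; rewrite -scaleN1r; apply: homogZ.
have -> : (if s then - (b * a) else b * a) = (-1) ^+ s *: (b * a).
  by case: (s); rewrite ?scaleN1r ?scale1r.
rewrite starD starZ (starM ha hb) (starM hb ha) sa sb.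
rewrite -!scalerAl -!scalerAr scalerDr !scalerA -!signr_addb addrC.
by congr (_ *: _ + _ *: _); congr (_ ^+ (nat_of_bool _));
  case: i j e f s {ha hb sa sb hba} => [] [] [] [] [].
Qed.

Lemma pure_comm t u a b : pure t a -> pure u b ->
  pure (brtype true t u) (comm a b).
Proof. exact: (@pure_bracket true). Qed.

(* The Boolean s selects the commutator (true) or the anticommutator (false). *)
Definition prof s t u :=
  exists a b, [/\ pure t a, pure u b & bracket s a b != 0].

(* Together these say that the proper polynomials of degree 3 are identities of
   A: symmetric even variables occur in them only inside commutators. *)
Record nil3 : Prop := Nil3 {
  nil3_comm2 : forall t u v x y z, pure t x -> pure u y -> pure v z ->
    comm x (comm y z) = 0;
  nil3_mul_comm : forall t u v x y z, t != ty0 ->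
    pure t x -> pure u y -> pure v z -> x * comm y z = 0;
  nil3_mul3 : forall t u v x y z, t != ty0 -> u != ty0 -> v != ty0 ->
    pure t x -> pure u y -> pure v z -> x * y * z = 0
}.

End Pure.

(** * Values of words up to reordering *)

Section Nil3.
Variables (F : fieldType) (A : staralg F) (nilA : nil3 A).
Implicit Types (x y z g h : A) (t u : ty).

Lemma mul_commC t u w x y z : pure t x -> pure u y -> pure w z ->
  x * comm y z = comm y z * x.
Proof. by move=> hx hy hz; apply/eqP; rewrite -subr_eq0; apply/eqP/(nil3_comm2 nilA hx hy hz). Qed.

(** Commutators are central, so a factor g or h that is not symmetric even can be moved next to
    [x, y], which it annihilates. If both are symmetric even, then [g, h] is skew and itself
    annihilates [x, y]. *)
Lemma mul_comm_comm t u w w' g h x y : pure t g -> pure u h -> pure w x ->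
  pure w' y -> comm g h * comm x y = 0.
Proof.
move=> hg hh hx hy; have [t0|t0] := eqVneq t ty0; last first.
  rewrite {1}/comm mulrBl -!mulrA (nil3_mul_comm nilA t0 hg hx hy) mulr0.
  by rewrite (mul_commC hh hx hy) mulrA (nil3_mul_comm nilA t0 hg hx hy) mul0r subrr.
have [u0|u0] := eqVneq u ty0; last first.
  rewrite {1}/comm mulrBl -!mulrA (nil3_mul_comm nilA u0 hh hx hy) mulr0.
  by rewrite (mul_commC hg hx hy) mulrA (nil3_mul_comm nilA u0 hh hx hy) mul0r subrr.
apply: (nil3_mul_comm nilA _ (pure_comm hg hh) hx hy).
by rewrite t0 u0.
Qed.

End Nil3.

(** Counts pairs of positions p < q with x at p and y at q, since letters may be repeated. *)
Fixpoint nbefore (T : eqType) (x y : T) (w : seq T) : nat :=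
  if w is h :: w' then ((h == x) * count_mem y w' + nbefore x y w')%N else 0%N.

Lemma nbefore_mem (T : eqType) (x y : T) (w : seq T) :
  nbefore x y w != 0%N -> (x \in w) && (y \in rem x w).
Proof.
elim: w => //= h w IH; rewrite in_cons [x == h]eq_sym; have [hx|hx] := eqVneq h x.
  rewrite mul1n /=; have [//|yw] := boolP (y \in w).
  rewrite (count_memPn yw) add0n => /IH/andP[_ /mem_rem].
  by rewrite (negPf yw).
rewrite mul0n add0n /= => /IH/andP[-> yw] /=.
by rewrite in_cons yw orbT.
Qed.

Section Words.
Variables (F : fieldType) (A : staralg F).

Definition wval (v : var -> A) (w : seq var) : A := \prod_(x <- w) v x.

Definition adm (v : var -> A) := forall x : var, pure x.1 (v x).

Variable v : var -> A.
Local Notation W := (wval v).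

Lemma wval_nil : W [::] = 1. Proof. by rewrite /wval big_nil. Qed.
Lemma wval_cons x w : W (x :: w) = v x * W w.
Proof. by rewrite /wval big_cons. Qed.

(* [all_comms w] is the sum over p < q of [w_p, w_q] times the other letters.
   If the proper polynomials of degree 3 vanish, subtracting half of it makes the
   value of w independent of the order of the letters; [symval] is twice the
   result, which avoids the division. *)
Fixpoint fst_comms (a : A) (w : seq var) : A :=
  if w is y :: w' then comm a (v y) * W w' + v y * fst_comms a w' else 0.

Fixpoint all_comms (w : seq var) : A :=
  if w is x :: w' then fst_comms (v x) w' + v x * all_comms w' else 0.

Definition symval w : A := W w *+ 2 - all_comms w.

Lemma symval_cons x w : symval (x :: w) = v x * symval w - fst_comms (v x) w.
Proof. by rewrite /symval wval_cons /= mulrBr mulrnAr opprD addrA addrAC. Qed.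

Hypothesis vp : adm v.
Hypothesis nilA : nil3 A.

Lemma commv x y z : v x * comm (v y) (v z) = comm (v y) (v z) * v x.
Proof. exact: (mul_commC nilA (vp x) (vp y) (vp z)). Qed.

Lemma commvCA x y z u :
  v x * (comm (v y) (v z) * u) = comm (v y) (v z) * (v x * u).
Proof. by rewrite !mulrA commv. Qed.

Lemma commv_comm g h x y : comm (v g) (v h) * comm (v x) (v y) = 0.
Proof. exact: (mul_comm_comm nilA (vp g) (vp h) (vp x) (vp y)). Qed.

Lemma mulvC x y : v x * v y = v y * v x + comm (v x) (v y).
Proof. by rewrite /comm addrCA subrr addr0. Qed.

Lemma mulvCA x y u :
  v x * (v y * u) = v y * (v x * u) + comm (v x) (v y) * u.
Proof. by rewrite mulrA mulvC mulrDl mulrA. Qed.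

(** Exchanging two letters behind a commutator costs a product of two commutators, which is zero. *)
Lemma comm_perm x y w w' : perm_eq w w' ->
  comm (v x) (v y) * W w = comm (v x) (v y) * W w'.
Proof.
move: w w'; apply: perm_swap_ind => [//|s2 s1 s3 -> ->//|z s s' _ h|z t s].
  by rewrite !wval_cons !mulrA -!commv -!mulrA h.
rewrite !wval_cons (mulvCA z t) mulrDr.
by rewrite [X in _ + X]mulrA commv_comm mul0r addr0.
Qed.

Lemma comm_fst_comms g h x w : comm (v g) (v h) * fst_comms (v x) w = 0.
Proof.
elim: w => [|y w IH] /=; first by rewrite mulr0.
by rewrite mulrDr !mulrA commv_comm mul0r add0r -commv -mulrA IH mulr0.
Qed.

Lemma comm_all_comms g h w : comm (v g) (v h) * all_comms w = 0.
Proof.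
elim: w => [|y w IH] /=; first by rewrite mulr0.
by rewrite mulrDr comm_fst_comms add0r mulrA -commv -mulrA IH mulr0.
Qed.

Lemma skew_comm z x y : z.1 != ty0 -> v z * comm (v x) (v y) = 0.
Proof. by move=> z0; exact: (nil3_mul_comm nilA z0 (vp z) (vp x) (vp y)). Qed.

Lemma skew_fst_comms z x w : z.1 != ty0 -> v z * fst_comms (v x) w = 0.
Proof.
move=> z0; elim: w => [|y w IH] /=; first by rewrite mulr0.
rewrite mulrDr [v z * (comm _ _ * _)]mulrA skew_comm // mul0r add0r mulvCA IH.
by rewrite mulr0 comm_fst_comms addr0.
Qed.

Lemma skew_all_comms z w : z.1 != ty0 -> v z * all_comms w = 0.
Proof.
move=> z0; elim: w => [|y w IH] /=; first by rewrite mulr0.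
rewrite mulrDr skew_fst_comms // add0r mulvCA IH.
by rewrite mulr0 comm_all_comms addr0.
Qed.

Lemma fst_comms_perm x w w' : perm_eq w w' -> fst_comms (v x) w = fst_comms (v x) w'.
Proof.
move: w w'; apply: perm_swap_ind => [//|s2 s1 s3 -> ->//|z s s' p h|y z s] /=.
  by rewrite h (comm_perm _ _ p).
rewrite !wval_cons !mulrDr !mulrA -!commv -!mulrA mulvCA comm_fst_comms addr0.
by rewrite addrCA.
Qed.

(** Exchanging the first two letters x, y changes twice the word by 2[x, y]W(w). The sum of
    commutators changes by the same amount: its term [x, y]W(w) changes sign, and [x, y] times the
    sum for w is zero. *)
Lemma symval_perm w w' : perm_eq w w' -> symval w = symval w'.
Proof.
move: w w'; apply: perm_swap_ind => [//|s2 s1 s3 -> ->//|z s s' p h|x y w].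
  by rewrite !symval_cons h (fst_comms_perm _ p).
have sw a b : symval (a :: b :: w) = v a * v b * symval w - v a * fst_comms (v b) w -
    v b * fst_comms (v a) w - comm (v a) (v b) * W w.
  by rewrite !symval_cons /= mulrBr mulrA opprD addrA [RHS]addrAC.
rewrite !sw [comm (v y) _]commC mulNr opprK mulvC mulrDl.
have -> : comm (v x) (v y) * symval w = (comm (v x) (v y) * W w) *+ 2.
  by rewrite /symval mulrBr comm_all_comms subr0 mulrnAr.
rewrite mulr2n.
move: (v y * v x * symval w) (comm (v x) (v y) * W w) (v x * fst_comms (v y) w).
move: (v y * fst_comms (v x) w) => b q k a.
rewrite -!addrA; congr (q + _).
rewrite [- a + (_ - _)]addrA [k + (_ - k)]addrC subrK.
by rewrite addrC [- a - b]addrC addrA.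
Qed.

Section Expansion.
Variables (L : seq var) (uL : uniq L).

Lemma fst_commsE x w : {subset w <= L} -> fst_comms (v x) w =
  \sum_(y <- L) (comm (v x) (v y) * W (rem y w)) *+ count_mem y w.
Proof.
elim: w => [_|h w IH hL] /=; first by rewrite big1_seq.
have sL : {subset w <= L} by move=> y yw; apply: hL; rewrite in_cons yw orbT.
have hL' : h \in L by apply: hL; rewrite mem_head.
rewrite IH //.
rewrite big_distrr /= (bigD1_seq h) //= [RHS](bigD1_seq h) //= eqxx addrA.
congr (_ + _); last first.
  apply: eq_bigr => y yh; rewrite [h == y]eq_sym (negPf yh) add0n wval_cons.
  by rewrite mulrnAr commvCA.
rewrite mulrnDr mulr1n mulrnAr; congr (_ + _).
have [hw|hw] := boolP (h \in w); last by rewrite (count_memPn hw) !mulr0n.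
by rewrite commvCA -wval_cons -(comm_perm _ _ (perm_to_rem hw)).
Qed.

(** Collecting by pairs of letters instead of pairs of positions makes the order of the letters
    visible only in the multiplicities [nbefore x y w]. *)
Lemma all_commsE w : {subset w <= L} -> all_comms w =
  \sum_(x <- L) \sum_(y <- L)
     (comm (v x) (v y) * W (rem y (rem x w))) *+ nbefore x y w.
Proof.
elim: w => [_|h w IH hL] /=; first by rewrite big1_seq // => i _; rewrite big1_seq.
have sL : {subset w <= L} by move=> y yw; apply: hL; rewrite in_cons yw orbT.
have hL' : h \in L by apply: hL; rewrite mem_head.
rewrite IH // fst_commsE // [X in _ + _ * X](bigD1_seq h hL' uL) /=.
rewrite [in RHS](bigD1_seq h hL' uL) /=.
(* Prepending h and removing x and y commute only up to reordering, which is harmless behind a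
   commutator. If x never precedes y in w, both multiplicities are 0. *)
have term x y : v h * ((comm (v x) (v y) * W (rem y (rem x w))) *+ nbefore x y w)
    = (comm (v x) (v y) * W (rem y (rem x (h :: w)))) *+ nbefore x y w.
  rewrite mulrnAr; have [->|] := eqVneq (nbefore x y w) 0%N; first by rewrite !mulr0n.
  move=> /nbefore_mem/andP[xw yw].
  rewrite commvCA -wval_cons; congr (_ *+ _); apply: comm_perm.
  have p1 : perm_eq (h :: w) (h :: x :: y :: rem y (rem x w)).
    rewrite perm_cons; apply: perm_trans (perm_to_rem xw) _.
    by rewrite perm_cons perm_to_rem.
  rewrite -(perm_cons y) -(perm_cons x).
  have xhw : x \in h :: w by rewrite in_cons xw orbT.
  have yhw : y \in rem x (h :: w).
    by rewrite /=; case: eqP => // _; [exact: mem_rem yw | rewrite in_cons yw orbT].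
  apply: (@perm_trans _ (h :: w)); last first.
    apply: perm_trans (perm_to_rem xhw) _; rewrite perm_cons perm_to_rem //.
  rewrite perm_sym; apply: perm_trans p1 _.
  by rewrite -(perm_catCA [:: x; y] [:: h]).
rewrite mulrDr big_distrr [v h * (\sum_(i <- L | _) _)]big_distrr /= addrA.
congr (_ + _); last first.
  apply: eq_bigr => x xh; rewrite big_distrr; apply: eq_bigr => y _ /=.
  by rewrite term /= [h == x]eq_sym (negPf xh).
rewrite -big_split /=; apply: eq_bigr => y _.
by rewrite term /= eqxx mul1n mulrnDr.
Qed.

End Expansion.
End Words.

(** * Consequences of characteristic zero *)

Section CharZero.
Variables (F : fieldType) (charF0 : [pchar F] =i pred0).

Lemma natr_neq0_char n : (0 < n)%N -> n%:R != 0 :> F.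
Proof. by move=> n0; rewrite ((pcharf0P F).1 charF0) -lt0n. Qed.

Lemma mulrn_eq0_char (V : lmodType F) (x : V) n : (0 < n)%N -> x *+ n = 0 -> x = 0.
Proof.
move=> n0; rewrite -scaler_nat => /eqP.
by rewrite scaler_eq0 (negPf (natr_neq0_char n0)) /= => /eqP.
Qed.

Lemma scaler_eq0_or (V : lmodType F) (c : F) (x : V) : c *: x = 0 -> c = 0 \/ x = 0.
Proof. by move/eqP; rewrite scaler_eq0 => /orP[] /eqP; [left|right]. Qed.

(* (-a)^m - 1 is a multiple of a + 1, so that a^m and (a + 1)^m generate the
   unit ideal of F[a]. *)
Lemma expr_shift_eq0 (R : pzRingType) (u a : R) m :
  u * a ^+ m = 0 -> u * (a + 1) ^+ m = 0 -> u = 0.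
Proof.
move=> h0 h1; set g := \sum_(i < m) (- a) ^+ i.
have ug : u * ((a + 1) * g) = u.
  have := subrX1 (- a) m; rewrite -/g => e.
  have -> : (a + 1) * g = 1 - (- a) ^+ m by rewrite -opprB e -mulNr opprB opprK addrC.
  by rewrite mulrBr mulr1 exprNn -signr_odd mulr_sign; case: odd;
    rewrite ?mulrN h0 ?oppr0 addr0.
have cag : GRing.comm (a + 1) g.
  apply: commr_sum => i _; apply: commrX; apply: commr_sym; apply: commrD; last exact: commr1.
  by apply: commr_sym; apply: commrN; exact: commr_refl.
have ugk k : u * ((a + 1) * g) ^+ k = u.
  by elim: k => [|k IH]; rewrite ?mulr1 // exprSr mulrA IH.
by rewrite -(ugk m) exprMn_comm // mulrA h1 mul0r.
Qed.

Lemma prof0_ty0 (A : staralg F) : prof A false ty0 ty0.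
Proof.
exists 1, 1; split; try exact: pure1.
rewrite /bracket /anticomm mulr1 -mulr2n; apply/eqP.
by move/mulrn_eq0_char => /(_ isT) /eqP; rewrite oner_eq0.
Qed.

Lemma prof0_neq0 (A : staralg F) t (a : A) : pure t a -> a != 0 -> prof A false t ty0.
Proof.
move=> ha a0; exists a, 1; split=> //; first exact: pure1.
rewrite /bracket /anticomm mulr1 mul1r -mulr2n; apply: contraNneq a0.
by move/mulrn_eq0_char => ->.
Qed.

(** Applying the superinvolution to p + q = 0 gives p - q = 0 up to sign. *)
Lemma pure_opp_eq0 (A : staralg F) (i e : bool) (p q : A) :
  pure (i, e) p -> pure (i, ~~ e) q -> p + q = 0 -> p = 0 /\ q = 0.
Proof.
move=> [_ /= sp] [_ /= sq] pq.
have pq' : p = - q by apply/eqP; rewrite -addr_eq0 pq.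
have e1 : star p + star q = 0 by rewrite -starD pq star0.
move: e1; rewrite sp sq (_ : (-1) ^+ (~~ e) = - (-1) ^+ e :> F); last first.
  by case: (e); rewrite ?expr0 ?expr1 ?opprK.
rewrite scaleNr -scalerBr pq' -opprD scalerN => /eqP; rewrite oppr_eq0.
rewrite scaler_eq0 signr_eq0 /= -mulr2n => /eqP /mulrn_eq0_char -> //.
by rewrite oppr0.
Qed.

End CharZero.

Lemma mem_rem_neq (T : eqType) (x y : T) w : y != x -> y \in w -> y \in rem x w.
Proof.
move=> yx yw; have [xw|/rem_id->//] := boolP (x \in w).
by move: yw; rewrite (perm_mem (perm_to_rem xw)) in_cons (negPf yx).
Qed.

Lemma perm_rem (T : eqType) (x : T) w w' :
  perm_eq w w' -> perm_eq (rem x w) (rem x w').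
Proof.
move=> ww'; have [xw|xw] := boolP (x \in w); last first.
  by rewrite !rem_id // -(perm_mem ww').
have xw' : x \in w' by rewrite -(perm_mem ww').
rewrite -(perm_cons x) perm_sym; apply: perm_trans (perm_to_rem xw).
by rewrite perm_sym; apply: perm_trans ww' (perm_to_rem xw').
Qed.

(** Includes the odd symmetric variables: these are all the variables that cannot be specialized to
    1. *)
Definition skewvar (x : var) := x.1 != ty0.

(** * Polynomials in a fixed multiset of letters *)

Section Content.
Variables (F : fieldType) (charF0 : [pchar F] =i pred0).
Variables (I : Type) (r : seq I) (c : I -> F) (wd : I -> seq var) (w0 : seq var).

Let P i := perm_eq (wd i) w0.
Let L := undup w0.

Definition content_sum : F := \sum_(i <- r | P i) c i.
Definition content_before (x y : var) : F := \sum_(i <- r | P i) c i *+ nbefore x y (wd i).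
Definition content_diff (x y : var) : F := content_before x y - content_before y x.
Definition content_val (A : staralg F) (v : var -> A) : A :=
  \sum_(i <- r | P i) c i *: wval v (wd i).

(** The default [ty0] of [nth] matters: with a single letter z of [skewvar], the condition on [prof]
    says that the space of type [z.1] is nonzero, and with none it always holds in characteristic
    zero. *)
Definition content_cond (A : staralg F) : Prop :=
  let zs := [seq x <- w0 | skewvar x] in
  let t k := nth ty0 [seq x.1 | x <- zs] k in
  ((size zs <= 2)%N -> prof A false (t 0%N) (t 1%N) -> content_sum = 0) /\
  (forall x y, x \in w0 -> y \in w0 -> x != y ->
     [seq z <- rem y (rem x w0) | skewvar z] = [::] ->
     prof A true x.1 y.1 -> content_diff x y = 0).

Section Expand.
Variables (A : staralg F) (nilA : nil3 A) (v : var -> A) (vp : adm v).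
Local Notation W := (wval v).

Definition pair_term x y := comm (v x) (v y) * W (rem y (rem x w0)).

Lemma pair_termC x y : x \in w0 -> y \in w0 -> pair_term y x = - pair_term x y.
Proof.
move=> xw yw; have [->|xy] := eqVneq x y; first by rewrite /pair_term commxx mul0r oppr0.
rewrite /pair_term [comm (v y) _]commC mulNr; congr (- _); apply: comm_perm => //.
have yr : y \in rem x w0 by apply: mem_rem_neq; rewrite // eq_sym.
have xr : x \in rem y w0 by apply: mem_rem_neq.
rewrite -(perm_cons x) -(perm_cons y).
rewrite perm_sym -[_ :: _]/([:: y] ++ [:: x] ++ _) perm_catCA /=.
apply: (@perm_trans _ w0).
  rewrite perm_sym; apply: perm_trans (perm_to_rem xw) _.
  by rewrite perm_cons perm_to_rem.
by apply: perm_trans (perm_to_rem yw) _; rewrite perm_cons perm_to_rem.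
Qed.

Lemma content_val_expand : content_val v *+ 2 = content_sum *: symval v w0 +
  \sum_(x <- L) \sum_(y <- L) content_before x y *: pair_term x y.
Proof.
have step i : P i -> (c i *: W (wd i)) *+ 2 = c i *: symval v w0 +
    \sum_(x <- L) \sum_(y <- L) (c i *+ nbefore x y (wd i)) *: pair_term x y.
  move=> pi; rewrite scalerMnr.
  have -> : W (wd i) *+ 2 = symval v (wd i) + all_comms v (wd i) by rewrite /symval subrK.
  rewrite scalerDr (symval_perm vp nilA pi); congr (_ + _).
  have wL : {subset wd i <= L} by move=> x; rewrite mem_undup (perm_mem pi).
  rewrite (all_commsE vp nilA (undup_uniq w0) wL).
  rewrite scaler_sumr; apply: eq_bigr => x _; rewrite scaler_sumr.
  apply: eq_bigr => y _; rewrite -scalerMnr -scalerMnl.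
  have [->|] := eqVneq (nbefore x y (wd i)) 0%N; first by rewrite !mulr0n.
  move=> /nbefore_mem/andP[xw yw]; congr (_ *: _ *+ _).
  by apply: comm_perm => //; apply: perm_rem; apply: perm_rem.
rewrite /content_val -sumrMnl (eq_bigr _ step) big_split /= scaler_suml; congr (_ + _).
rewrite exchange_big; apply: eq_bigr => x _ /=.
rewrite exchange_big; apply: eq_bigr => y _ /=.
by rewrite scaler_suml.
Qed.

(** The second doubling adds the term of (y, x) to that of (x, y); antisymmetry of the commutator
    leaves the difference of their coefficients. *)
Lemma content_val_expand4 : content_val v *+ 4 = content_sum *: symval v w0 *+ 2 +
  \sum_(x <- L) \sum_(y <- L) content_diff x y *: pair_term x y.
Proof.
rewrite (mulrnA _ 2 2) content_val_expand mulrnDl; congr (_ + _).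
rewrite mulr2n {2}exchange_big /= -big_split /= [LHS]big_seq [RHS]big_seq.
apply: eq_bigr => x; rewrite mem_undup => xw.
rewrite -big_split /= [LHS]big_seq [RHS]big_seq.
apply: eq_bigr => y; rewrite mem_undup => yw.
by rewrite (pair_termC xw yw) scalerN -scalerBl.
Qed.

(** Letters that are not symmetric even annihilate commutators, so only 2ab - [a, b] = ab + ba
    survives in front of the rest. *)
Lemma symval_skew2 a b w : skewvar a -> skewvar b ->
  symval v (a :: b :: w) = anticomm (v a) (v b) * W w.
Proof.
move=> ha hb; rewrite !symval_cons /symval /= !mulrBr (skew_all_comms vp nilA _ hb) mulr0 subr0.
rewrite (skew_fst_comms vp nilA _ _ ha) subr0 (skew_fst_comms vp nilA _ _ hb) addr0.
rewrite mulrA mulrnAr -mulrnAl -mulrBl; congr (_ * _).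
by rewrite /anticomm /comm mulr2n opprB addrAC addrA subrK addrC.
Qed.

End Expand.

End Content.

Lemma sum_seq2 (V : nmodType) (T : eqType) (s : seq T) (x y : T) (g : T -> V) :
  uniq s -> x \in s -> y \in s -> x != y ->
  (forall z, z != x -> z != y -> g z = 0) -> \sum_(z <- s) g z = g x + g y.
Proof.
move=> us xs ys xy g0; rewrite (bigD1_seq x) //= -big_filter.
have ys' : y \in [seq z <- s | z != x] by rewrite mem_filter eq_sym xy.
rewrite (bigD1_seq y ys') ?filter_uniq //= big1_seq ?addr0 // => z.
by rewrite mem_filter => /and3P[zy zx _]; apply: g0.
Qed.

Section Criterion.
Variables (F : fieldType) (charF0 : [pchar F] =i pred0).
Variables (I : Type) (r : seq I) (c : I -> F) (wd : I -> seq var) (w0 : seq var).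

Local Notation content_sum := (content_sum r c wd w0).
Local Notation content_diff := (content_diff r c wd w0).
Local Notation content_val := (content_val r c wd w0).
Local Notation L := (undup w0).

Section Values.
Variables (A : staralg F) (nilA : nil3 A) (v : var -> A) (vp : adm v).
Local Notation W := (wval v).

Lemma symval_zero1 z w : v z = 0 -> symval v (z :: w) = 0.
Proof.
move=> z0; rewrite symval_cons z0 mul0r sub0r; apply/eqP; rewrite oppr_eq0; apply/eqP.
elim: w => [|y w IH] //=.
by rewrite IH mulr0 /comm mul0r mulr0 subrr mul0r addr0.
Qed.

Lemma symval_skew3 a b d w : skewvar a -> skewvar b -> skewvar d ->
  symval v (a :: b :: d :: w) = 0.
Proof.
move=> ha hb hd; rewrite (symval_skew2 nilA vp _ ha hb) wval_cons mulrA /anticomm mulrDl.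
rewrite (nil3_mul3 nilA ha hb hd (vp a) (vp b) (vp d)).
by rewrite (nil3_mul3 nilA hb ha hd (vp b) (vp a) (vp d)) addr0 mul0r.
Qed.

Lemma content_cond_val : content_cond r c wd w0 A -> content_val v = 0.
Proof.
case=> hs hd; apply: (mulrn_eq0_char charF0 (n := 4)) => //.
rewrite (content_val_expand4 _ _ _ _ nilA vp) [X in _ + X]big1_seq ?addr0; last first.
  move=> x /=; rewrite mem_undup => xw; apply: big1_seq => y /=.
  rewrite mem_undup => yw; rewrite /pair_term.
  have [->|xy] := eqVneq x y; first by rewrite commxx mul0r scaler0.
  have [->|c0] := eqVneq (comm (v x) (v y)) 0; first by rewrite mul0r scaler0.
  have [e|] := boolP ([seq z <- rem y (rem x w0) | skewvar z] == [::]).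
    rewrite (hd x y xw yw xy (eqP e)) ?scale0r //.
    by exists (v x), (v y); split.
  (* A further letter that is not symmetric even can be moved to the front, where it annihilates the
     commutator. *)
  rewrite -has_filter => /hasP[z zr hz].
  rewrite (comm_perm vp nilA x y (perm_to_rem zr)) wval_cons mulrA.
  by rewrite -(commv vp nilA) (skew_comm vp nilA _ _ hz) mul0r scaler0.
(* The symmetrized word may be reordered, so the letters that are not symmetric even come first;
   from three of them on it is zero. *)
have : perm_eq w0 ([seq x <- w0 | skewvar x] ++ [seq x <- w0 | predC skewvar x]).
  by rewrite perm_sym perm_filterC.
move/(symval_perm vp nilA) => ->.
have : all skewvar [seq x <- w0 | skewvar x] by apply: filter_all.
case: [seq x <- w0 | skewvar x] hs => [|a [|b [|d zs]]] /= hs; last first.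
- by case/and4P=> ha hb h3 _; rewrite symval_skew3 // scaler0 mul0rn.
- case/and3P=> ha hb _; rewrite (symval_skew2 nilA vp _ ha hb).
  have [->|s0] := eqVneq (anticomm (v a) (v b)) 0; first by rewrite mul0r scaler0 mul0rn.
  by rewrite hs ?scale0r ?mul0rn //; exists (v a), (v b); split.
- move=> _; have [a0|a0] := eqVneq (v a) 0; first by rewrite symval_zero1 // scaler0 mul0rn.
  by rewrite hs ?scale0r ?mul0rn //; exact: (prof0_neq0 charF0 (vp a) a0).
- by move=> _; rewrite hs ?scale0r ?mul0rn //; exact: prof0_ty0.
Qed.

End Values.

Section Necessity.
Variables (A : staralg F) (nilA : nil3 A).
Hypothesis content_val0 : forall v : var -> A, adm v -> content_val v = 0.

(* Setting all symmetric even variables but x and y to 1 and all the others to 0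
   isolates the coefficients of the pair x, y. *)
Definition two_point (x y : var) (a b : A) (u : var) : A :=
  if u == x then a else if u == y then b else if skewvar u then 0 else 1.

Lemma adm_two_point x y a b : pure x.1 a -> pure y.1 b -> adm (two_point x y a b).
Proof.
move=> ha hb u; rewrite /two_point; case: eqP => [->//|_]; case: eqP => [->//|_].
rewrite /skewvar; case: eqVneq => [->|_]; [exact: pure1 | exact: pure0].
Qed.

Lemma two_pointl x y a b : two_point x y a b x = a.
Proof. by rewrite /two_point eqxx. Qed.

Lemma two_pointr x y a b : x != y -> two_point x y a b y = b.
Proof. by rewrite /two_point eqxx eq_sym => /negPf->. Qed.

Lemma wval_two_point1 x y a b w : x \notin w -> y \notin w ->
  [seq z <- w | skewvar z] = [::] -> wval (two_point x y a b) w = 1.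
Proof.
elim: w => [|z w IH]; first by rewrite wval_nil.
rewrite !in_cons !negb_or => /andP[xz xw] /andP[yz yw] /=.
rewrite wval_cons {1}/two_point [z == x]eq_sym [z == y]eq_sym (negPf xz) (negPf yz).
by case: skewvar => // h; rewrite IH // mulr1.
Qed.

Lemma comm_two_point x y a b u w : u != x -> u != y ->
  comm (two_point x y a b u) w = 0.
Proof.
move=> ux uy; rewrite {1}/two_point (negPf ux) (negPf uy).
by case: skewvar; rewrite ?comm1l // /comm mul0r mulr0 subrr.
Qed.

Lemma comm_two_point_same x a u w :
  comm (two_point x x a a u) (two_point x x a a w) = 0.
Proof.
have [->|ux] := eqVneq u x; last by rewrite comm_two_point.
have [->|wx] := eqVneq w x; first by rewrite commxx.
by rewrite commC comm_two_point // oppr0.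
Qed.

Lemma content_val_comm (v : var -> A) w : adm v -> perm_eq w0 w ->
  (forall x y, comm (v x) (v y) = 0) -> content_sum *: wval v w = 0.
Proof.
move=> vp ww hc; have := content_val_expand r c wd w0 nilA vp.
rewrite content_val0 // mul0rn [X in _ + X]big1 ?addr0; last first.
  by move=> x _; apply: big1 => y _; rewrite /pair_term hc mul0r scaler0.
rewrite (symval_perm vp nilA ww) /symval (all_commsE vp nilA (undup_uniq w)); last first.
  by move=> x; rewrite mem_undup.
rewrite [X in _ - X]big1 ?subr0; last first.
  by move=> x _; apply: big1 => y _; rewrite hc mul0r mul0rn.
by rewrite -scalerMnr => /esym/(mulrn_eq0_char charF0)->.
Qed.

Lemma content_val_two_point x y a b : x \in w0 -> y \in w0 -> x != y ->
  pure x.1 a -> pure y.1 b -> let v := two_point x y a b in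
  content_sum *: symval v w0 + content_diff x y *: (comm a b * wval v (rem y (rem x w0))) = 0.
Proof.
move=> xw yw xy ha hb v; have vp : adm v by apply: adm_two_point.
apply: (mulrn_eq0_char charF0 (n := 2)) => //.
have := content_val_expand4 r c wd w0 nilA vp; rewrite content_val0 // mul0rn mulrnDl => ->.
congr (_ + _); have xL : x \in L by rewrite mem_undup.
have yL : y \in L by rewrite mem_undup.
have z0 p q : p != x -> p != y -> pair_term w0 v p q = 0.
  by move=> px py; rewrite /pair_term comm_two_point // mul0r.
have z1 p q : q != x -> q != y -> pair_term w0 v p q = 0.
  by move=> qx qy; rewrite /pair_term commC comm_two_point // oppr0 mul0r.
have zz p : pair_term w0 v p p = 0 by rewrite /pair_term commxx mul0r.
rewrite (sum_seq2 (undup_uniq _) xL yL xy); last first.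
  by move=> p px py; apply: big1 => q _; rewrite z0 // scaler0.
rewrite (sum_seq2 (undup_uniq _) xL yL xy); last first.
  by move=> q qx qy; rewrite z1 // scaler0.
rewrite (sum_seq2 (undup_uniq _) xL yL xy); last first.
  by move=> q qx qy; rewrite z1 // scaler0.
rewrite !zz !scaler0 add0r addr0 (pair_termC nilA vp xw yw) scalerN -scaleNr.
rewrite [- content_diff y x]opprB -mulr2n /pair_term.
have -> : v x = a by exact: two_pointl.
by have -> : v y = b by exact: two_pointr.
Qed.

Lemma notin_noskew x w : skewvar x -> [seq z <- w | skewvar z] = [::] -> x \notin w.
Proof.
move=> hx e; apply/negP => xw.
by have : x \in [seq z <- w | skewvar z]; [rewrite mem_filter hx | rewrite e].
Qed.

(** The evaluation gives only the sum of the two terms. They have equal degree and opposite signs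
    under the superinvolution, hence vanish separately. *)
Lemma content_val_skew_pair x y w (a b : A) : perm_eq w0 (x :: y :: w) -> x != y ->
  skewvar x -> skewvar y -> [seq z <- w | skewvar z] = [::] ->
  pure x.1 a -> pure y.1 b ->
  content_sum *: anticomm a b = 0 /\ content_diff x y *: comm a b = 0.
Proof.
move=> pw xy hx hy hw ha hb.
have xw : x \in w0 by rewrite (perm_mem pw) mem_head.
have yw : y \in w0 by rewrite (perm_mem pw) in_cons mem_head orbT.
have vp := adm_two_point ha hb.
have W1 := @wval_two_point1 x y a b w (notin_noskew hx hw) (notin_noskew hy hw) hw.
have := content_val_two_point xw yw xy ha hb.
rewrite /= (symval_perm vp nilA pw) (symval_skew2 nilA vp _ hx hy).
rewrite two_pointl (two_pointr _ _ xy) W1 mulr1.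
have pr : perm_eq (rem y (rem x w0)) w.
  have := perm_rem y (perm_rem x pw).
  by rewrite /= eqxx [in X in perm_eq _ X]/= eqxx.
have := comm_perm vp nilA x y pr.
rewrite two_pointl (two_pointr _ _ xy) W1 mulr1 => ->.
apply: (pure_opp_eq0 charF0 (i := x.1.1 (+) y.1.1)
  (e := (x.1.1 && y.1.1) (+) x.1.2 (+) y.1.2)).
  apply: pureZ; have := pure_bracket false ha hb.
  by rewrite /brtype /= addbF.
apply: pureZ; have := pure_bracket true ha hb.
by rewrite /brtype /= addbT.
Qed.

Lemma content_sum_eq0 : let zs := [seq x <- w0 | skewvar x] in
  let t k := nth ty0 [seq x.1 | x <- zs] k in
  (size zs <= 2)%N -> prof A false (t 0%N) (t 1%N) -> content_sum = 0.
Proof.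
have : perm_eq w0 ([seq x <- w0 | skewvar x] ++ [seq x <- w0 | predC skewvar x]).
  by rewrite perm_sym perm_filterC.
have : [seq z <- [seq x <- w0 | predC skewvar x] | skewvar z] = [::].
  by rewrite -filter_predI (eq_filter (a2 := pred0)) ?filter_pred0 // => z /=; case: skewvar.
have : all skewvar [seq x <- w0 | skewvar x] by apply: filter_all.
move: [seq x <- w0 | predC _ x] => xs.
case: [seq x <- w0 | skewvar x] => [|x [|y [|d zs]]] //= hz hx pw _ [a [b [ha hb ab]]].
- pose v (u : var) : A := if skewvar u then 0 else 1.
  have vp : adm v.
    move=> u; rewrite /v /skewvar; case: eqVneq => [->|_]; [exact: pure1 | exact: pure0].
  have hc u u' : comm (v u) (v u') = 0.
    by rewrite /v; case: skewvar; rewrite ?comm1l // /comm mul0r mulr0 subrr.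
  have := content_val_comm vp pw hc.
  rewrite (_ : wval v xs = 1); last first.
    elim: xs hx {pw} => [|u xs IH] /=; first by rewrite wval_nil.
    by rewrite wval_cons; case e: (skewvar u) => // /IH->; rewrite mulr1 /v e.
  by move/eqP; rewrite scaler_eq0 oner_eq0 orbF => /eqP.
- have vp := adm_two_point ha ha; move: hz; rewrite andbT => hz.
  have hc := comm_two_point_same x a.
  have := content_val_comm vp pw hc; rewrite wval_cons two_pointl.
  have xxs := notin_noskew hz hx.
  rewrite wval_two_point1 // mulr1; case/scaler_eq0_or => // a0.
  by move: ab; rewrite a0 /bracket /anticomm mul0r mulr0 addr0 eqxx.
case/and3P: hz => hx' hy _; have [xy|xy] := eqVneq x y; last first.
  have [+ _] := content_val_skew_pair pw xy hx' hy hx ha hb.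
  by case/scaler_eq0_or => // e; rewrite /bracket e eqxx in ab.
(* A repeated letter only produces squares; polarization, that is evaluation at a + b, recovers the
   anticommutator. *)
rewrite -xy in pw hb.
have sq (d : A) : pure x.1 d -> content_sum *: (d * d) = 0.
  move=> hd; have vp := adm_two_point hd hd.
  have hc := comm_two_point_same x d.
  have := content_val_comm vp pw hc; rewrite !wval_cons two_pointl.
  have xxs := notin_noskew hx' hx.
  by rewrite wval_two_point1 // mulr1.
have : content_sum *: anticomm a b = 0.
  have := sq _ (pureD ha hb).
  rewrite mulrDl !mulrDr addrACA addrA [_ * _ + _ + _]addrAC -addrA.
  by rewrite !scalerDr !sq // add0r addr0 /anticomm -scalerDr.
by case/scaler_eq0_or => // e; rewrite /bracket e eqxx in ab.
Qed.

(** The multiplicity is a Boolean read as 0 or 1: any letter other than x and y that is not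
    symmetric even is evaluated to 0. Behind [a, b] the factors a and b commute. *)
Lemma two_point_power x y (a b : A) w : x != y -> pure x.1 a -> pure y.1 b ->
  comm a b * wval (two_point x y a b) w =
  comm a b * a ^+ count_mem x w * b ^+ count_mem y w
    *+ all (fun z => skewvar z ==> ((z == x) || (z == y))) w.
Proof.
move=> xy ha hb; have vp := adm_two_point ha hb.
have cA z u : two_point x y a b z * (comm a b * u) = comm a b * (two_point x y a b z * u).
  by have := commvCA vp nilA z x y u; rewrite two_pointl (two_pointr _ _ xy).
have cb u : comm a b * (b * (a * u)) = comm a b * (a * (b * u)).
  have := commv_comm vp nilA x y x y; rewrite two_pointl (two_pointr _ _ xy).
  rewrite {2}/comm mulrBr => /eqP; rewrite subr_eq0 => /eqP e.
  by have := congr1 (fun t => t * u) e; rewrite -!mulrA.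
have cbX m u : comm a b * (b * (a ^+ m * u)) = comm a b * (a ^+ m * (b * u)).
  elim: m u => [|m IH] u; first by rewrite !mul1r.
  rewrite exprS -!mulrA cb; have := cA x; rewrite two_pointl => cx.
  by rewrite -cx IH cx.
elim: w => [|z w IH]; first by rewrite wval_nil !mulr1.
rewrite wval_cons -cA IH mulrnAr /= -mulnb mulnC mulrnA.
have [->|zx] := eqVneq z x.
  rewrite two_pointl (negPf xy) /= implybT mulr1n; congr (_ *+ _).
  have := cA x; rewrite two_pointl => cx.
  by rewrite -!mulrA cx exprS -!mulrA.
have [->|zy] := eqVneq z y.
  rewrite (two_pointr _ _ xy) /= implybT mulr1n; congr (_ *+ _).
  have := cA y; rewrite (two_pointr _ _ xy) => cy.
  by rewrite -!mulrA cy cbX exprS.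
rewrite /two_point (negPf zx) (negPf zy) /= implybF.
by case: skewvar; rewrite ?mul0r ?mul1r ?mul0rn.
Qed.

Lemma content_cond_nec : content_cond r c wd w0 A.
Proof.
split; first exact: content_sum_eq0.
move=> x y xw yw xy hr [a0 [b0 [ha0 hb0 ab0]]].
set w := rem y (rem x w0) in hr *.
have pw : perm_eq w0 (x :: y :: w).
  apply: perm_trans (perm_to_rem xw) _; rewrite perm_cons perm_to_rem //.
  by apply: mem_rem_neq => //; rewrite eq_sym.
have count0 z : skewvar z -> count_mem z w = 0%N.
  by move=> hz; apply/count_memPn; apply: notin_noskew.
(* The evaluation leaves [a, b] times powers of a and b. If y is symmetric even, b + 1 is also
   admissible and has the same commutator with a, so [expr_shift_eq0] removes the power of b; the
   power of a is removed likewise. *)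
have main : content_sum = 0 -> content_diff x y = 0.
  move=> cs0; apply/eqP; apply: contraNT ab0 => d0; apply/eqP.
  have h0 (a b : A) : pure x.1 a -> pure y.1 b ->
      comm a b * a ^+ count_mem x w * b ^+ count_mem y w = 0.
    move=> ha hb; have := content_val_two_point xw yw xy ha hb.
    rewrite /= cs0 scale0r add0r (two_point_power _ xy ha hb) -/w.
    have -> : all (fun z => skewvar z ==> (z == x) || (z == y)) w.
      apply/allP => z zw; apply/implyP => hz.
      by move: (notin_noskew hz hr); rewrite zw.
    by case/scaler_eq0_or => // e; rewrite e eqxx in d0.
  have h1 (a b : A) : pure x.1 a -> pure y.1 b -> comm a b * a ^+ count_mem x w = 0.
    move=> ha hb; have [hy|hy] := boolP (skewvar y).
      by have := h0 _ _ ha hb; rewrite (count0 y hy) mulr1.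
    have py : pure y.1 (1 : A) by move: hy; rewrite negbK => /eqP->; exact: pure1.
    apply: (expr_shift_eq0 (h0 _ _ ha hb)).
    by have := h0 _ _ ha (pureD hb py); rewrite commDr comm1r addr0.
  have [hx|hx] := boolP (skewvar x).
    by have := h1 _ _ ha0 hb0; rewrite (count0 x hx) mulr1.
  have px : pure x.1 (1 : A) by move: hx; rewrite negbK => /eqP->; exact: pure1.
  apply: (expr_shift_eq0 (h1 _ _ ha0 hb0)).
  by have := h1 _ _ (pureD ha0 px) hb0; rewrite commDl comm1l addr0.
have pz := perm_filter skewvar pw.
have a00 : a0 != 0 by apply: contraNneq ab0 => ->; rewrite /bracket /comm mul0r mulr0 subrr.
have b00 : b0 != 0 by apply: contraNneq ab0 => ->; rewrite /bracket /comm mul0r mulr0 subrr.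
(* If both x and y are in [skewvar], the superinvolution separates the two parts. Otherwise
   [content_sum] vanishes first, the profile condition for it holding because a and b are
   nonzero. *)
have [hx|/negbTE hx] := boolP (skewvar x); have [hy|/negbTE hy] := boolP (skewvar y).
- have [_] := content_val_skew_pair pw xy hx hy hr ha0 hb0.
  by case/scaler_eq0_or => // e; rewrite /bracket e eqxx in ab0.
- rewrite /= hx hy hr in pz; apply/main/content_sum_eq0; rewrite (perm_small_eq _ pz) //=.
  exact: (prof0_neq0 charF0 ha0 a00).
- rewrite /= hx hy hr in pz; apply/main/content_sum_eq0; rewrite (perm_small_eq _ pz) //=.
  exact: (prof0_neq0 charF0 hb0 b00).
- rewrite /= hx hy hr in pz; apply/main/content_sum_eq0; rewrite (perm_small_eq _ pz) //=.
  exact: prof0_ty0.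
Qed.

End Necessity.

End Criterion.

(** * Splitting identities by multisets of letters *)

(** Dedekind's argument with vector coefficients: subtracting [chi b g] times the relation from its
    translate by g removes b, and multiplies the coefficient of a by the nonzero scalar
    [chi a g - chi b g]. *)
Lemma characters_indep (F : fieldType) (V : lmodType F) (G : Type)
    (mul : G -> G -> G) (one : G) (K : eqType) (chi : K -> G -> F)
    (s : seq K) (u : K -> V) :
  (forall a, chi a one = 1) -> (forall a g h, chi a (mul g h) = chi a g * chi a h) ->
  (forall a b, a \in s -> b \in s -> a != b -> exists g, chi a g != chi b g) ->
  uniq s -> (forall g, \sum_(a <- s) chi a g *: u a = 0) ->
  forall a, a \in s -> u a = 0.
Proof.
move=> chi1 chiM; elim: s u => // b s IH u sep /= /andP[bs us] h.
have us0 a : a \in s -> u a = 0.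
  move=> as_; have ba : a != b by apply: contraNneq bs => <-.
  have [g hg] := sep a b (@mem_behead _ (b :: s) a as_) (mem_head b s) ba.
  have hs a' b' : a' \in s -> b' \in s -> a' != b' -> exists g, chi a' g != chi b' g.
    by move=> ha hb; apply: sep; rewrite in_cons ?ha ?hb orbT.
  have h' k : \sum_(a <- s) chi a k *: ((chi a g - chi b g) *: u a) = 0.
    have e : chi b g *: (\sum_(a <- s) chi a k *: u a) =
        \sum_(a <- s) chi a (mul g k) *: u a.
      apply: (addrI (chi b (mul g k) *: u b)).
      have h1 := h k; have h2 := h (mul g k); rewrite !big_cons in h1 h2.
      by rewrite h2 chiM -scalerA -scalerDr h1 scaler0.
    rewrite (eq_bigr (fun a => chi a (mul g k) *: u a - chi b g *: (chi a k *: u a))).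
      by rewrite sumrB -e -scaler_sumr subrr.
    by move=> a' _; rewrite chiM !scalerA mulrBr scalerBl mulrC [chi a' k * chi b g]mulrC.
  have := IH (fun a => (chi a g - chi b g) *: u a) hs us h' a as_.
  by move/eqP; rewrite scaler_eq0 subr_eq0 (negPf hg) => /eqP.
move=> a; rewrite in_cons => /orP[/eqP->|]; last exact: us0.
have := h one; rewrite big_cons big1_seq ?addr0; last first.
  by move=> x /= /us0->; rewrite scaler0.
by rewrite chi1 scale1r.
Qed.

Lemma sum_fibers (V : nmodType) (I K : eqType) (r : seq I) (f : I -> K) (g : I -> V) :
  \sum_(i <- r) g i = \sum_(a <- undup [seq f i | i <- r]) \sum_(i <- r | f i == a) g i.
Proof.
rewrite (exchange_big_dep predT) //= [LHS]big_seq [RHS]big_seq.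
apply: eq_bigr => i ir; rewrite -big_filter.
rewrite (eq_filter (a2 := pred1 (f i))); last by move=> a; rewrite /= eq_sym.
rewrite filter_pred1_uniq ?undup_uniq ?big_seq1 //.
by rewrite mem_undup map_f.
Qed.

(** An arbitrary total order, chosen so that sorting turns multisets of letters into canonical
    lists. *)
Definition varle (x y : bool * bool * nat) : bool := (choice.pickle x <= choice.pickle y)%N.
Definition content (w : seq var) : seq var := sort varle w.

Lemma contentP w w' : perm_eq w w' = (content w == content w').
Proof.
apply/idP/eqP; last by move=> e; rewrite -(perm_sort varle w) [sort _ _]e perm_sort.
move=> h; apply/perm_sortP => //.
- by move=> x y; apply: leq_total.
- by move=> x y z; apply: leq_trans.
- move=> x y /andP[xy yx]; apply: (pcan_inj (@choice.pickleK _)).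
  by apply/eqP; rewrite eqn_leq; apply/andP.
Qed.

Lemma natr_inj_char (F : fieldType) : [pchar F] =i pred0 -> injective (fun n => n%:R : F).
Proof.
move=> charF0 m n; wlog mn : m n / (m <= n)%N.
  by move=> h e; case/orP: (leq_total m n) => le; [exact: h | exact/esym/h].
move=> e; apply/eqP; rewrite eqn_leq mn /= -subn_eq0 -((pcharf0P F).1 charF0).
by rewrite natrB // e subrr.
Qed.

Section Contents.
Variables (F : fieldType) (charF0 : [pchar F] =i pred0).
Variables (I : eqType) (r : seq I) (c : I -> F) (wd : I -> seq var).

Lemma content_valE (A : staralg F) (v : var -> A) w :
  content_val r c wd w v = \sum_(i <- r | content (wd i) == content w) c i *: wval v (wd i).
Proof. by apply: eq_bigl => i; rewrite contentP. Qed.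

Lemma sum_content_val (A : staralg F) (v : var -> A) :
  (forall w, content_val r c wd w v = 0) -> \sum_(i <- r) c i *: wval v (wd i) = 0.
Proof.
move=> h; rewrite (sum_fibers r (content \o wd)) big1_seq // => a /=.
rewrite mem_undup => /mapP[i _ ->].
exact: etrans (esym (content_valE _ _)) (h (wd i)).
Qed.

(** Rescaling every variable x by l x multiplies a word by a scalar that depends only on its
    multiset of letters. As functions of l these scalars are multiplicative, and distinct multisets
    give distinct ones. *)
Lemma content_val_split (A : staralg F) :
  (forall v : var -> A, adm v -> \sum_(i <- r) c i *: wval v (wd i) = 0) ->
  forall (v : var -> A) w, adm v -> content_val r c wd w v = 0.
Proof.
move=> h v w vp; rewrite content_valE.
pose s := undup [seq (content \o wd) i | i <- r].
pose chi (a : seq var) (l : var -> F) := \prod_(x <- a) l x.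
pose u a := \sum_(i <- r | content (wd i) == a) c i *: wval v (wd i).
have wvalZ l w' : wval (fun x => l x *: v x) w' = chi (content w') l *: wval v w'.
  rewrite /chi (perm_big w') /=; last exact: permEl (perm_sort _ _).
  elim: w' => [|x w' IH]; first by rewrite !wval_nil big_nil scale1r.
  by rewrite !wval_cons IH big_cons -scalerAl -scalerAr scalerA.
have hu a : a \in s -> u a = 0.
  apply: (@characters_indep F A (var -> F) (fun l m x => l x * m x) (fun=> 1) _ chi).
  - by move=> b; rewrite /chi big1.
  - by move=> b g k; rewrite /chi -big_split.
  - move=> b b'; rewrite !mem_undup => /mapP[i _ ->] /mapP[j _ ->] /= ne.
    have : ~~ perm_eq (content (wd i)) (content (wd j)).
      apply: contraNN ne; rewrite /content perm_sort perm_sym perm_sort perm_sym.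
      by rewrite contentP.
    (* Doubling only x gives the scalar 2 to the number of occurrences of x, and these powers are
       distinct in characteristic zero. *)
    move=> /allPn[x _ /= cx]; exists (fun y => if y == x then 2%:R else 1).
    have chiE a0 : chi a0 (fun y => if y == x then 2%:R else 1) = (2 ^ count_mem x a0)%:R.
      rewrite /chi; elim: a0 => [|y a0 IH]; first by rewrite big_nil.
      by rewrite big_cons IH /= expnD natrM; case: eqP; rewrite ?mul1r.
    rewrite !chiE; apply: contraNneq cx => /(natr_inj_char charF0) /eqP.
    by rewrite eqn_exp2l.
  - exact: undup_uniq.
  - move=> l; have := h (fun x => l x *: v x) (fun x => pureZ (l x) (vp x)).
    rewrite (sum_fibers r (content \o wd)) -/s => e; rewrite -[RHS]e.
    apply: eq_bigr => a' _; rewrite /u scaler_sumr; apply: eq_bigr => i /= /eqP<-.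
    by rewrite wvalZ !scalerA mulrC.
have [ws|ws] := boolP (content w \in s); first exact: hu.
rewrite big_seq_cond big1 // => i /andP[ir /eqP e]; case/negP: ws.
by rewrite mem_undup; apply/mapP; exists i; rewrite //= e.
Qed.

End Contents.

Section Identities.
Variables (F : fieldType) (charF0 : [pchar F] =i pred0).

Lemma fevalE (A : staralg F) (v : var -> A) (f : freestar F) :
  feval v f = \sum_(m <- msupp f) mcoeff m f *: wval v (fmonom_val m).
Proof.
rewrite /feval mmapE; apply: eq_bigr => m _.
by rewrite /= mulr_algl.
Qed.

(** [content_cond] involves the algebra only through its profile, and a larger profile imposes more
    conditions. *)
Lemma word_identity_mono (A B : staralg F) (I : eqType) (r : seq I) (c : I -> F)
    (wd : I -> seq var) :
  nil3 A -> nil3 B -> (forall s t u, prof B s t u -> prof A s t u) ->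
  (forall v : var -> A, adm v -> \sum_(i <- r) c i *: wval v (wd i) = 0) ->
  forall v : var -> B, adm v -> \sum_(i <- r) c i *: wval v (wd i) = 0.
Proof.
move=> nilA nilB pBA hA v vp; apply: sum_content_val => w.
apply: (content_cond_val charF0 nilB vp).
have [h1 h2] : content_cond r c wd w A.
  by apply: (content_cond_nec charF0 nilA) => v' vp'; apply: content_val_split.
split=> [sz /pBA|x y xw yw xy e /pBA]; [exact: h1 | exact: h2].
Qed.

Lemma Idstar_mono (A B : staralg F) : nil3 A -> nil3 B ->
  (forall s t u, prof B s t u -> prof A s t u) ->
  forall f, Idstar A f -> Idstar B f.
Proof.
move=> nilA nilB pBA f hf v hv; rewrite fevalE.
apply: (word_identity_mono nilA nilB pBA); last by case=> [[i e] j]; apply: hv.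
by move=> v' vp'; rewrite -fevalE; apply: hf => i e j; apply: (vp' ((i, e), j)).
Qed.

End Identities.

(** * Nonzero brackets of direct sums and of the listed algebras *)

Section DirectSums.
Variable F : fieldType.
Implicit Types A B C : staralg F.

Lemma pure_dsum2 A B t (x : dsum2 A B) : pure t x <-> pure t x.1 /\ pure t x.2.
Proof.
split=> [[[h1 h2] e]|[[h1 e1] [h2 e2]]].
  by split; split=> //; [have := congr1 fst e | have := congr1 snd e].
by split=> //; apply: injective_projections; [exact: e1 | exact: e2].
Qed.

Lemma nil3_dsum2 A B : nil3 A -> nil3 B -> nil3 (dsum2 A B).
Proof.
move=> nA nB; split.
- move=> t u w x y z /pure_dsum2[hx hx'] /pure_dsum2[hy hy'] /pure_dsum2[hz hz']; apply: injective_projections;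
  [exact: (nil3_comm2 nA  hx hy hz) | exact: (nil3_comm2 nB  hx' hy' hz')].
- move=> t u w x y z ht /pure_dsum2[hx hx'] /pure_dsum2[hy hy'] /pure_dsum2[hz hz']; apply: injective_projections;
  [exact: (nil3_mul_comm nA ht hx hy hz) | exact: (nil3_mul_comm nB ht hx' hy' hz')].
- move=> t u w x y z ht hu hw /pure_dsum2[hx hx'] /pure_dsum2[hy hy'] /pure_dsum2[hz hz']; apply: injective_projections;
  [exact: (nil3_mul3 nA ht hu hw hx hy hz) | exact: (nil3_mul3 nB ht hu hw hx' hy' hz')].
Qed.

Lemma bracket_dsum2 A B s (x y : dsum2 A B) :
  bracket s x y = (bracket s x.1 y.1, bracket s x.2 y.2).
Proof. by case: x y s => [x x'] [y y'] []. Qed.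

Lemma prof_dsum2 A B s t u : prof (dsum2 A B) s t u <-> prof A s t u \/ prof B s t u.
Proof.
split=> [[x [y [/pure_dsum2[hx hx'] /pure_dsum2[hy hy']]]]|].
  rewrite bracket_dsum2 => h.
  have [e|e] := eqVneq (bracket s x.1 y.1) 0; last by left; exists x.1, y.1.
  right; exists x.2, y.2; split=> //; apply: contraNneq h => e'.
  by rewrite e e'.
case=> [] [x [y [hx hy h]]].
  exists (x, 0), (y, 0); split; try by apply/pure_dsum2; split=> //; apply: pure0.
  by rewrite bracket_dsum2; apply: contraNneq h => /(congr1 fst) /= ->.
exists (0, x), (0, y); split; try by apply/pure_dsum2; split=> //; apply: pure0.
by rewrite bracket_dsum2; apply: contraNneq h => /(congr1 snd) /= ->.
Qed.

Lemma nil3_dsum A r : (forall C, List.In C (A :: r) -> nil3 C) -> nil3 (dsum A r).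
Proof.
elim: r A => [|B r IH] A h /=; first by apply: h; left.
apply: nil3_dsum2; first by apply: h; left.
by apply: IH => C hC; apply: h; right.
Qed.

Lemma prof_dsum A r s t u :
  prof (dsum A r) s t u <-> exists2 C, List.In C (A :: r) & prof C s t u.
Proof.
elim: r A => [|B r IH] A /=.
  split=> [h|[C [->|[]] //]]; by exists A => //; left.
split=> [/prof_dsum2[h|/IH[C hC h]]|[C [->|hC] h]].
- by exists A => //; left.
- by exists C => //; right.
- by apply/prof_dsum2; left.
- by apply/prof_dsum2; right; apply/IH; exists C.
Qed.

End DirectSums.

(** * Profiles forced by one bracket *)

Section Profile.
Variables (F : fieldType) (charF0 : [pchar F] =i pred0).

Definition core_types s (t1 t2 : ty) : seq ty := [:: ty0; t1; t2; brtype s t1 t2].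

(* The nonzero brackets that a nonzero bracket of type (s, t1, t2) forces. *)
Definition core_prof s0 (t1 t2 : ty) s (t u : ty) : bool :=
  ((s == s0) && (((t == t1) && (u == t2)) || ((t == t2) && (u == t1)))) ||
  (~~ s && (((t == ty0) && (u \in core_types s0 t1 t2)) ||
            ((u == ty0) && (t \in core_types s0 t1 t2)))).

Lemma prof_sym (A : staralg F) s t u : prof A s t u -> prof A s u t.
Proof.
case=> a [b [ha hb h]]; exists b, a; split=> //; move: h; rewrite /bracket.
by case: s; rewrite ?(anticommC b) // commC oppr_eq0.
Qed.

Lemma core_profP (A : staralg F) s0 t1 t2 s t u :
  prof A s0 t1 t2 -> core_prof s0 t1 t2 s t u -> prof A s t u.
Proof.
move=> h; have [a [b [ha hb ab]]] := h.
have a0 : a != 0.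
  by apply: contraNneq ab => ->; rewrite bracketE mul0r mulr0 mulr0 addr0.
have b0 : b != 0.
  by apply: contraNneq ab => ->; rewrite bracketE mul0r mulr0 mulr0 addr0.
have ht v : v \in core_types s0 t1 t2 -> prof A false v ty0.
  rewrite !inE => /or4P[] /eqP->; first exact: prof0_ty0.
  - exact: prof0_neq0 ha a0.
  - exact: prof0_neq0 hb b0.
  - exact: prof0_neq0 (pure_bracket s0 ha hb) ab.
case/orP=> [/andP[/eqP-> /orP[]/andP[/eqP-> /eqP->] //]|]; first exact: prof_sym.
case: s => //= /orP[]/andP[/eqP-> /ht] //; exact: prof_sym.
Qed.

(** By [core_profP] the profile of a model is contained in that of every algebra on which this
    bracket is nonzero. *)
Definition is_model (A : staralg F) s t1 t2 : Prop :=
  [/\ nil3 A, prof A s t1 t2 &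
      forall s' t u, prof A s' t u -> core_prof s t1 t2 s' t u].

Lemma is_model_sym A s t1 t2 : is_model A s t1 t2 -> is_model A s t2 t1.
Proof.
case=> h1 h2 h3; split=> //; first exact: prof_sym.
move=> s' t u /h3; rewrite /core_prof /core_types !inE.
have -> : brtype s t2 t1 = brtype s t1 t2.
  by case: s t1 t2 {h2 h3} => [] [[] []] [[] []].
by case: (s' == s) (s') (t == t1) (t == t2) (u == t1) (u == t2) => [] [] [] [] [] [];
   case: (t == ty0) (u == ty0) (t == brtype s t1 t2) (u == brtype s t1 t2) => [] [] [] [].
Qed.

End Profile.

(** * Computing profiles from spanning sets *)

Section Span.
Variables (F : fieldType) (charF0 : [pchar F] =i pred0).
Variables (A : staralg F) (S : seq (ty * A)).
Hypothesis S_pure : forall p, p \in S -> pure p.1 p.2.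
Hypothesis S_span : forall P : A -> Prop, P 0 ->
  (forall c x y, P x -> P y -> P (c *: x + y)) ->
  (forall p, p \in S -> P p.2) -> forall x, P x.

(** The grading separates the two degrees, and the superinvolution the two signs within each. *)
Lemma pure_indep (y : ty -> A) : (forall t, pure t (y t)) -> \sum_t y t = 0 ->
  forall t, y t = 0.
Proof.
move=> hy; rewrite (bigID (fun t : ty => t.1)) /=.
set y1 := \sum_(i | _) _; set y0 := \sum_(i | _) _ => e.
have h1 : homog true y1.
  rewrite /y1; elim/big_ind: _ => [||[i e'] /= ->]; [exact: homog0 | exact: homogD |].
  by have [] := hy (true, e').
have h0 : homog false y0.
  rewrite /y0; elim/big_ind: _ => [||[i e'] /= /negPf->]; [exact: homog0 | exact: homogD |].
  by have [] := hy (false, e').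
have y10 : y1 = - y0 by apply/eqP; rewrite -addr_eq0 e.
have z1 : y1 = 0.
  apply: homog_cap => //; rewrite y10 -sub0r; apply: homogB => //; exact: homog0.
have z0 : y0 = 0 by move: e; rewrite z1 add0r.
have pr (G : ty -> A) : \sum_(t : ty) G t = 
    G (false, false) + G (false, true) + (G (true, false) + G (true, true)).
  transitivity (\sum_(i : bool) \sum_(e : bool) G (i, e)).
    by rewrite pair_bigA; apply: eq_bigr => -[].
  by rewrite !big_bool /= addrC; congr (_ + _); rewrite addrC.
have s1 : y (true, false) + y (true, true) = 0.
  by rewrite -z1 /y1 big_mkcond pr /= !add0r.
have s0 : y (false, false) + y (false, true) = 0.
  by rewrite -z0 /y0 big_mkcond pr /= !addr0.
have [a b] := pure_opp_eq0 charF0 (hy (true, false)) (hy (true, true)) s1.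
have [a' b'] := pure_opp_eq0 charF0 (hy (false, false)) (hy (false, true)) s0.
by case=> [[] []].
Qed.

(** The induction along the span builds a decomposition into the four types whose component of type
    t satisfies P. For x of type t, directness of the sum identifies this component with x. *)
Lemma pure_lin_ind t (P : A -> Prop) : P 0 ->
  (forall c x y, P x -> P y -> P (c *: x + y)) ->
  (forall p, p \in S -> p.1 = t -> P p.2) -> forall x, pure t x -> P x.
Proof.
move=> P0 PD PS x hx.
pose Q u z := pure u z /\ (u = t -> P z).
have [y hy ey] : exists2 y : ty -> A, (forall u, Q u (y u)) & x = \sum_u y u.
  move: x {hx}; apply: S_span => [|c x x' [y hy ->] [y' hy' ->]|p pS].
  - exists (fun=> 0); last by rewrite big1.
    by move=> u; split=> // ; exact: pure0.
  - exists (fun u => c *: y u + y' u); last by rewrite big_split scaler_sumr.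
    move=> u; have [h1 h2] := hy u; have [h1' h2'] := hy' u; split.
      by apply: pureD => //; apply: pureZ.
    by move=> e; apply: PD; [exact: h2 | exact: h2'].
  exists (fun u => if u == p.1 then p.2 else 0); last first.
    by rewrite -big_mkcond big_pred1_eq.
  move=> u; case: eqP => [->|_]; last by split=> //; exact: pure0.
  by split; [exact: S_pure | exact: PS].
have := @pure_indep (fun u => y u - (if u == t then x else 0)).
move=> /(_ _ _ t); rewrite eqxx => h.
suff -> : x = y t by have [_] := hy t; apply.
apply/eqP; rewrite -subr_eq0 -oppr_eq0 opprB; apply/eqP/h => [u|].
  have [h1 _] := hy u.
  by case: eqP => [e|_]; apply: pureB => //; rewrite ?e //; exact: pure0.
by rewrite sumrB -ey -big_mkcond big_pred1_eq subrr.
Qed.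

Lemma prof_span s t u : prof A s t u ->
  exists p q, [/\ p \in S, q \in S, p.1 = t, q.1 = u & bracket s p.2 q.2 != 0].
Proof.
case=> x [y [hx hy h]]; apply: contrapT => hn; move/eqP: h; apply.
have h0 p q : p \in S -> q \in S -> p.1 = t -> q.1 = u -> bracket s p.2 q.2 = 0.
  move=> pS qS pt qu; apply: contrapT => /eqP h; apply: hn; by exists p, q.
move: x hx; apply: pure_lin_ind => [|c x x' hx hx'|p pS pt].
- by rewrite bracketE mul0r mulr0 mulr0 addr0.
- rewrite bracketE mulrDl mulrDr -scalerAl -scalerAr mulrDr addrACA.
  rewrite -scalerAr -scalerDr -!bracketE hx hx' scaler0 addr0 //.
move: y hy; apply: pure_lin_ind => [|c x x' hx hx'|q qS qu].
- by rewrite bracketE mul0r mulr0 mulr0 addr0.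
- rewrite bracketE mulrDl mulrDr -scalerAl -scalerAr mulrDr addrACA.
  rewrite -scalerAr -scalerDr -!bracketE hx hx' scaler0 addr0 //.
exact: h0.
Qed.

End Span.

Section MatrixModel.
Variables (F : fieldType) (charF0 : [pchar F] =i pred0) (n : nat).
Variables (V : {vspace 'M[F]_n.+1}) (D : bool -> {vspace 'M[F]_n.+1}).
Variables (s : 'M[F]_n.+1 -> 'M[F]_n.+1) (H : superinv_mx V D s).
Variable L : seq (ty * 'M[F]_n.+1).

Hypothesis L_homog : forall p, p \in L -> p.2 \in D p.1.1.
Hypothesis L_star : forall p, p \in L -> s p.2 = (-1) ^+ p.1.2 *: p.2.
Hypothesis L_span : (V <= <<1%R :: [seq p.2 | p <- L]>>)%VS.
Hypothesis L_mul3 : forall p q r, p \in L -> q \in L -> r \in L ->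
  p.2 * q.2 * r.2 = 0.

Let M := mxstaralg H.
Let proj (x : 'M[F]_n.+1) : M := vsproj (mxstar_aspace H) x.
Let S : seq (ty * M) := (ty0, 1) :: [seq (p.1, proj p.2) | p <- L].

Let L_V p : p \in L -> p.2 \in V.
Proof.
move=> /L_homog; rewrite -(simx_sum H).
by case: p.1.1; apply: subvP; rewrite ?addvSl ?addvSr.
Qed.

Let projK x : x \in V -> vsval (proj x) = x.
Proof. by move=> h; rewrite /proj vsprojK. Qed.

Let oneV : 1%R \in V.
Proof. by rewrite -(simx_sum H); apply: (subvP (addvSl _ _)); exact: simx_1 H. Qed.

Let val1 : vsval (1%R : M) = 1%R.
Proof. by apply/eqP; rewrite (algid_eq1 (mxstar_aspace H)). Qed.

Let S_pure p : p \in S -> pure p.1 p.2.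
Proof.
rewrite in_cons => /orP[/eqP->|/mapP[q qL ->]] /=; first exact: pure1.
have qV := L_V qL; split; first by rewrite /homog /= projK // L_homog.
have -> : star (proj q.2) = proj (s (vsval (proj q.2))) by [].
by rewrite projK // L_star // /proj linearZ.
Qed.

Let S_span (P : M -> Prop) : P 0 ->
  (forall c x y, P x -> P y -> P (c *: x + y)) ->
  (forall p, p \in S -> P p.2) -> forall x, P x.
Proof.
move=> P0 PD PS x.
have hx := subvP L_span (vsval x) (subvsP x).
have -> : x = proj (vsval x) by rewrite /proj vsvalK.
move: hx; apply: (span_lin_ind (P := fun z => P (proj z))).
- by rewrite /proj linear0.
- by move=> c y z; rewrite /proj linearP; apply: PD.
move=> z; rewrite in_cons => /orP[/eqP->|/mapP[p pL ->]].
  have -> : proj 1 = 1 by apply: subvs_inj; rewrite projK // val1.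
  exact: (PS (ty0, 1) (mem_head _ _)).
apply: (PS (p.1, proj p.2)); rewrite in_cons; apply/orP; right.
by apply/mapP; exists p.
Qed.

Let valM (x y : M) : vsval (x * y) = vsval x * vsval y. Proof. by []. Qed.

Let val_bracket b (x y : M) : vsval (bracket b x y) = bracket b (vsval x) (vsval y).
Proof. by case: b. Qed.

Let S_mul3 p q r : p \in S -> q \in S -> r \in S -> p.1 != ty0 \/ p.2 != 1 -> 
  q.1 != ty0 \/ q.2 != 1 -> r.1 != ty0 \/ r.2 != 1 -> p.2 * q.2 * r.2 = 0.
Proof.
have aux x : x \in S -> x.1 != ty0 \/ x.2 != 1 ->
    exists2 y, y \in L & x = (y.1, proj y.2).
  by rewrite in_cons => /orP[/eqP->|/mapP[y yL ->]]; [case; rewrite eqxx | exists y].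
move=> pS qS rS /(aux _ pS)[p' pL ->] /(aux _ qS)[q' qL ->] /(aux _ rS)[r' rL ->].
by apply: subvs_inj; rewrite !valM /= !projK ?L_V // L_mul3.
Qed.

(** The identity has zero commutators and is of type [ty0], so by linearity only products of three
    elements of L remain. *)
Lemma mxstar_nil3 : nil3 M.
Proof.
have lin := pure_lin_ind charF0 S_pure S_span.
split=> [t u w x y z hx hy hz|t u w x y z t0 hx hy hz|t u w x y z t0 u0 w0 hx hy hz].
- move: x hx; apply: (lin) => [|c a b ha hb|p pS _]; first by rewrite comm0l.
    by rewrite commDl commZl ha hb scaler0 addr0.
  move: y hy; apply: (lin) => [|c a b ha hb|q qS _]; first by rewrite comm0l comm0r.
    by rewrite commDl commZl commDr commZr ha hb scaler0 addr0.
  move: z hz; apply: (lin) => [|c a b ha hb|r rS _]; first by rewrite !comm0r.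
    by rewrite [comm q.2 _]commDr commZr (commDr (c *: _)) commZr ha hb scaler0 addr0.
  have [->|p1] := eqVneq p.2 1; first by rewrite comm1l.
  have [->|q1] := eqVneq q.2 1; first by rewrite comm1l comm0r.
  have [->|r1] := eqVneq r.2 1; first by rewrite comm1r comm0r.
  by rewrite /comm mulrBr mulrBl !mulrA !S_mul3 ?subrr; auto.
- move: x hx; apply: (lin) => [|c a b ha hb|p pS pt]; first by rewrite mul0r.
    by rewrite mulrDl hb addr0 -scalerAl ha scaler0.
  move: y hy; apply: (lin) => [|c a b ha hb|q qS _]; first by rewrite comm0l mulr0.
    by rewrite commDl commZl mulrDr hb addr0 -scalerAr ha scaler0.
  move: z hz; apply: (lin) => [|c a b ha hb|r rS _]; first by rewrite comm0r mulr0.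
    by rewrite commDr commZr mulrDr hb addr0 -scalerAr ha scaler0.
  have [->|q1] := eqVneq q.2 1; first by rewrite comm1l mulr0.
  have [->|r1] := eqVneq r.2 1; first by rewrite comm1r mulr0.
  by rewrite -pt in t0; rewrite /comm mulrBr !mulrA !S_mul3 ?subrr; auto.
move: x hx; apply: (lin) => [|c a b ha hb|p pS pt]; first by rewrite !mul0r.
  by rewrite !mulrDl hb addr0 -!scalerAl ha scaler0.
move: y hy; apply: (lin) => [|c a b ha hb|q qS qt].
- by rewrite mulr0 mul0r.
- by rewrite mulrDr mulrDl hb addr0 -scalerAr -scalerAl ha scaler0.
move: z hz; apply: (lin) => [|c a b ha hb|r rS rt].
- by rewrite mulr0.
- by rewrite mulrDr hb addr0 -scalerAr ha scaler0.
by rewrite S_mul3 //; left; rewrite ?pt ?qt ?rt.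
Qed.

Variables (s0 : bool) (t1 t2 : ty).
Hypothesis L_bracket : forall b p q, p \in L -> q \in L ->
  bracket b p.2 q.2 != 0 -> core_prof s0 t1 t2 b p.1 q.1.
Hypothesis L_types : forall p, p \in L -> p.1 \in core_types s0 t1 t2.
Hypothesis L_core : exists p q, [/\ p \in (ty0, 1) :: L, q \in (ty0, 1) :: L,
  p.1 = t1, q.1 = t2 & bracket s0 p.2 q.2 != 0].

Lemma mxstar_is_model : is_model M s0 t1 t2.
Proof.
have lift p : p \in (ty0, 1) :: L -> exists2 x : M, pure p.1 x & vsval x = p.2.
  rewrite in_cons => /orP[/eqP->|pL]; first by exists 1; [exact: pure1|exact: val1].
  exists (proj p.2); last by rewrite projK // L_V.
  apply: (S_pure (p := (p.1, proj p.2))); rewrite in_cons; apply/orP; right.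
  by apply/mapP; exists p.
have sub p : p \in S -> exists2 q, q \in (ty0, 1) :: L & q.1 = p.1 /\ q.2 = vsval p.2.
  rewrite in_cons => /orP[/eqP->|/mapP[q qL ->]].
    by exists (ty0, 1); rewrite ?mem_head ?val1.
  by exists q; rewrite ?in_cons ?qL ?orbT //= projK // L_V.
split; first exact: mxstar_nil3.
  have [p [q [/lift[x hx ex] /lift[y hy ey] <- <- h]]] := L_core.
  exists x, y; split=> //; apply: contraNneq h => /(congr1 vsval).
  by rewrite val_bracket ex ey => ->; rewrite linear0.
move=> b t u /(prof_span charF0 S_pure S_span)[p [q [/sub[p' pS [<- ep]] /sub[q' qS [<- eq]] <- <- h]]].
have {h} : bracket b p'.2 q'.2 != 0.
  apply: contraNneq h => e; apply/eqP/subvs_inj.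
  by rewrite val_bracket -ep -eq e linear0.
move: pS qS; rewrite !in_cons => /orP[/eqP->|pL] /orP[/eqP->|qL] /=.
- case: b; rewrite /bracket; first by rewrite comm1l eqxx.
  by rewrite /core_prof /core_types !inE eqxx orbT.
- case: b; rewrite /bracket; first by rewrite comm1l eqxx.
  by rewrite /core_prof L_types ?eqxx ?orbT.
- case: b; rewrite /bracket; first by rewrite comm1r eqxx.
  by rewrite /core_prof L_types ?eqxx ?orbT.
exact: L_bracket.
Qed.

End MatrixModel.

Lemma core_prof_sym s0 t1 t2 s t u :
  core_prof s0 t1 t2 s t u = core_prof s0 t1 t2 s u t.
Proof.
rewrite /core_prof; congr ((_ && _) || (_ && _)); last by rewrite orbC.
by case: (t == t1) (t == t2) (u == t1) (u == t2) => [] [] [] [].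
Qed.

Section CoreTable.
Variables (F : fieldType) (charF0 : [pchar F] =i pred0) (n : nat).
Variables (V : {vspace 'M[F]_n.+1}) (D : bool -> {vspace 'M[F]_n.+1}).
Variables (s : 'M[F]_n.+1 -> 'M[F]_n.+1) (H : superinv_mx V D s).
Variables (t1 t2 : ty) (b c : 'M[F]_n.+1) (L0 : seq (ty * 'M[F]_n.+1)) (s0 : bool).
Let L := (t1, b) :: (t2, c) :: L0.

(** The alternative [b = c] serves the algebras C_3. The alternative [t1 == ty0], for a commutator,
    serves N_3 and U_3: there the anticommutator of b and c may be nonzero too, but a nonzero c
    already forces an anticommutator of these types. *)
Lemma core_is_model :
  (forall p, p \in L -> p.2 \in D p.1.1) ->
  (forall p, p \in L -> s p.2 = (-1) ^+ p.1.2 *: p.2) ->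
  (V <= <<1%R :: [seq p.2 | p <- L]>>)%VS ->
  (forall q, q \in L0 -> [/\ b * q.2 = 0, q.2 * b = 0, c * q.2 = 0, q.2 * c = 0 &
     forall r, r \in L0 -> q.2 * r.2 = 0]) ->
  (b * b = 0 /\ c * c = 0) \/ (b = c /\ t1 = t2) ->
  b * c * b = 0 -> c * b * c = 0 ->
  (bracket (~~ s0) b c = 0 \/ ~~ (~~ s0) && (t1 == ty0)) ->
  bracket s0 b c != 0 ->
  (forall q, q \in L0 -> q.1 \in core_types s0 t1 t2) ->
  is_model (mxstaralg H) s0 t1 t2.
Proof.
move=> h1 h2 h3 h4 h5 bcb cbc h6 h7 h8.
have eqv : b = c -> c * c * c = 0 by move=> e; move: cbc; rewrite e.
have bbc : b * b * c = 0.
  by case: h5 => [[-> _]|[e _]]; [rewrite mul0r | rewrite !e eqv].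
have bcc : b * c * c = 0.
  by case: h5 => [[_ e]|[e _]]; [rewrite -mulrA e mulr0 | rewrite !e eqv].
have bbb : b * b * b = 0.
  by case: h5 => [[-> _]|[e _]]; [rewrite mul0r | rewrite !e eqv].
have ccc : c * c * c = 0.
  by case: h5 => [[_ ->]|[e _]]; [rewrite mul0r | rewrite eqv].
have cbb : c * b * b = 0.
  by case: h5 => [[e _]|[e _]]; [rewrite -mulrA e mulr0 | rewrite !e eqv].
have ccb : c * c * b = 0.
  by case: h5 => [[_ ->]|[e _]]; [rewrite mul0r | rewrite !e eqv].
apply: (@mxstar_is_model F charF0 n V D s H L) => //.
- have z0 (x y z : 'M[F]_n.+1) : x * y = 0 \/ y * z = 0 -> x * y * z = 0.
    by case=> e; [rewrite e mul0r | rewrite -mulrA e mulr0].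
  move=> p q r; rewrite !in_cons => /or3P[/eqP->|/eqP->|/h4[? ? ? ? hp]];
  move=> /or3P[/eqP->|/eqP->|/[dup] hq /h4[? ? ? ? hq']] /or3P[/eqP->|/eqP->|/[dup] hr /h4[? ? ? ? hr']] //=;
  by apply: z0; auto.
- have z0 k (x y : 'M[F]_n.+1) : x * y = 0 -> y * x = 0 -> bracket k x y = 0.
    by move=> e e'; rewrite bracketE e e' mulr0 addr0.
  have sym12 k : bracket k b c != 0 -> core_prof s0 t1 t2 k t1 t2.
    have [->|ks] := eqVneq k s0; first by rewrite /core_prof !eqxx.
    have -> : k = ~~ s0 by case: (k) (s0) ks => [] [].
    case: h6 => [->|/andP[/negPf e /eqP->]]; first by rewrite eqxx.
    by rewrite /core_prof e /core_types !inE !eqxx !orbT.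
  have sym21 k : bracket k c b != 0 -> core_prof s0 t1 t2 k t2 t1.
    have -> : (bracket k c b != 0) = (bracket k b c != 0).
      by case: k; rewrite /bracket ?(anticommC b) // commC oppr_eq0.
    by move/sym12; rewrite core_prof_sym.
  have same k x t : (t, x) \in [:: (t1, b); (t2, c)] -> bracket k x x != 0 ->
      core_prof s0 t1 t2 k t t.
    rewrite !inE => /orP[/eqP[-> ->]|/eqP[-> ->]] hk.
      case: h5 => [[e _]|[e e']]; first by rewrite z0 ?eqxx // in hk.
      by rewrite {3}e'; apply: sym12; rewrite -e.
    case: h5 => [[_ e]|[e e']]; first by rewrite z0 ?eqxx // in hk.
    by rewrite -{2}e'; apply: sym12; rewrite e.
  move=> k p q; rewrite !in_cons => /or3P[/eqP->|/eqP->|/[dup] hp /h4[? ? ? ? hp']];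
  move=> /or3P[/eqP->|/eqP->|/[dup] hq /h4[? ? ? ? hq']] /=;
  try (by rewrite z0 ?eqxx //; auto).
  + by apply: same; rewrite !inE eqxx.
  + exact: sym12.
  + exact: sym21.
  + by apply: same; rewrite !inE eqxx orbT.
- move=> p pL; move: pL; rewrite in_cons => /orP[/eqP->|].
    by rewrite /core_types !inE eqxx orbT.
  rewrite in_cons => /orP[/eqP->|/h8 //].
  by rewrite /core_types !inE eqxx !orbT.
- exists (t1, b), (t2, c); split=> //; by rewrite !in_cons eqxx ?orbT.
Qed.

End CoreTable.

(** * The listed algebras as models *)

Section C2Models.
Variables (F : fieldType) (charF0 : [pchar F] =i pred0).

Lemma C2_is_model d (e : bool) (s : 'M[F]_2 -> 'M[F]_2)
    (H : superinv_mx (full_span (C2basis F d)) (graded_span (C2basis F d)) s) :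
  s (eu 1 2) = (-1) ^+ e *: eu 1 2 -> (d, e) != ty0 ->
  is_model (mxstaralg H) false ty0 (d, e).
Proof.
move=> se de; have bb : eu 1 2 * eu 1 2 = 0 :> 'M[F]_2 by apply: C2_mulb.
have b0 : eu 1 2 != 0 :> 'M[F]_2.
  by apply/eqP => /matrixP/(_ 0 1); rewrite !mxE /= => /eqP; rewrite oner_eq0.
apply: (@mxstar_is_model F charF0 _ _ _ _ H [:: ((d, e), eu 1 2)]) => //.
- by move=> p; rewrite inE => /eqP->; apply: memv_graded; rewrite !inE eqxx orbT.
- by move=> p; rewrite inE => /eqP->.
- by move=> p q r; rewrite !inE => /eqP-> /eqP-> /eqP->; rewrite bb mul0r.
- by move=> k p q; rewrite !inE => /eqP-> /eqP->; rewrite bracketE bb mulr0 addr0 eqxx.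
- by move=> p; rewrite inE => /eqP->; rewrite /core_types !inE eqxx !orbT.
- exists (ty0, 1), ((d, e), eu 1 2); split=> //; rewrite ?inE ?eqxx ?orbT //.
  rewrite /bracket /anticomm /= mulr1 mul1r -mulr2n; apply: contraNneq b0.
  by move/(mulrn_eq0_char charF0) => /(_ isT) ->.
Qed.

Lemma C2_gr_model : is_model (C2_gr F) false ty0 (true, false).
Proof. by apply: C2_is_model; rewrite ?scale1r. Qed.

Lemma C2neg_eu : C2neg (eu 1 2) = - eu 1 2 :> 'M[F]_2.
Proof. by rewrite /C2neg /C2elt; mx_entries; rewrite raddf0 add0r scaleN1r. Qed.

Lemma C2_star_model : is_model (C2_star F) false ty0 (false, true).
Proof. by apply: C2_is_model; rewrite // C2neg_eu scaleN1r. Qed.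

Lemma C2_star_gr_model : is_model (C2_star_gr F) false ty0 (true, true).
Proof. by apply: C2_is_model; rewrite // C2neg_eu scaleN1r. Qed.

End C2Models.

Section C3Models.
Variables (F : fieldType) (charF0 : [pchar F] =i pred0).

Lemma C3_is_model d (e : bool) (s : 'M[F]_3 -> 'M[F]_3)
    (H : superinv_mx (full_span (C3basis F d)) (graded_span (C3basis F d)) s) :
  s (eu 1 2 + eu 2 3) = (-1) ^+ e *: (eu 1 2 + eu 2 3) ->
  s (eu 1 3) = (-1) ^+ d *: eu 1 3 ->
  is_model (mxstaralg H) false (d, e) (d, e).
Proof.
move=> sb sc; set b := eu 1 2 + eu 2 3 in sb *.
have bb : b * b = eu 1 3 :> 'M[F]_3 by rewrite /b; eu_simp.
have c0 : eu 1 3 != 0 :> 'M[F]_3.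
  by apply/eqP => /matrixP/(_ 0 2); rewrite !mxE /= => /eqP; rewrite oner_eq0.
have bc : b * eu 1 3 = 0 :> 'M[F]_3 by rewrite /b; eu_simp.
have cb : eu 1 3 * b = 0 :> 'M[F]_3 by rewrite /b; eu_simp.
have cc : eu 1 3 * eu 1 3 = 0 :> 'M[F]_3 by eu_simp.
have bE : b = eu 1 2 + eu 2 3 by [].
apply: (@core_is_model F charF0 _ _ _ _ H (d, e) (d, e) b b [:: ((false, d), eu 1 3)]).
- move=> p; rewrite !inE => /or3P[]/eqP->; apply: memv_graded; rewrite !inE ?bE eqxx ?orbT //.
- by move=> p; rewrite !inE => /or3P[]/eqP->.
- apply: sub_span => x; rewrite !inE => /or3P[]/eqP->; rewrite ?bE eqxx ?orbT //.
- by move=> q; rewrite inE => /eqP->; split=> // r; rewrite inE => /eqP->.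
- by right.
- by rewrite bb cb.
- by rewrite bb cb.
- by left; rewrite /bracket /= commxx.
- rewrite /bracket /anticomm bb -mulr2n; apply: contraNneq c0.
  by move/(mulrn_eq0_char charF0) => ->.
- move=> q; rewrite inE => /eqP->; rewrite /core_types !inE /=.
  by case: (d) (e) => [] [].
Qed.

Ltac C3_star := rewrite ?/C3_i1 ?/C3_i2 ?/C3_i3 /C3elt; mx_entries;
  rewrite ?(raddf0, scale0r, scaleN1r, scale1r, addr0, add0r, expr1, expr0, oppr0).

Lemma C3_i1_model : is_model (C3_i1_gr F) false (true, false) (true, false).
Proof. by apply: C3_is_model; C3_star. Qed.

Lemma C3_i2_model : is_model (C3_i2_triv F) false (false, true) (false, true).
Proof. by apply: C3_is_model; C3_star. Qed.

Lemma C3_i3_model : is_model (C3_i3_gr F) false (true, true) (true, true).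
Proof. by apply: C3_is_model; C3_star. Qed.

End C3Models.

Section Dim4Models.
Variables (F : fieldType) (charF0 : [pchar F] =i pred0).

(** The bracket selected by [eps] takes the value 2d on b, c and the opposite one vanishes. Thus
    commuting generators, as in W, realize an anticommutator, and anticommuting ones, as in G_2, a
    commutator. *)
Lemma dim4_is_model (d1 d2 e1 e2 eps : bool) (b c d : 'M[F]_4) s
    (bs := [:: (false, 1); (d1, b); (d2, c); (d1 (+) d2, d)])
    (H : superinv_mx (full_span bs) (graded_span bs) s) :
  b * b = 0 -> c * c = 0 -> b * c = d -> c * b = (-1) ^+ eps *: d -> d != 0 ->
  s b = (-1) ^+ e1 *: b -> s c = (-1) ^+ e2 *: c ->
  is_model (mxstaralg H) eps (d1, e1) (d2, e2).
Proof.
move=> bb cc bc cb d0 sb sc.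
have bd : b * d = 0 by rewrite -bc mulrA bb mul0r.
have dc : d * c = 0 by rewrite -bc -mulrA cc mulr0.
have db : d * b = 0 by rewrite -bc -mulrA cb -scalerAr bd scaler0.
have cd : c * d = 0 by rewrite -bc mulrA cb -scalerAl dc scaler0.
have dd : d * d = 0 by rewrite -{1}bc -mulrA cd mulr0.
have hb : b \in graded_span bs d1 by apply: memv_graded; rewrite !inE eqxx ?orbT.
have hc : c \in graded_span bs d2 by apply: memv_graded; rewrite !inE eqxx ?orbT.
have hd : d \in graded_span bs (d1 (+) d2) by apply: memv_graded; rewrite !inE eqxx ?orbT.
pose td := (d1 (+) d2, (d1 && d2) (+) e1 (+) e2 (+) eps).
have sd : s d = (-1) ^+ td.2 *: d.
  rewrite -bc (simx_M H hb hc) sb sc -scalerAl -scalerAr cb bc !scalerA -!signr_addb.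
  by congr ((-1) ^+ (nat_of_bool _) *: _); rewrite /td /=;
    case: (d1) (d2) (e1) (e2) (eps) => [] [] [] [] [].
apply: (@core_is_model F charF0 _ _ _ _ H (d1, e1) (d2, e2) b c [:: (td, d)]).
- by move=> p; rewrite !inE => /or3P[]/eqP->.
- by move=> p; rewrite !inE => /or3P[]/eqP->.
- by apply: sub_span => x; rewrite !inE => /or4P[]/eqP->; rewrite eqxx ?orbT.
- by move=> q; rewrite inE => /eqP->; split=> // r; rewrite inE => /eqP->.
- by left.
- by rewrite bc db.
- by rewrite cb -scalerAl dc scaler0.
- left; rewrite bracketE bc cb mulr_sign.
  by case: (eps); rewrite /= ?expr0 ?expr1 ?scale1r ?scaleN1r subrr.
- rewrite bracketE bc cb mulr_sign; apply: contraNneq d0.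
  have -> : (if eps then - ((-1) ^+ eps *: d) else (-1) ^+ eps *: d) = d.
    by case: (eps); rewrite /= ?expr0 ?expr1 ?scale1r ?scaleN1r ?opprK.
  by rewrite -mulr2n => /(mulrn_eq0_char charF0) ->.
- by move=> q; rewrite inE => /eqP->; rewrite /core_types !inE /td /= /brtype /= eqxx !orbT.
Qed.

Ltac W_star := rewrite ?/W_eta1 ?/W_eta2 ?/W_eta3 /Welt; mx_entries;
  rewrite ?(raddf0, scale0r, scaleN1r, scale1r, addr0, add0r, expr1, expr0, oppr0).

Lemma eu14_neq0 : eu 1 4 != 0 :> 'M[F]_4.
Proof.
by apply/eqP => /matrixP/(_ 0 3); rewrite !mxE /= => /eqP; rewrite oner_eq0.
Qed.

Lemma W_is_model (d1 d2 e1 e2 : bool) (s : 'M[F]_4 -> 'M[F]_4)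
    (H : superinv_mx (full_span (Wbasis F d1 d2)) (graded_span (Wbasis F d1 d2)) s) :
  s (eu 1 2 + eu 3 4) = (-1) ^+ e1 *: (eu 1 2 + eu 3 4) ->
  s (eu 1 3 + eu 2 4) = (-1) ^+ e2 *: (eu 1 3 + eu 2 4) ->
  is_model (mxstaralg H) false (d1, e1) (d2, e2).
Proof.
move=> h1 h2; apply: dim4_is_model => //; try exact: eu14_neq0; by eu_simp.
Qed.

Lemma W_eta1_model : is_model (W_eta1_gri F) false (false, true) (true, false).
Proof. by apply: W_is_model; W_star. Qed.

Lemma W_eta2_model : is_model (W_eta2_gr F) false (true, true) (true, false).
Proof. by apply: W_is_model; W_star. Qed.

Lemma W_eta3_model : is_model (W_eta3_gri F) false (false, true) (true, true).
Proof. by apply: W_is_model; W_star. Qed.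

Lemma G2_is_model d1 d2 e1 e2 :
  is_model (mxstaralg (G2_superinv F d1 d2 e1 e2)) true (d1, e1) (d2, e2).
Proof.
apply: dim4_is_model => //.
- by rewrite /g1; eu_simp.
- by rewrite /g2; eu_simp.
- by rewrite g2g1 scaleN1r.
- by rewrite g1g2 eu14_neq0.
- have [] := G2_coords (0 : F) 1 0 0; rewrite !scale0r !addr0 add0r scale1r.
  by rewrite /G2star => -> -> -> ->; rewrite !scale0r !addr0 add0r scale1r.
- have [] := G2_coords (0 : F) 0 1 0; rewrite !scale0r !addr0 !add0r scale1r.
  by rewrite /G2star => -> -> -> ->; rewrite !scale0r !addr0 !add0r scale1r.
Qed.

End Dim4Models.

Section NUModels.
Variables (F : fieldType) (charF0 : [pchar F] =i pred0).

(** The reflection exchanges e_13 and e_46, so their sum and difference are used instead. One of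
    these has the type of the commutator of the generators, the other the type of g. *)
Lemma NU_is_model (eps d : bool) V D (H : superinv_mx V D (@reflection F)) :
  V = full_span (NUbasis F eps d) -> D =1 graded_span (NUbasis F eps d) ->
  is_model (mxstaralg H) true ty0 (d, eps).
Proof.
move=> VE DE; set g := eu 1 2 + (-1) ^+ eps *: eu 5 6 : 'M[F]_6.
set f := eu 2 3 + eu 4 5 : 'M[F]_6; set q := eu 1 3 : 'M[F]_6; set r := eu 4 6 : 'M[F]_6.
have fg : f * g = (-1) ^+ eps *: r by rewrite /f /g; eu_simp.
have gf : g * f = q by rewrite /f /g; eu_simp.
have ff : f * f = 0 by rewrite /f; eu_simp.
have gg : g * g = 0 by rewrite /g; eu_simp.
have fq : f * q = 0 by rewrite /f /q; eu_simp.
have fr : f * r = 0 by rewrite /f /r; eu_simp.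
have qf : q * f = 0 by rewrite /f /q; eu_simp.
have rf : r * f = 0 by rewrite /f /r; eu_simp.
have gq : g * q = 0 by rewrite /g /q; eu_simp.
have gr : g * r = 0 by rewrite /g /r; eu_simp.
have qg : q * g = 0 by rewrite /g /q; eu_simp.
have rg : r * g = 0 by rewrite /g /r; eu_simp.
have qq : q * q = 0 by rewrite /q; eu_simp.
have qr : q * r = 0 by rewrite /q /r; eu_simp.
have rq : r * q = 0 by rewrite /q /r; eu_simp.
have rr : r * r = 0 by rewrite /r; eu_simp.
have hf : f \in D false by rewrite DE; apply: memv_graded; rewrite !inE eqxx ?orbT.
have hg : g \in D d by rewrite DE; apply: memv_graded; rewrite !inE eqxx ?orbT.
have hq : q \in D d by rewrite DE; apply: memv_graded; rewrite !inE eqxx ?orbT.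
have hr : r \in D d by rewrite DE; apply: memv_graded; rewrite !inE eqxx ?orbT.
have sD x y : reflection (x + y) = reflection x + reflection y :> 'M[F]_6.
  by have := reflection_lin 1 x y; rewrite !scale1r.
have sZ c x : reflection (c *: x) = c *: reflection x :> 'M[F]_6.
  exact: (linear_funZ (@reflection_lin F)).
have sf : reflection f = f by rewrite /f sD !reflection_eu // addrC.
have sg : reflection g = (-1) ^+ eps *: g.
  rewrite /g sD sZ !reflection_eu // scalerDr scalerA -signr_addb addbb scale1r.
  by rewrite addrC.
have sq : reflection q = r by rewrite /q reflection_eu.
have sr : reflection r = q by rewrite /r reflection_eu.
have mulE := (fq, fr, qf, rf, gq, gr, qg, rg, qq, qr, rq, rr).
have two : 2%:R != 0 :> F by apply: (natr_neq0_char charF0).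
have nz : (-1) ^+ eps *: r - q != 0.
  apply/eqP => /matrixP/(_ 0 2); rewrite !mxE /= mulr0 sub0r.
  by move/eqP; rewrite oppr_eq0 oner_eq0.
pose X0 : seq 'M[F]_6 := [:: 1; f; g; q; r].
have {VE} VE : V = <<X0>>%VS by rewrite VE.
(* From here on the matrices are opaque; the relations recorded above suffice. *)
rewrite /X0 {X0} in VE; clearbody f g q r.
apply: (@core_is_model F charF0 _ _ _ _ H ty0 (d, eps) f g
  [:: ((d, false), q + r); ((d, true), q - r)]).
- by move=> p; rewrite !inE => /or4P[]/eqP-> //; [apply: memvD | apply: memvB].
- move=> p; rewrite !inE => /or4P[]/eqP-> //=; rewrite ?sf ?scale1r //.
    by rewrite sD sq sr addrC.
  by rewrite -[- r]scaleN1r sD sZ sq sr !scaleN1r opprB addrC.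
- pose X : seq 'M[F]_6 := [:: 1; f; g; q + r; q - r].
  suff : (V <= <<X>>)%VS by [].
  rewrite VE; apply/span_subvP => x; rewrite !inE.
  have mem y : y \in X -> y \in <<X>>%VS by exact: memv_span.
  have half y z : y = 2%:R^-1 *: (z : 'M[F]_6) -> z \in <<X>>%VS -> y \in <<X>>%VS.
    by move=> ->; apply: memvZ.
  case/or4P=> [|||/orP[]] /eqP->.
  + by apply: mem; rewrite !inE eqxx.
  + by apply: mem; rewrite !inE eqxx ?orbT.
  + by apply: mem; rewrite !inE eqxx ?orbT.
  + apply: (half _ ((q + r) + (q - r))).
      by rewrite addrACA subrr addr0 -mulr2n -scaler_nat scalerA mulVf // scale1r.
    by apply: memvD; apply: mem; rewrite !inE eqxx ?orbT.
  + apply: (half _ ((q + r) - (q - r))).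
      by rewrite opprB addrC addrA subrK -mulr2n -scaler_nat scalerA mulVf // scale1r.
    by apply: memvB; apply: mem; rewrite !inE eqxx ?orbT.
- move=> p; rewrite !inE => /orP[]/eqP-> /=.
    split; rewrite ?(mulrDl, mulrDr, mulNr, mulrN) ?mulE ?oppr0 ?addr0 //.
    by move=> p'; rewrite !inE => /orP[]/eqP-> /=;
      rewrite ?(mulrDl, mulrDr, mulNr, mulrN) ?mulE ?oppr0 ?addr0.
  split; rewrite ?(mulrDl, mulrDr, mulNr, mulrN) ?mulE ?oppr0 ?addr0 //.
  by move=> p'; rewrite !inE => /orP[]/eqP-> /=;
    rewrite ?(mulrDl, mulrDr, mulNr, mulrN) ?mulE ?oppr0 ?addr0.
- by left.
- by rewrite fg -scalerAl rf scaler0.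
- by rewrite gf qg.
- by right.
- by rewrite /bracket /comm fg gf.
- move=> p pL; rewrite /core_types /brtype; move: pL.
  by rewrite inE => /orP[|]; rewrite ?inE => /eqP->; case: (d) (eps) => [] [].
Qed.

Lemma U3_star_model : is_model (U3_star F) true ty0 (false, false).
Proof.
apply: NU_is_model; first by rewrite U3E.
by move=> i; rewrite -(U3E F false) graded_span_triv.
Qed.

Lemma N3_star_model : is_model (N3_star F) true ty0 (false, true).
Proof.
apply: NU_is_model; first by rewrite N3E.
by move=> i; rewrite -(N3E F false) graded_span_triv.
Qed.

Lemma U3_star_gri_model : is_model (U3_star_gri F) true ty0 (true, false).
Proof.
apply: NU_is_model; first by rewrite U3E.
by move=> i; rewrite -(U3E F true) graded_span_elem.
Qed.

Lemma N3_star_gri_model : is_model (N3_star_gri F) true ty0 (true, true).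
Proof.
apply: NU_is_model; first by rewrite N3E.
by move=> i; rewrite -(N3E F true) graded_span_elem.
Qed.

End NUModels.

Section AllModels.
Variables (F : fieldType) (charF0 : [pchar F] =i pred0).

Lemma calItilde_sub (C : staralg F) : List.In C (calItilde F) -> List.In C (calI F).
Proof. by move=> h; do 4 right. Qed.

Ltac in_list := cbn [List.In];
  repeat match goal with
  | |- ?a = ?b \/ _ => first [constr_eq a b; left; reflexivity | right]
  end.

Ltac in_tilde := cbv [calItilde]; in_list.

(** Up to exchanging t and u there are 10 commutators of the four types and 6 anticommutators of the
    three types other than [ty0]; these 16 brackets correspond one to one to the members of
    [calItilde]. *)
Lemma tilde_model_exists s (t u : ty) : s || (t != ty0) && (u != ty0) ->
  exists2 C : staralg F, List.In C (calItilde F) & is_model C s t u \/ is_model C s u t.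
Proof.
have C1 := C3_i1_model charF0; have C2 := C3_i2_model charF0.
have C3 := C3_i3_model charF0.
have W1 := W_eta1_model charF0; have W2 := W_eta2_model charF0.
have W3 := W_eta3_model charF0.
have U1 := U3_star_model charF0; have U2 := U3_star_gri_model charF0.
have N1 := N3_star_model charF0; have N2 := N3_star_gri_model charF0.
have G1 : is_model (G2_psi_gr F) true (true, false) (true, false) := G2_is_model charF0 _ _ _ _.
have G2 : is_model (G2_tau F) true (false, true) (false, true) := G2_is_model charF0 _ _ _ _.
have G3 : is_model (G2_tau_gr F) true (true, true) (true, true) := G2_is_model charF0 _ _ _ _.
have G4 : is_model (G2_tau_gri F) true (false, true) (true, true) := G2_is_model charF0 _ _ _ _.
have G5 : is_model (G2_gamma_gr F) true (true, true) (true, false) := G2_is_model charF0 _ _ _ _.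
have G6 : is_model (G2_gamma_gri F) true (false, true) (true, false) := G2_is_model charF0 _ _ _ _.
case: s t u => [] [[] []] [[] []] // _;
  match goal with
  | h : is_model ?C ?s ?t ?u |- exists2 _, _ & is_model _ ?s ?t ?u \/ _ =>
      exists C; [in_tilde | left; exact: h]
  | h : is_model ?C ?s ?t ?u |- exists2 _, _ & is_model _ ?s ?u ?t \/ _ =>
      exists C; [in_tilde | right; exact: h]
  end.
Qed.

(** The additional brackets are the anticommutators of [ty0] with one of the other three types,
    realized by the three algebras C_2. *)
Lemma model_exists s (t u : ty) : s || (t != ty0) || (u != ty0) ->
  exists2 C : staralg F, List.In C (calI F) &
    is_model C s t u /\ (s || (t != ty0) && (u != ty0) -> List.In C (calItilde F)).
Proof.
move=> h; have [/tilde_model_exists[C hC hm]|nt] := boolP (s || (t != ty0) && (u != ty0)).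
  exists C; first exact: calItilde_sub.
  by split=> //; case: hm => // /is_model_sym.
have D1 := C2_gr_model charF0; have D2 := C2_star_model charF0.
have D3 := C2_star_gr_model charF0.
suff [C hC hm] : exists2 C : staralg F, List.In C [:: C2_gr F; C2_star F; C2_star_gr F] &
    is_model C s t u \/ is_model C s u t.
  exists C; first by case: hC => [<-|[<-|[<-|[]]]]; right; [left|right;left|right;right;left].
  by split=> //; case: hm => // /is_model_sym.
case: s t u h nt => [] [[] []] [[] []] // _ _;
  match goal with
  | h : is_model ?C ?s ?t ?u |- exists2 _, _ & is_model _ ?s ?t ?u \/ _ =>
      exists C; [in_list | left; exact: h]
  | h : is_model ?C ?s ?t ?u |- exists2 _, _ & is_model _ ?s ?u ?t \/ _ =>
      exists C; [in_list | right; exact: h]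
  end.
Qed.

End AllModels.

(** * Codimension growth *)

Section QuotientDim.
Variables (F : fieldType) (V : lmodType F) (P Q : V -> Prop) (d : nat).
Hypothesis (P0 : P 0) (PD : forall (c : F) x y, P x -> P y -> P (c *: x + y)).
Hypothesis (Q0 : Q 0) (QD : forall (c : F) x y, Q x -> Q y -> Q (c *: x + y)).

Lemma row_ker_exists m k (M : 'M[F]_(m, k)) : (k < m)%N ->
  exists2 u : 'rV[F]_m, u != 0 & u *m M = 0.
Proof.
move=> km; have : kermx M != 0.
  rewrite kermx_eq0 /row_free; apply: contraTneq km => e.
  by rewrite -leqNgt -[X in (X <= _)%N]e rank_leq_col.
case/rowV0Pn=> u /sub_kermxP uM u0; by exists u.
Qed.

Lemma sum_closed (I : finType) (c : I -> F) (f : I -> V) :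
  (forall i, P (f i)) -> P (\sum_i c i *: f i).
Proof. by move=> h; elim/big_rec: _ => // i x _; apply: PD. Qed.

Lemma quotient_dim_ge (k : nat) (f : 'I_k -> V) :
  quotient_dim P Q d -> (forall j, P (f j)) ->
  (forall c : 'I_k -> F, Q (\sum_j c j *: f j) -> forall j, c j = 0) -> (k <= d)%N.
Proof.
move=> [b [Pb span _]] Pf find; rewrite leqNgt; apply/negP => dk.
have [M hM] := choice (fun j => span (f j) (Pf j)).
have [u u0 uM] := row_ker_exists (\matrix_(j < k, i < d) M j i) dk.
case/negP: u0; apply/eqP/rowP => j; rewrite mxE; move: j.
apply: find.
have -> : \sum_j u 0 j *: f j = \sum_j u 0 j *: (f j - \sum_i M j i *: b i).
  rewrite [RHS](eq_bigr (fun j => u 0 j *: f j - \sum_i (u 0 j * M j i) *: b i)).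
    rewrite sumrB exchange_big /= [X in _ - X]big1 ?subr0 // => i _.
    rewrite -scaler_suml.
    have := congr1 (fun A : 'rV_d => A 0 i) uM; rewrite !mxE => e.
    suff -> : \sum_j u 0 j * M j i = 0 by rewrite scale0r.
    by rewrite -[RHS]e; apply: eq_bigr => j _; rewrite mxE.
  by move=> j _; rewrite scalerBr scaler_sumr; congr (_ - _); apply: eq_bigr => i _; rewrite scalerA.
elim/big_rec: _ => // j x _; apply: QD; by case: (hM j).
Qed.

(** Here phi assigns k invariants whose vanishing forces membership in Q. It is a relation, so the
    coefficients defining the invariants need not be unique. *)
Lemma quotient_dim_le (k : nat) (phi : V -> ('I_k -> F) -> Prop) :
  quotient_dim P Q d -> (forall x, P x -> exists a, phi x a) ->
  (forall (I : finType) (c : I -> F) (f : I -> V) (a : I -> 'I_k -> F),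
     (forall i, phi (f i) (a i)) -> (forall j, \sum_i c i * a i j = 0) ->
     Q (\sum_i c i *: f i)) ->
  (d <= k)%N.
Proof.
move=> [b [Pb _ ind_b]] hphi sep; rewrite leqNgt; apply/negP => kd.
have [M hM] := choice (fun i => hphi (b i) (Pb i)).
have [u u0 uM] := row_ker_exists (\matrix_(i < d, j < k) M i j) kd.
case/negP: u0; apply/eqP/rowP => i; rewrite mxE; move: i.
apply: ind_b; split; first exact: sum_closed.
apply: (sep _ _ _ M) => // j.
have := congr1 (fun A : 'rV_k => A 0 j) uM; rewrite !mxE => e.
by rewrite -[RHS]e; apply: eq_bigr => i _; rewrite mxE.
Qed.

End QuotientDim.

(** * Values of multilinear polynomials *)

Section Multilinear.
Variables (F : fieldType).

Lemma prod_fvar (l : seq var) : \prod_(x <- l) fvar F x = mkmalgU (FMonom l) 1.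
Proof.
elim: l => [|x l IH]; first by rewrite big_nil -fmoneE.
rewrite big_cons IH /fvar malgM_def fgmulUU mulr1 fmuE; congr (mkmalgU _ 1).
exact: (fmmulE (FMonom [:: x]) (FMonom l)).
Qed.

Variable A : staralg F.

Lemma feval_is_linear (v : var -> A) c f g : feval v (c *: f + g) = c *: feval v f + feval v g.
Proof.
rewrite /feval mmapD; congr (_ + _).
rewrite (mmapEw (msuppZ_le _ _)) mmapE scaler_sumr; apply: eq_bigr => k _.
by rewrite mcoeffZ /= !mulr_algl scalerA.
Qed.

Lemma feval_word (v : var -> A) l : feval v (\prod_(x <- l) fvar F x) = wval v l.
Proof. by rewrite prod_fvar /feval mmapU /= mulr_algl scale1r. Qed.

Lemma feval0 (v : var -> A) : feval v 0 = 0.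
Proof. by rewrite /feval mmap0. Qed.

Lemma feval_sum (v : var -> A) (I : finType) (c : I -> F) (f : I -> freestar F) :
  feval v (\sum_i c i *: f i) = \sum_i c i *: feval v (f i).
Proof.
elim/big_rec2: _ => [|i x y _ <-]; first exact: feval0.
exact: feval_is_linear.
Qed.

Lemma Idstar_adm (f : freestar F) :
  Idstar A f <-> forall v : var -> A, adm v -> feval v f = 0.
Proof.
split=> h v hv; apply: h; first by move=> i e j; apply: (hv ((i, e), j)).
by case=> [[i e] j]; apply: hv.
Qed.

Lemma Idstar0 : Idstar A 0.
Proof. by move=> v _; rewrite feval0. Qed.

Lemma IdstarP (c : F) f g : Idstar A f -> Idstar A g -> Idstar A (c *: f + g).
Proof. by move=> hf hg v hv; rewrite feval_is_linear hf // hg // scaler0 addr0. Qed.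

Lemma Pstar0 n : @Pstar F n 0.
Proof. by exists (fun=> 0); rewrite big1 // => p _; rewrite scale0r. Qed.

Lemma PstarP n (c : F) f g : @Pstar F n f -> @Pstar F n g -> @Pstar F n (c *: f + g).
Proof.
move=> [a ->] [b ->]; exists (fun p => c * a p + b p).
by rewrite scaler_sumr -big_split; apply: eq_bigr => p _; rewrite scalerDl scalerA.
Qed.

Definition mlword n (s : 'S_n) (w : {ffun 'I_n -> bool * bool}) : seq var :=
  [seq (w (s k), s k : nat) | k <- enum 'I_n].

Lemma mlmonomE n (s : 'S_n) w : mlmonom F s w = \prod_(x <- mlword s w) fvar F x.
Proof. by rewrite /mlmonom /mlword big_map enumT unlock. Qed.

Lemma Pstar_word n (l : seq 'I_n) (w : {ffun 'I_n -> bool * bool}) :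
  perm_eq l (enum 'I_n) ->
  @Pstar F n (\prod_(j <- l) fvar F (w j, j : nat)).
Proof.
move=> hl; have /tuple_permP[s es] : perm_eq l (ord_tuple n) by move: hl; rewrite -val_ord_tuple.
exists (fun p => ((p.1 == s) && (p.2 == w))%:R).
rewrite (bigD1 (s, w)) //= !eqxx scale1r [X in _ = _ + X]big1 ?addr0; last first.
  case=> s' w' /= ne.
  have [/andP[/eqP e1 /eqP e2]|_] := boolP ((s' == s) && (w' == w)); last by rewrite scale0r.
  by rewrite e1 e2 eqxx in ne.
rewrite mlmonomE /mlword big_map.
have -> : l = [seq tnth (ord_tuple n) (s i) | i <- enum 'I_n].
  by rewrite es /= -val_ord_tuple.
by rewrite big_map; apply: eq_bigr => i _; rewrite tnth_ord_tuple.
Qed.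

End Multilinear.

(** * Cubic lower bound from a proper polynomial of degree 3 *)

Section Lower.
Variables (F : fieldType) (A : staralg F).
Variables (t : 'I_3 -> ty) (terms : seq (F * seq 'I_3)).
Hypothesis terms_perm : forall p, p \in terms -> perm_eq p.2 (enum 'I_3).

Definition peval (z : 'I_3 -> A) : A := \sum_(p <- terms) p.1 *: \prod_(k <- p.2) z k.

Hypothesis proper : forall z : 'I_3 -> A, (forall k, pure (t k) (z k)) ->
  (exists k, z k = (t k == ty0)%:R) -> peval z = 0.

Variable z0 : 'I_3 -> A.
Hypothesis z0_pure : forall k, pure (t k) (z0 k).
Hypothesis z0_neq0 : peval z0 != 0.
Variable m : nat.

Fact pos_proof (a : {ffun 'I_3 -> 'I_m}) (k : 'I_3) : (k * m + a k < 3 * m)%N.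
Proof. have := ltn_ord k; have := ltn_ord (a k); nia. Qed.
Definition pos a k : 'I_(3 * m) := Ordinal (pos_proof a k).

Lemma pos_eq a b k l : pos a k = pos b l -> k = l /\ a k = b l.
Proof.
move/(congr1 val) => /= e; have ha := ltn_ord (a k); have hb := ltn_ord (b l).
have kl : k = l.
  apply: val_inj => /=; have := congr1 (divn^~ m) e.
  by rewrite !divnMDl ?(divn_small ha) ?(divn_small hb) ?addn0 //; lia.
by split=> //; apply: val_inj => /=; move: e; rewrite kl; lia.
Qed.

Definition ptype a : {ffun 'I_(3 * m) -> bool * bool} :=
  [ffun j => if [pick k | pos a k == j] is Some k then t k else ty0].

Definition outer a := [seq j <- enum 'I_(3 * m) | j \notin codom (pos a)].

Definition pword a (w : seq 'I_3) := outer a ++ [seq pos a k | k <- w].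

Lemma pword_perm a w : perm_eq w (enum 'I_3) -> perm_eq (pword a w) (enum 'I_(3 * m)).
Proof.
move=> hw; apply: uniq_perm; rewrite ?enum_uniq //.
  rewrite cat_uniq filter_uniq ?enum_uniq //= map_inj_uniq; last first.
    by move=> k l /pos_eq[].
  rewrite (perm_uniq hw) enum_uniq andbT; apply/hasPn => j /mapP[k _ ->].
  by rewrite /= mem_filter codom_f.
move=> j; rewrite mem_enum mem_cat mem_filter mem_enum andbT.
have [/codomP[k ->]|//] := boolP (j \in codom (pos a)).
by rewrite /= map_f // (perm_mem hw) mem_enum.
Qed.

Definition ppoly a : freestar F :=
  \sum_(p <- terms) p.1 *: \prod_(j <- pword a p.2) fvar F (ptype a j, j : nat).

Lemma ppoly_Pstar a : @Pstar F (3 * m) (ppoly a).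
Proof.
rewrite /ppoly big_seq; elim/big_rec: _ => [|p f pt hf]; first exact: Pstar0.
by apply: PstarP => //; apply: Pstar_word; apply/pword_perm/terms_perm.
Qed.

(** Variables that are not chosen receive 1 or 0, the values at which [proper] makes the polynomial
    vanish. Types are compared as well, because one position can carry different types in different
    [ppoly b]. *)
Definition point a (x : var) : A :=
  if [pick k | (pos a k == x.2 :> nat) && (t k == x.1)] is Some k then z0 k
  else (x.1 == ty0)%:R.

Lemma point_adm a : adm (point a).
Proof.
move=> x; rewrite /point; case: pickP => [k /andP[_ /eqP<-]|_]; first exact: z0_pure.
by case: eqP => [->|_]; [exact: pure1 | exact: pure0].
Qed.

Lemma ptype_pos a k : ptype a (pos a k) = t k.
Proof.
rewrite ffunE; case: pickP => [l /eqP/pos_eq[-> //]|/(_ k)]; by rewrite eqxx.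
Qed.

Lemma feval_ppoly a b : feval (point a) (ppoly b) =
  (\prod_(j <- outer b) point a (ptype b j, j : nat)) *
  peval (fun k => point a (t k, pos b k : nat)).
Proof.
rewrite /ppoly /peval big_distrr /=.
elim: terms => [|p r IH]; first by rewrite !big_nil feval0.
rewrite !big_cons feval_is_linear IH; congr (_ + _); rewrite -scalerAr; congr (_ *: _).
have -> : \prod_(j <- pword b p.2) fvar F (ptype b j, j : nat) =
   \prod_(x <- [seq (ptype b j, j : nat) | j <- pword b p.2]) fvar F x by rewrite big_map.
rewrite feval_word /wval big_map /pword big_cat big_map /=; congr (_ * _).
by apply: eq_bigr => k _; rewrite ptype_pos.
Qed.

Lemma feval_ppoly_eq a : feval (point a) (ppoly a) = peval z0.
Proof.
rewrite feval_ppoly big_seq big1 ?mul1r => [|j]; last first.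
  rewrite mem_filter => /andP[ja _].
  have nopos k : (pos a k == j) = false.
    by apply/eqP => e; case/negP: ja; rewrite -e codom_f.
  rewrite ffunE; case: pickP => [k|_]; first by rewrite nopos.
  rewrite /point; case: pickP => [k /andP[/eqP/val_inj e _]|_]; last by rewrite eqxx.
  by have := nopos k; rewrite e eqxx.
congr peval; apply: funext => k; rewrite /point.
case: pickP => [l /andP[/eqP/val_inj/pos_eq[-> //]]|/(_ k)].
by rewrite /= !eqxx.
Qed.

(** If b and a differ in block k, the letter of [ppoly b] in that block is not chosen by [point a],
    so [proper] applies. *)
Lemma feval_ppoly_neq a b : b != a -> feval (point a) (ppoly b) = 0.
Proof.
move=> ba; rewrite feval_ppoly proper ?mulr0 // => [k|].
  exact: (point_adm a (t k, pos b k : nat)).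
have [k bk] : exists k, b k != a k.
  apply/existsP; rewrite -negb_forall; apply: contraNN ba => /forallP h.
  by apply/eqP/ffunP => k; apply/eqP.
exists k; rewrite /point; case: pickP => [l /andP[/eqP/val_inj/pos_eq[e1 e2] _]|//].
by move: bk; rewrite -e2 e1 eqxx.
Qed.

(* Choosing one position in each of three blocks of length m gives m^3 proper
   polynomials, padded with symmetric even variables; [point a] kills all of them
   but the one at a. *)
Lemma codim_ge_cube d : is_codim A (3 * m) d -> (m ^ 3 <= d)%N.
Proof.
move=> hd; have -> : (m ^ 3 = #|{: {ffun 'I_3 -> 'I_m}}|)%N by rewrite card_ffun !card_ord.
apply: (@quotient_dim_ge F (freestar F) (@Pstar F (3 * m)) (Idstar A) d
  (@Idstar0 F A) (@IdstarP F A) _ (fun j => ppoly (enum_val j)) hd).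
  by move=> j; apply: ppoly_Pstar.
move=> c hc j; pose v := point (enum_val j).
have e : \sum_i c i *: feval v (ppoly (enum_val i)) = 0.
  by rewrite -feval_sum; apply: (Idstar_adm _ _).1 => //; exact: point_adm.
have ne i : i != j -> c i *: feval v (ppoly (enum_val i)) = 0.
  by move=> ij; rewrite feval_ppoly_neq ?scaler0 // (inj_eq enum_val_inj).
move: e; rewrite (bigD1 j isT) /= [X in _ + X](big1 _ _ _ ne) addr0 feval_ppoly_eq => /eqP.
by rewrite scaler_eq0 (negPf z0_neq0) orbF => /eqP.
Qed.

End Lower.

(** * Linear upper bound when no quadratic bracket is present *)

Section Upper.
Variables (F : fieldType) (charF0 : [pchar F] =i pred0) (A : staralg F).
Hypothesis nilA : nil3 A.
Hypothesis noprof : forall s (t u : ty), s || (t != ty0) && (u != ty0) -> ~ prof A s t u.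

(** Since [ty] contains [ty0], some assignments arise from several o; this makes the bound 4n + 1
    rather than 3n + 1. *)
Definition one_skew n (o : option ('I_n * ty)) : {ffun 'I_n -> bool * bool} :=
  [ffun j => if o is Some p then (if j == p.1 then p.2 else ty0) else ty0].

Lemma one_skew_onto n (w : {ffun 'I_n -> bool * bool}) :
  (size [seq x <- mlword 1 w | skewvar x] <= 1)%N -> exists o, w = one_skew o.
Proof.
move=> hs; have [/existsP[k wk]|w0] := boolP [exists k, w k != ty0]; last first.
  exists None; apply/ffunP => j; rewrite ffunE; apply/eqP.
  by move: w0; rewrite negb_exists => /forallP/(_ j); rewrite negbK.
exists (Some (k, w k)); apply/ffunP => j; rewrite ffunE /=.
case: eqP => [->//|/eqP jk]; apply/eqP; apply: contraTT hs => wj.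
have mem i : w i != ty0 -> (w i, i : nat) \in [seq x <- mlword 1 w | skewvar x].
  move=> wi; rewrite mem_filter; apply/andP; split=> //; apply/mapP; exists i; rewrite ?mem_enum //.
  by rewrite perm1.
rewrite -ltnNge; apply: (@uniq_leq_size _ [:: (w j, j : nat); (w k, k : nat)]).
  rewrite /= andbT inE; apply: contraNN jk => /eqP[_ e].
  by apply/eqP/val_inj.
by move=> x; rewrite !inE => /orP[] /eqP->; apply: mem.
Qed.

(* Without commutators and products of two other variables, a multilinear value
   depends only on which variable, if any, is not symmetric even. *)
Lemma codim_le_linear n d : is_codim A n d -> (d <= 4 * n + 1)%N.
Proof.
move=> hd; have -> : (4 * n + 1 = #|{: option ('I_n * ty)}|)%N.
  by rewrite card_option card_prod card_ord card_prod !card_bool addn1 mulnC.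
(* The invariants are the coefficient sums over all orders of the letters, one for each type
   assignment with at most one entry other than [ty0]. *)
pose phi (x : freestar F) (a : 'I_#|{: option ('I_n * ty)}| -> F) :=
  exists2 c : 'S_n * {ffun 'I_n -> bool * bool} -> F,
    x = \sum_p c p *: mlmonom F p.1 p.2 &
    forall j, a j = \sum_s c (s, one_skew (enum_val j)).
apply: (quotient_dim_le (Pstar0 F n) (@PstarP F n) (phi := phi) hd).
  by move=> x [c ex]; exists (fun j => \sum_s c (s, one_skew (enum_val j))); exists c.
move=> I k f a hphi hk.
have [c hc ha] : exists2 c : I -> 'S_n * {ffun 'I_n -> bool * bool} -> F,
    forall i, f i = \sum_p c i p *: mlmonom F p.1 p.2 &
    forall i j, a i j = \sum_s c i (s, one_skew (enum_val j)).
  have [c hc] := choice (fun i => let: ex_intro2 c h1 h2 := hphi i in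
     ex_intro (fun c => f i = \sum_p c p *: mlmonom F p.1 p.2 /\
        forall j, a i j = \sum_s c (s, one_skew (enum_val j))) c (conj h1 h2)).
  by exists c => [i|i j]; case: (hc i).
apply/Idstar_adm => v vp.
pose e p := \sum_i k i * c i p.
have -> : \sum_i k i *: f i = \sum_p e p *: mlmonom F p.1 p.2.
  under eq_bigr do rewrite hc scaler_sumr.
  rewrite exchange_big; apply: eq_bigr => p _; rewrite /e scaler_suml.
  by apply: eq_bigr => i _; rewrite scalerA.
rewrite feval_sum (eq_bigr (fun p => e (p.1, p.2) *: wval v (mlword p.1 p.2))); last first.
  by case=> s w _; rewrite mlmonomE feval_word.
rewrite -(pair_bigA _ (fun s w => e (s, w) *: wval v (mlword s w))) exchange_big /=.
apply: big1 => w _.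
(* For a fixed type assignment all words have the same letters, so the criterion for a single
   multiset applies. *)
have hperm (s : 'S_n) : perm_eq (mlword s w) (mlword 1 w).
  have inj : injective (fun k : 'I_n => (w k, k : nat)) by move=> i j [_ /val_inj].
  have -> : mlword s w = [seq (w k, k : nat) | k <- [seq s k | k <- enum 'I_n]].
    by rewrite -map_comp.
  have -> : mlword 1 w = [seq (w k, k : nat) | k <- enum 'I_n].
    by apply: eq_map => i; rewrite perm1.
  apply/perm_map/uniq_perm; [|exact: enum_uniq|move=> i].
    by rewrite (map_inj_uniq (@perm_inj _ s)) enum_uniq.
  rewrite mem_enum; apply/mapP; exists (s^-1%g i); rewrite ?mem_enum //.
  by rewrite permKV.
transitivity (content_val (index_enum _) (fun s => e (s, w)) (fun s => mlword s w) (mlword 1 w) v).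
  by apply/esym/eq_bigl => s; rewrite hperm.
apply: (content_cond_val charF0 nilA vp); split=> [|x y _ _ _ _ /noprof []//].
have all_skew := filter_all skewvar (mlword 1 w).
case ez : [seq x <- mlword 1 w | skewvar x] => [|x [|y r]] sz.
- move=> _; have [|o wo] := @one_skew_onto n w; first by rewrite ez.
  rewrite /content_sum (eq_bigl predT) => [|s]; last by rewrite /= hperm.
  rewrite /e exchange_big /= -[RHS](hk (enum_rank o)); apply: eq_bigr => i _.
  by rewrite -mulr_sumr ha enum_rankK -wo.
- move=> _; have [|o wo] := @one_skew_onto n w; first by rewrite ez.
  rewrite /content_sum (eq_bigl predT) => [|s]; last by rewrite /= hperm.
  rewrite /e exchange_big /= -[RHS](hk (enum_rank o)); apply: eq_bigr => i _.
  by rewrite -mulr_sumr ha enum_rankK -wo.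
(* With two letters that are not symmetric even, [noprof] excludes the anticommutator in
   question. *)
move: all_skew; rewrite ez /= => /and3P[hx hy _].
by case/noprof; rewrite /=; apply/andP.
Qed.

End Upper.

(** * Consequences of quadratic growth *)

Section Growth.
Variables (R : realType) (F : fieldType) (A : staralg F).
Hypothesis growthA : quadratic_growth R A.

Lemma quadratic_growth_bounds : exists c : nat -> nat,
  [/\ forall n, is_codim A n (c n),
      exists m, (c (3 * m) < m ^ 3)%N & exists n, (4 * n + 1 < c n)%N].
Proof.
have [c hc [alpha a0 cv]] := growthA; exists c.
(* The tolerance 1/2 keeps the absolute value of the quotient between 1/2 and 2. Absolute values are
   taken since [alpha] is only known to be nonzero. *)
have [N _ hN] : exists2 N, True & forall n, (N <= n)%N ->
    `|1 - (c n)%:R / (alpha * n%:R ^+ 2)| < 2%:R^-1 :> R.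
  have h2 : 0 < 2%:R^-1 :> R by rewrite invr_gt0 ltr0n.
  have := (cvgrPdist_lt _ _).1 cv _ h2.
  by case=> N _ h; exists N => // n hn; apply: h.
have b0 : 0 < `|alpha| by rewrite normr_gt0.
(* The strict inequality makes n positive, hence the denominator nonzero. *)
have bounds n : (N < n)%N ->
    2%:R^-1 * `|alpha| * n%:R ^+ 2 < (c n)%:R < 2%:R * `|alpha| * n%:R ^+ 2.
  move=> hn; have := hN n (ltnW hn).
  have n0 : 0 < n%:R ^+ 2 :> R by rewrite exprn_gt0 // ltr0n; lia.
  set q := (c n)%:R / _ => hq.
  have cE : (c n)%:R = `|q| * `|alpha| * n%:R ^+ 2.
    rewrite /q normrM normfV normrM (gtr0_norm n0) normr_nat -mulrA mulfVK //.
    by rewrite mulf_neq0 // gt_eqF.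
  have q1 : 2%:R^-1 < `|q|.
    have := ler_normD (1 - q) q; rewrite subrK normr1; lra.
  have q2 : `|q| < 2%:R.
    have := ler_normD (q - 1) 1; rewrite subrK normr1 distrC; lra.
  rewrite cE !ltr_pM2r // q1 q2 //.
split=> //.
(* The upper bound at 3m is 2|alpha|(3m)^2 = 18|alpha|m^2, which is at most m^3 once m exceeds
   18|alpha|. *)
- pose m := maxn N.+1 (Num.bound (18%:R * `|alpha|)); exists m.
  have hm : 18%:R * `|alpha| < m%:R.
    apply: lt_le_trans (archi_boundP _) _; first by rewrite mulr_ge0.
    by rewrite ler_nat leq_maxr.
  have m0 : (N < m)%N by rewrite leq_maxl.
  have /andP[_ h] : _ := bounds (3 * m)%N ltac:(lia).
  rewrite -(ltr_nat R) (lt_le_trans h) // natrX natrM.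
  have mp : 0 <= m%:R ^+ 2 :> R by rewrite exprn_ge0.
  have := ler_wpM2r mp (ltW hm); rewrite -exprS => h'.
  by apply: le_trans h'; rewrite le_eqVlt; apply/orP; left; apply/eqP; ring.
(* For n > 12/|alpha| the lower bound |alpha|n^2/2 is at least 6n, hence at least 4n + 1. *)
pose n := maxn N.+1 (Num.bound (12%:R / `|alpha|)); exists n.
have hn : 12%:R / `|alpha| < n%:R.
  apply: lt_le_trans (archi_boundP _) _; first by rewrite divr_ge0.
  by rewrite ler_nat leq_maxr.
have n0 : (N < n)%N by rewrite leq_maxl.
have /andP[h _] := bounds n n0.
rewrite -(ltr_nat R); apply: le_lt_trans h.
move: hn; rewrite ltr_pdivrMr // => /ltW hn.
have n1 : 1 <= n%:R :> R by rewrite ler1n; lia.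
have := ler_wpM2r (le_trans ler01 n1) hn.
rewrite natrD natrM; nra.
Qed.

End Growth.

Section Nil3OfGrowth.
Variables (F : fieldType) (A : staralg F) (c : nat -> nat).
Hypothesis codimA : forall n, is_codim A n (c n).
Variable m : nat.
Hypothesis c_small : (c (3 * m) < m ^ 3)%N.

Let o0 : 'I_3 := @Ordinal 3 0 isT.
Let o1 : 'I_3 := @Ordinal 3 1 isT.
Let o2 : 'I_3 := @Ordinal 3 2 isT.

(** A nonzero value would produce m^3 polynomials of degree 3m independent modulo the identities,
    more than [c (3 * m)]. *)
Lemma proper3_eq0 (t u v : ty) (x y z : A) (terms : seq (F * seq 'I_3)) :
  (forall p, p \in terms -> perm_eq p.2 (enum 'I_3)) ->
  (forall a : 'I_3 -> A, pure t (a o0) -> pure u (a o1) -> pure v (a o2) ->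
     [\/ a o0 = (t == ty0)%:R, a o1 = (u == ty0)%:R | a o2 = (v == ty0)%:R] ->
     peval terms a = 0) ->
  pure t x -> pure u y -> pure v z ->
  peval terms (fun k => if k == o0 then x else if k == o1 then y else z) = 0.
Proof.
move=> hperm hproper hx hy hz; apply/eqP; apply: contraTT c_small => h.
rewrite -leqNgt.
pose tt k := if k == o0 then t else if k == o1 then u else v.
apply: (@codim_ge_cube F A tt terms hperm _ _ _ h) => // [a ha [k hk]|k].
- apply: hproper; [exact: (ha o0) | exact: (ha o1) | exact: (ha o2) |].
  have : [\/ k = o0, k = o1 | k = o2].
    case: k {hk} => [[|[|[|//]]] i];
    [apply: Or31 | apply: Or32 | apply: Or33]; exact: val_inj.
  by case=> e; rewrite e in hk; [apply: Or31 | apply: Or32 | apply: Or33].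
- by rewrite /tt; case: (k == o0) => //; case: (k == o1).
Qed.

Lemma enum3_perm (s : seq 'I_3) : perm_eq (map val s) [:: 0; 1; 2]%N -> perm_eq s (enum 'I_3).
Proof.
by move=> h; apply: (perm_map_inj val_inj); rewrite val_enum_ord.
Qed.

Lemma comm_boolr (b : bool) (a : A) : comm a b%:R = 0.
Proof. by case: b; rewrite ?comm1r ?comm0r. Qed.

Lemma comm_booll (b : bool) (a : A) : comm b%:R a = 0.
Proof. by case: b; rewrite ?comm1l ?comm0l. Qed.

(** Each of the three polynomials vanishes when a symmetric even argument is 1 or another argument
    is 0, because symmetric even arguments are allowed only inside commutators. *)
Lemma nil3_of_growth : nil3 A.
Proof.
split.
- move=> t u v x y z hx hy hz.
  pose terms : seq (F * seq 'I_3) :=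
    [:: (1, [:: o0; o1; o2]); (-1, [:: o0; o2; o1]); (-1, [:: o1; o2; o0]); (1, [:: o2; o1; o0])].
  have E a : peval terms a = comm (a o0) (comm (a o1) (a o2)) :> A.
    rewrite /peval /terms !big_cons !big_nil /= !scale1r !scaleN1r !mulr1 addr0.
    by rewrite /comm mulrBr mulrBl opprB !mulrA -!addrA; congr (_ + (_ + _)); rewrite addrC.
  have := @proper3_eq0 t u v x y z terms; rewrite E /=; apply=> //.
    by move=> p; rewrite !inE => /or4P[]/eqP->; apply: enum3_perm.
  move=> a _ _ _; rewrite E.
  by case=> ->; rewrite ?comm_boolr ?comm_booll ?comm0r.
- move=> t u v x y z t0 hx hy hz.
  pose terms : seq (F * seq 'I_3) := [:: (1, [:: o0; o1; o2]); (-1, [:: o0; o2; o1])].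
  have E a : peval terms a = a o0 * comm (a o1) (a o2) :> A.
    rewrite /peval /terms !big_cons !big_nil /= !scale1r !scaleN1r !mulr1 addr0.
    by rewrite /comm mulrBr.
  have := @proper3_eq0 t u v x y z terms; rewrite E /=; apply=> //.
    by move=> p; rewrite !inE => /orP[]/eqP->; apply: enum3_perm.
  move=> a _ _ _; rewrite E (negPf t0).
  by case=> ->; rewrite ?comm_boolr ?comm_booll ?mul0r ?mulr0.
move=> t u v x y z t0 u0 v0 hx hy hz.
pose terms : seq (F * seq 'I_3) := [:: (1, [:: o0; o1; o2])].
have E a : peval terms a = a o0 * a o1 * a o2 :> A.
  by rewrite /peval /terms !big_cons !big_nil /= !scale1r !mulr1 addr0 mulrA.
have := @proper3_eq0 t u v x y z terms; rewrite E /=; apply=> //.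
  by move=> p; rewrite !inE => /eqP->; apply: enum3_perm.
move=> a _ _ _; rewrite E (negPf t0) (negPf u0) (negPf v0).
by case=> ->; rewrite ?(mul0r, mulr0).
Qed.

End Nil3OfGrowth.

(** * A direct sum with the profile of A *)

Lemma In_map (T U : Type) (f : T -> U) (s : seq T) (y : U) :
  List.In y [seq f x | x <- s] <-> exists2 x, List.In x s & y = f x.
Proof.
elim: s => [|x s IH] /=; first by split=> // -[].
split=> [[<-|h]|[z [<-|hz] e]].
- by exists x => //; left.
- by have [z hz ->] := IH.1 h; exists z => //; right.
- by left.
- by right; apply: IH.2; exists z.
Qed.

Lemma In_mem (T : eqType) (s : seq T) (x : T) : List.In x s <-> x \in s.
Proof.
elim: s => [|y s IH] /=; first by split.
rewrite in_cons; split=> [[->|h]|/orP[/eqP->|h]]; first by rewrite eqxx.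
- by rewrite (IH.1 h) orbT.
- by left.
- by right; apply: IH.2.
Qed.

Theorem theorem4p7 (R : realType) (F : fieldType)
    (charF0 : [pchar F] =i pred0) (A : staralg F)
    (growthA : quadratic_growth R A) :
  exists (B : staralg F) (s : seq (staralg F)),
    [/\ forall C, List.In C (B :: s) -> List.In C (calI F),
        exists2 C, List.In C (B :: s) & List.In C (calItilde F)
      & Tequiv A (dsum B s)].
Proof.
have [c [hc [m cm] [n cn]]] := quadratic_growth_bounds growthA.
have nilA := nil3_of_growth hc cm.
pose core (p : bool * ty * ty) := p.1.1 || (p.1.2 != ty0) || (p.2 != ty0).
pose proper2 (p : bool * ty * ty) := p.1.1 || (p.1.2 != ty0) && (p.2 != ty0).
have models p : exists C : staralg F, core p -> [/\ List.In C (calI F),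
    is_model C p.1.1 p.1.2 p.2 & proper2 p -> List.In C (calItilde F)].
  (* Outside [core] nothing is required of the chosen algebra; A serves as a default value. *)
  have [hp|hp] := boolP (core p); last by exists A.
  by have [C hC [hm ht]] := model_exists charF0 hp; exists C.
have [M hM] := choice models.
(* Otherwise the codimension at n would be at most 4n + 1. The model of this bracket is the summand
   from [calItilde]. *)
have [p0 p0A p0c] : exists2 p, prof A p.1.1 p.1.2 p.2 & proper2 p.
  apply: contrapT => h; have := codim_le_linear charF0 nilA (n := n) _ (hc n).
  rewrite leqNgt cn => /(_ _)/negP; apply=> // s t u stu hprof; apply: h.
  by exists (s, t, u).
have core_proper p : proper2 p -> core p.
  by rewrite /proper2 /core; case: p.1.1 => //= /andP[->].
(* Both orders of a pair of types are listed; repeated summands do not change the profile. *)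
pose present := [seq p <- enum {: bool * ty * ty} | core p && `[< prof A p.1.1 p.1.2 p.2 >]].
pose s := [seq M p | p <- present].
have presentP p : List.In p present <-> core p /\ prof A p.1.1 p.1.2 p.2.
  rewrite In_mem mem_filter mem_enum andbT; split=> [/andP[h /asboolP]//|[h1 h2]].
  by rewrite h1; apply/asboolP.
have sP C : List.In C (M p0 :: s) -> exists p, [/\ core p, prof A p.1.1 p.1.2 p.2 & C = M p].
  case=> [<-|/In_map[p /presentP[h1 h2] ->]]; last by exists p.
  by exists p0; split=> //; exact: core_proper.
exists (M p0), s; split.
- by move=> C /sP[p [hp _ ->]]; have [] := hM p hp.
- by exists (M p0); [left | have [_ _] := hM p0 (core_proper _ p0c); apply].
have nilB : nil3 (dsum (M p0) s).
  by apply: nil3_dsum => C /sP[p [hp _ ->]]; have [_ []] := hM p hp.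
have profE k t u : prof A k t u <-> prof (dsum (M p0) s) k t u.
  rewrite prof_dsum; split=> [h|[C /sP[p [hp pA ->]] hC]]; last first.
    have [_ [_ _ hprof] _] := hM p hp.
    exact: (core_profP charF0 pA (hprof _ _ _ hC)).
  have [hp|] := boolP (core (k, t, u)).
    exists (M (k, t, u)); first by right; apply/In_map; exists (k, t, u) => //; apply/presentP.
    by have [_ []] := hM _ hp.
  (* The only bracket outside [core] is the anticommutator of [ty0] with itself, which is nonzero on
     every algebra because of 1. *)
  rewrite /core /= !negb_or !negbK => /andP[/andP[/negPf-> /eqP->] /eqP->].
  by exists (M p0); [left | exact: prof0_ty0].
rewrite /Tequiv; apply/funext => f; apply/propext; split.
- by apply: (Idstar_mono charF0 nilA nilB) => k t u /profE.
- by apply: (Idstar_mono charF0 nilB nilA) => k t u /profE.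
Qed.
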